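(* Let $\lambda:[0,1]\to\mathbb R$ be continuous, suppose that the limit $$\kappa=\lim_{t\to1}\frac{\lambda(t)}{\sqrt{1-t}}$$ exists with $|\kappa|<4$, and assume there is $C<4$ such that $\lambda$ has local Lip $1/2$ norm less than $C$. Then the trace $\gamma$ driven by $\lambda$ is a Jordan arc (on $[0,1]$). Moreover, $\gamma(1)\in\mathbb H$ and $\gamma$ is asymptotically similar at $\gamma(1)$ to the logarithmic spiral $S_\theta$ with $\theta\in(-\pi/2,\pi/2)$, $\kappa=-4\sin\theta$.
   Context: $\mathbb H$ is the upper half-plane. For continuous real $\lambda$, let $g_t$ solve the Loewner equation $\frac{d}{dt}g_t(z)=\frac{2}{g_t(z)-\lambda(t)}$, $g_0(z)=z\in\mathbb H$, and let $K_t$ be the set of $z$ for which $|g_u(z)-\lambda(u)|\to0$ as $u\to T_z$ for some time $T_z\le t$; then $g_t$ is the conformal map of $\mathbb H\setminus K_t$ onto $\mathbb H$ with $g_t(z)=z+2t/z+O(1/z^2)$ at $\infty$. The trace of $\lambda$ is a continuous curve $\gamma$ in $\overline{\mathbb H}$ such that for each $t$, $\mathbb H\setminus K_t$ is the unbounded component of $\mathbb H\setminus\gamma[0,t]$. A Jordan arc is an injective continuous image of a closed interval. A function $\mu:[0,1)\to\mathbb R$ has local Lip $1/2$ norm $\le C$ if there is $\delta>0$ such that $|\mu(t)-\mu(t')|\le C|t-t'|^{1/2}$ for all $0\le t<t'<1$ with $|t-t'|<\delta(1-t)$. The logarithmic spiral is $S_\theta=\{e^{\tau e^{i\theta}}:\tau\in\mathbb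 R\}$, which accumulates at $0$ as $\tau\to-\infty$ (for $\theta=0$ it is the ray $(0,\infty)$). Asymptotic similarity of $\gamma$ to $S_\theta$ at $\gamma(1)$ means that suitably rescaled arcs of $\gamma$ near $\gamma(1)$ converge to arcs of $S_\theta$: with $\Gamma(s)=\gamma(1-e^{-s})$, for every $u>0$ the sets $\{(\Gamma(s+v)-\gamma(1))/(\Gamma(s)-\gamma(1)):0\le v\le u\}$ converge in the Hausdorff metric, as $s\to\infty$, to the arc $\{e^{-\tau e^{i\theta}}:0\le\tau\le u\cos\theta\}$. *)

(* Defs.v *)
From Stdlib Require Import Reals.
From Coquelicot Require Import Coquelicot.

Open Scope R_scope.

Definition upper_half_plane (z : C) : Prop := 0 < Im z.

(* The time derivative is taken within [0,T), hence one-sided at 0.  The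
   condition [g t <> lambda t] is needed because the inverse on [C] is total. *)
Definition loewner_solution (lambda : R -> R) (z : C) (T : R) (g : R -> C)
    : Prop :=
  g 0 = z /\
  forall t, 0 <= t < T ->
    g t <> RtoC (lambda t) /\
    filterdiff (K := R_AbsRing) (U := R_NormedModule) (V := C_R_NormedModule)
      g (within (fun s => 0 <= s < T) (locally t))
      (fun h => scal h (RtoC 2 / (g t - RtoC (lambda t)))%C).

(* [T] plays the role of T_z; [0 < T] excludes a vacuous equation on an empty
   time interval. *)
Definition loewner_hull (lambda : R -> R) (t : R) (z : C) : Prop :=
  upper_half_plane z /\
  exists (T : R) (g : R -> C),
    0 < T <= t /\ loewner_solution lambda z T g /\
    filterlim (fun u => Cmod (g u - RtoC (lambda u))%C) (at_left T) (locally 0).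

Definition connected_set (A : C -> Prop) : Prop :=
  forall U V : C -> Prop, open U -> open V ->
    (forall z, A z -> U z \/ V z) ->
    (exists z, A z /\ U z) -> (exists z, A z /\ V z) ->
    exists z, A z /\ U z /\ V z.

Definition connected_component_of (A S : C -> Prop) : Prop :=
  (exists z, A z) /\ (forall z, A z -> S z) /\ connected_set A /\
  forall B : C -> Prop, connected_set B ->
    (forall z, B z -> S z) -> (forall z, A z -> B z) ->
    forall z, B z -> A z.

Definition bounded_set (A : C -> Prop) : Prop :=
  exists M : R, forall z, A z -> Cmod z <= M.

Definition curve_image (gamma : R -> C) (a b : R) (z : C) : Prop :=
  exists s, a <= s <= b /\ gamma s = z.

(* Driving functions and curves on [0,1] are total functions on R of which only
   the values on [0,1] matter.  A half-plane minus a compact set has exactly one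
   unbounded component, so "an unbounded component" is "the" one. *)
Definition is_trace (lambda : R -> R) (gamma : R -> C) : Prop :=
  continuous_on (fun t => 0 <= t <= 1) gamma /\
  (forall t, 0 <= t <= 1 -> 0 <= Im (gamma t)) /\
  forall t, 0 <= t <= 1 ->
    let U := fun z => upper_half_plane z /\ ~ loewner_hull lambda t z in
    connected_component_of U
      (fun z => upper_half_plane z /\ ~ curve_image gamma 0 t z) /\
    ~ bounded_set U.

Definition jordan_arc (gamma : R -> C) (a b : R) : Prop :=
  continuous_on (fun t => a <= t <= b) gamma /\
  forall s t, a <= s <= b -> a <= t <= b -> gamma s = gamma t -> s = t.

Definition local_lip_half_le (mu : R -> R) (c : R) : Prop :=
  exists delta, 0 < delta /\
    forall t t', 0 <= t -> t < t' -> t' < 1 ->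
      Rabs (t - t') < delta * (1 - t) ->
      Rabs (mu t - mu t') <= c * sqrt (Rabs (t - t')).

(* The local norm is the infimum of the admissible constants. *)
Definition local_lip_half_lt (mu : R -> R) (c : R) : Prop :=
  exists c', c' < c /\ local_lip_half_le mu c'.

Definition Cexp (z : C) : C :=
  (exp (Re z) * cos (Im z), exp (Re z) * sin (Im z)).

(* S_theta is the range of [log_spiral theta]. *)
Definition log_spiral (theta tau : R) : C :=
  Cexp (RtoC tau * Cexp (Ci * RtoC theta))%C.

Definition hausdorff_dist (A B : C -> Prop) : Rbar :=
  Glb_Rbar (fun e => 0 <= e /\
    (forall x, A x -> exists y, B y /\ Cmod (x - y)%C <= e) /\
    (forall y, B y -> exists x, A x /\ Cmod (x - y)%C <= e)).

Definition hausdorff_cv (A : R -> C -> Prop) (B : C -> Prop) : Prop :=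
  forall eps, 0 < eps ->
    Rbar_locally p_infty (fun s => Rbar_lt (hausdorff_dist (A s) B) eps).

Definition asymptotically_similar_to_spiral (gamma : R -> C) (theta : R)
    : Prop :=
  let Gamma := fun s => gamma (1 - exp (- s)) in
  forall u, 0 < u ->
    hausdorff_cv
      (fun s z => exists v, 0 <= v <= u /\
         z = ((Gamma (s + v)%R - gamma 1%R) / (Gamma s - gamma 1%R))%C)
      (fun z => exists tau, 0 <= tau <= u * cos theta /\
         z = log_spiral theta (- tau)).

(* Main.v *)
Require Import Defs.
From Stdlib Require Import Reals Ranalysis5 Lra Lia ClassicalEpsilon.
From Coquelicot Require Import Coquelicot.

(** The local condition and the limit [kappa] combine near time 1: to close
    times the local bound applies, and for times that are far apart relative to
    [1 - t] the driving function is close to [kappa sqrt (1 - t)], whose Lip-1/2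
    norm is [|kappa| < 4].  So [lambda] is uniformly locally Lip-1/2 up to and
    including time 1, with a constant below 4 ([clamped_driver]), and the
    assertions on the arc reduce to such driving functions, for which time 1 is
    like any other.

    Let [Z = g - lambda] along a solution that is absorbed by the driving point
    at time [T], or that ends straight above it.  Then [|Re Z| <= A Im Z]
    throughout ([chord_cone]).  The reason is that on an excursion of [Re Z] away
    from zero a bounded scale-invariant quantity drifts at a definite logarithmic
    speed as long as [Im Z] is small ([excursion_height]); the drift is a perfect
    square for the critical constant 4 ([excursion_inequality]).  In the cone,
    [(Im Z)^2] is of order [T - t], and the distance of two solutions grows
    backwards in time no faster than a power below 1 of their heights
    ([pair_monotone]).  Both facts together give a Hoelder estimate for solutions
    with nearby end times ([chord_compare]).  It yields for every [T] exactly one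
    solution absorbed at time [T] ([chord_exists], [chord_unique]), whose starting
    point [gamma T] depends continuously and injectively on [T].  The hull at time
    [t] is [gamma (0, t]] ([trace_hull]); its complement is connected, being the
    image of the half-plane under the backward flow ([survivors_connected]).  As
    an arc has empty interior, the hulls determine the curve, so that every trace
    coincides with [gamma] ([trace_unique]).

    In the coordinate [z / sqrt (1 - t)] the driving function
    [kappa sqrt (1 - t)] gives an autonomous flow with a repelling fixed point in
    the half-plane.  The solution that starts at [gamma 1] stays bounded in this
    coordinate, so it converges to the fixed point ([tip_is_steady]).  The
    difference of the solutions that start at [gamma T] and at [gamma 1] satisfies
    a linear equation; for the model driving function a complex power integrates
    it ([spiral_coordinate]).  For [lambda] itself this quantity is almost constant
    over the times [t] with [1 - t] comparable to [1 - T] ([near_ratio]), and at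
    its end it shows the factor of the spiral ([spiral_end_ratio]).  At the earlier
    times the Hoelder estimate shows that the quotient of the differences for two
    values of [T] hardly changes ([far_ratio]).  At time 0 these differences are
    the chords [gamma T - gamma 1] of the arc ([rescaled_limit]). *)

Open Scope R_scope.

(** * Calculus on the line *)

Lemma derive_plus (f g : R -> R) t a b :
  is_derive f t a -> is_derive g t b -> is_derive (fun s => f s + g s) t (a + b).
Proof. exact (is_derive_plus f g t a b). Qed.

Lemma derive_minus (f g : R -> R) t a b :
  is_derive f t a -> is_derive g t b -> is_derive (fun s => f s - g s) t (a - b).
Proof. exact (is_derive_minus f g t a b). Qed.

Lemma derive_opp (f : R -> R) t a :
  is_derive f t a -> is_derive (fun s => - f s) t (- a).
Proof. exact (is_derive_opp f t a). Qed.

Lemma derive_mult (f g : R -> R) t a b :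
  is_derive f t a -> is_derive g t b ->
  is_derive (fun s => f s * g s) t (a * g t + f t * b).
Proof. intros Hf Hg. exact (is_derive_mult f g t a b Hf Hg Rmult_comm). Qed.

Lemma derive_comp (f g : R -> R) t a b :
  is_derive f (g t) a -> is_derive g t b -> is_derive (fun s => f (g s)) t (a * b).
Proof.
  intros Hf Hg. rewrite Rmult_comm. exact (is_derive_comp f g t a b Hf Hg).
Qed.

Lemma derive_ext (f g : R -> R) t d :
  (forall s, f s = g s) -> is_derive f t d -> is_derive g t d.
Proof. exact (is_derive_ext f g t d). Qed.

Lemma continuous_of_derive (f : R -> R) t d : is_derive f t d -> continuous f t.
Proof. intros H. apply (ex_derive_continuous f). now exists d. Qed.

Lemma derive_inv (f : R -> R) t d :
  is_derive f t d -> f t <> 0 -> is_derive (fun s => / f s) t (- d / f t ^ 2).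
Proof. intros H Hn. exact (is_derive_inv f t d H Hn). Qed.

Lemma derive_ln (f : R -> R) t d :
  is_derive f t d -> 0 < f t -> is_derive (fun s => ln (f s)) t (d / f t).
Proof.
  intros H Hp. evar_last. exact (derive_comp ln f t _ _ (is_derive_ln _ Hp) H).
  field. lra.
Qed.

Lemma derive_sqrt (f : R -> R) t d :
  is_derive f t d -> 0 < f t -> is_derive (fun s => sqrt (f s)) t (d / (2 * sqrt (f t))).
Proof. intros H Hp. exact (is_derive_sqrt f t d H Hp). Qed.

Lemma derive_rev (a t : R) : is_derive (fun s => a - s) t (-1).
Proof. auto_derive; [trivial|ring]. Qed.

Lemma exp_monotone x y : x <= y -> exp x <= exp y.
Proof. intros [H|H]; [left; now apply exp_increasing | right; now rewrite H]. Qed.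

Lemma nondecreasing_of_derive (f df : R -> R) (a b : R) :
  a <= b ->
  (forall t, a <= t <= b -> is_derive f t (df t)) ->
  (forall t, a <= t <= b -> 0 <= df t) ->
  f a <= f b.
Proof.
  intros Hab Hd Hp.
  destruct (MVT_gen f a b df) as [c [Hc Heq]].
  - intros x Hx. rewrite Rmin_left, Rmax_right in Hx by lra. apply Hd; lra.
  - intros x Hx. rewrite Rmin_left, Rmax_right in Hx by lra.
    apply continuity_pt_filterlim. apply continuous_of_derive with (df x). apply Hd; lra.
  - rewrite Rmin_left, Rmax_right in Hc by lra.
    pose proof (Hp c ltac:(lra)). nra.
Qed.

Lemma nonincreasing_of_derive (f df : R -> R) (a b : R) :
  a <= b ->
  (forall t, a <= t <= b -> is_derive f t (df t)) ->
  (forall t, a <= t <= b -> df t <= 0) ->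
  f b <= f a.
Proof.
  intros Hab Hd Hp.
  enough (- f a <= - f b) by lra.
  apply (nondecreasing_of_derive (fun t => - f t) (fun t => - df t) a b Hab).
  - intros t Ht. apply derive_opp. now apply Hd.
  - intros t Ht. pose proof (Hp t Ht). lra.
Qed.

Lemma lipschitz_of_derive (f df : R -> R) (B : R) :
  (forall t, is_derive f t (df t)) -> (forall t, Rabs (df t) <= B) ->
  forall s t, Rabs (f s - f t) <= B * Rabs (s - t).
Proof.
  intros Hd Hb.
  assert (H : forall s t, s <= t -> Rabs (f s - f t) <= B * Rabs (s - t)).
  { intros s t Hst.
    assert (f s + B * s <= f t + B * t).
    { apply (nondecreasing_of_derive (fun u => f u + B * u) (fun u => df u + B) s t Hst).
      - intros u _. apply derive_plus. apply Hd.
        auto_derive; [trivial | ring].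
      - intros u _. specialize (Hb u). apply Rabs_le_between in Hb. lra. }
    assert (f t - B * t <= f s - B * s).
    { apply (nonincreasing_of_derive (fun u => f u - B * u) (fun u => df u - B) s t Hst).
      - intros u _. apply derive_minus. apply Hd.
        auto_derive; [trivial | ring].
      - intros u _. specialize (Hb u). apply Rabs_le_between in Hb. lra. }
    rewrite (Rabs_left1 (s - t)) by lra.
    apply Rabs_le_between. lra. }
  intros s t. destruct (Rle_dec s t) as [h|h]; [now apply H|].
  rewrite (Rabs_minus_sym (f s)), (Rabs_minus_sym s). apply H. lra.
Qed.

Lemma displacement_le (f df : R -> R) (K a b : R) :
  a <= b -> (forall t, a <= t <= b -> is_derive f t (df t)) ->
  (forall t, a <= t <= b -> Rabs (df t) <= K) -> Rabs (f b - f a) <= K * (b - a).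
Proof.
  intros Hab Hd HK.
  assert (L : forall k t, is_derive (fun t => k * t) t k).
  { intros k t. auto_derive; [trivial|ring]. }
  assert (f b - K * b <= f a - K * a).
  { apply (nonincreasing_of_derive (fun t => f t - K * t) (fun t => df t - K) a b Hab).
    - intros t Ht. exact (derive_minus _ _ _ _ _ (Hd t Ht) (L K t)).
    - intros t Ht. specialize (HK t Ht). apply Rabs_le_between in HK. lra. }
  assert (f a + K * a <= f b + K * b).
  { apply (nondecreasing_of_derive (fun t => f t + K * t) (fun t => df t + K) a b Hab).
    - intros t Ht. exact (derive_plus _ _ _ _ _ (Hd t Ht) (L K t)).
    - intros t Ht. specialize (HK t Ht). apply Rabs_le_between in HK. lra. }
  apply Rabs_le_between. lra.
Qed.

Lemma exp_bound_of_derive (u du : R -> R) (K a t0 : R) :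
  0 < a -> 0 <= K -> u t0 = 0 ->
  (forall t, is_derive u t (du t)) ->
  (forall t, Rabs (du t) <= K * exp (a * Rabs (t - t0))) ->
  forall t, Rabs (u t) <= K / a * exp (a * Rabs (t - t0)).
Proof.
  intros Ha HK.
  assert (Hhalf : forall v dv : R -> R, v t0 = 0 ->
    (forall t, is_derive v t (dv t)) ->
    (forall t, t0 <= t -> Rabs (dv t) <= K * exp (a * (t - t0))) ->
    forall t, t0 <= t -> Rabs (v t) <= K / a * exp (a * (t - t0))).
  { intros v dv Hv0 Hd Hb t Ht.
    assert (Hexp : forall x, is_derive (fun x => K / a * exp (a * (x - t0))) x
                          (K * exp (a * (x - t0)))).
    { intros x. auto_derive; [trivial|]. unfold Rminus. field. lra. }
    assert (H0 : 0 <= K / a * exp (a * (t0 - t0))).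
    { apply Rmult_le_pos. apply Rdiv_le_0_compat; lra. left; apply exp_pos. }
    assert (H1 : K / a * exp (a * (t0 - t0)) - v t0
                 <= K / a * exp (a * (t - t0)) - v t).
    { apply (nondecreasing_of_derive (fun x => K / a * exp (a * (x - t0)) - v x)
               (fun x => K * exp (a * (x - t0)) - dv x) t0 t Ht).
      - intros x Hx. apply derive_minus; auto.
      - intros x Hx. specialize (Hb x ltac:(lra)). apply Rabs_le_between in Hb. lra. }
    assert (H2 : K / a * exp (a * (t0 - t0)) + v t0
                 <= K / a * exp (a * (t - t0)) + v t).
    { apply (nondecreasing_of_derive (fun x => K / a * exp (a * (x - t0)) + v x)
               (fun x => K * exp (a * (x - t0)) + dv x) t0 t Ht).
      - intros x Hx. apply derive_plus; auto.
      - intros x Hx. specialize (Hb x ltac:(lra)). apply Rabs_le_between in Hb. lra. }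
    apply Rabs_le_between. lra. }
  intros Hu0 Hd Hb t.
  destruct (Rle_dec t0 t) as [h|h].
  - rewrite (Rabs_pos_eq (t - t0)) by lra. apply (Hhalf u du); auto.
    intros s Hs. specialize (Hb s). now rewrite (Rabs_pos_eq (s - t0)) in Hb by lra.
  - rewrite (Rabs_left1 (t - t0)) by lra.
    pose proof (Hhalf (fun s => u (2 * t0 - s)) (fun s => - du (2 * t0 - s))) as H.
    assert (h1 : u (2 * t0 - t0) = 0) by (now replace (2 * t0 - t0) with t0 by ring).
    assert (h2 : forall s, is_derive (fun s => u (2 * t0 - s)) s (- du (2 * t0 - s))).
    { intros s. evar_last.
      - apply (derive_comp u (fun s => 2 * t0 - s)); [apply Hd|].
        apply (derive_minus (fun _ => 2 * t0) (fun s => s));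
          [apply is_derive_const | apply is_derive_id].
      - unfold zero, one; simpl; ring. }
    assert (h3 : forall s, t0 <= s ->
      Rabs (- du (2 * t0 - s)) <= K * exp (a * (s - t0))).
    { intros s Hs. specialize (Hb (2 * t0 - s)). rewrite Rabs_Ropp.
      replace (Rabs (2 * t0 - s - t0)) with (s - t0) in Hb; [exact Hb|].
      rewrite Rabs_left1; lra. }
    specialize (H h1 h2 h3).
    specialize (H (2 * t0 - t) ltac:(lra)). simpl in H.
    replace (2 * t0 - (2 * t0 - t)) with t in H by ring.
    replace (- (t - t0)) with (2 * t0 - t - t0) by ring. exact H.
Qed.

Lemma continuous_eps (f : R -> R) u : continuous f u ->
  forall e, 0 < e -> exists d, 0 < d /\ forall v, Rabs (v - u) < d -> Rabs (f v - f u) < e.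
Proof.
  intros H e He.
  destruct (proj1 (filterlim_locally _ _) H (mkposreal e He)) as [d Hd].
  exists d. split; [apply cond_pos|]. intros v Hv. apply (Hd v Hv).
Qed.

Lemma first_exit (f : R -> R) (t T : R) :
  t < T -> (forall u, t <= u < T -> continuous f u) -> 0 < f t ->
  exists t1, t < t1 <= T /\ (forall u, t <= u < t1 -> 0 < f u) /\ (t1 < T -> f t1 = 0).
Proof.
  intros HT Hc Ht.
  set (E u := t <= u <= T /\ forall v, t <= v < u -> 0 < f v).
  destruct (completeness E) as [t1 [Hub Hleast]].
  { exists T. intros u [Hu _]; lra. }
  { exists t. split; [lra|]. intros; lra. }
  assert (Ht1 : t <= t1 <= T).
  { split; [apply Hub; split; [lra|intros; lra]|]. apply Hleast. intros u [Hu _]; lra. }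
  assert (Hpos : forall u, t <= u < t1 -> 0 < f u).
  { intros u Hu. apply NNPP. intros Hn.
    assert (t1 <= u); [|lra]. apply Hleast. intros v [Hv Hv'].
    apply Rnot_lt_le. intros Huv. apply Hn, Hv'. lra. }
  assert (Hgo : t1 < T -> f t1 <= 0).
  { intros h. apply Rnot_lt_le. intros Hp.
    destruct (continuous_eps _ _ (Hc t1 ltac:(lra)) _ Hp) as [d [Hd Hd']].
    set (v := Rmin (t1 + d / 2) T).
    assert (Hv : t1 < v <= T /\ v <= t1 + d / 2).
    { unfold v. split; [split|]; [apply Rmin_glb_lt; lra|apply Rmin_r|apply Rmin_l]. }
    assert (E v); [|pose proof (Hub v H); lra].
    split; [lra|]. intros w Hw. destruct (Rlt_dec w t1) as [h'|h']; [apply Hpos; lra|].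
    specialize (Hd' w). rewrite Rabs_pos_eq in Hd' by lra.
    specialize (Hd' ltac:(lra)). apply Rabs_lt_between in Hd'. lra. }
  assert (Hlt : t < t1).
  { destruct (Req_dec t t1) as [h|h]; [|lra]. rewrite <- h in Hgo. pose proof (Hgo HT). lra. }
  exists t1. split; [lra|]. split; [exact Hpos|]. intros h.
  apply Rle_antisym; [now apply Hgo|]. apply Rnot_lt_le. intros Hn.
  destruct (continuous_eps _ _ (Hc t1 ltac:(lra)) (- f t1) ltac:(lra)) as [d [Hd Hd']].
  set (v := Rmax t (t1 - d / 2)).
  assert (Hv : t <= v < t1 /\ t1 - d / 2 <= v).
  { unfold v. split; [split|]; [apply Rmax_l|apply Rmax_lub_lt; lra|apply Rmax_r]. }
  pose proof (Hpos v ltac:(lra)).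
  specialize (Hd' v). rewrite Rabs_left in Hd' by lra.
  specialize (Hd' ltac:(lra)). apply Rabs_lt_between in Hd'. lra.
Qed.

Lemma barrier (f : R -> R) (a u b : R) :
  (forall v, u <= v < b -> continuous f v) -> a < f u ->
  (forall v, u < v < b -> (forall w, u <= w <= v -> a <= f w) -> a < f v) ->
  forall v, u <= v < b -> a < f v.
Proof.
  intros Hc Hu Hstep v Hv.
  destruct (first_exit (fun v => f v - a) u b) as [t1 [Ht1 [Hpos Hzero]]]; [lra| |lra|].
  - intros w Hw. apply (continuous_minus f (fun _ => a)); [now apply Hc|apply continuous_const].
  - destruct (Rlt_or_le v t1) as [h|h]; [pose proof (Hpos v ltac:(lra)); lra|].
    specialize (Hzero ltac:(lra)).
    assert (a < f t1); [|lra]. apply Hstep; [lra|]. intros w Hw.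
    destruct (Req_dec w t1) as [->|h']; [lra|]. pose proof (Hpos w ltac:(lra)). lra.
Qed.

Lemma left_limit_eps (f : R -> R) T l :
  filterlim f (at_left T) (locally l) <->
  forall e, 0 < e -> exists d, 0 < d /\ forall u, T - d < u < T -> Rabs (f u - l) < e.
Proof.
  split.
  - intros H e He. destruct (proj1 (filterlim_locally _ _) H (mkposreal e He)) as [d Hd].
    exists d. split; [apply cond_pos|]. intros u Hu. apply (Hd u); [|lra].
    unfold ball; simpl. unfold AbsRing_ball, abs, minus, plus, opp; simpl.
    rewrite Rabs_left; lra.
  - intros H. apply filterlim_locally. intros e.
    destruct (H e (cond_pos e)) as [d [Hd Hu]]. exists (mkposreal d Hd).
    intros u Hb Hlt. apply Hu. unfold ball in Hb; simpl in Hb.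
    unfold AbsRing_ball, abs, minus, plus, opp in Hb; simpl in Hb.
    apply Rabs_lt_between in Hb. lra.
Qed.

Lemma left_limit_le (f : R -> R) (t T a l : R) :
  t < T -> filterlim f (at_left T) (locally l) ->
  (forall u, t < u < T -> a <= f u) -> a <= l.
Proof.
  intros Ht Hf H.
  apply (filterlim_le (F := at_left T) (fun _ => a) f (Finite a) (Finite l)); auto.
  - assert (Hd : 0 < T - t) by lra. exists (mkposreal _ Hd). intros u Hu Hu'.
    apply H. unfold ball in Hu; simpl in Hu.
    unfold AbsRing_ball, abs, minus, plus, opp in Hu; simpl in Hu.
    apply Rabs_lt_between in Hu. lra.
  - apply filterlim_const.
Qed.

Lemma left_limit_plus (f g : R -> R) T a b :
  filterlim f (at_left T) (locally a) -> filterlim g (at_left T) (locally b) ->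
  filterlim (fun u => f u + g u) (at_left T) (locally (a + b)).
Proof.
  intros Hf Hg. exact (filterlim_comp_2 _ _ _ Hf Hg (filterlim_plus (V := R_NormedModule) a b)).
Qed.

Lemma left_limit_mult (f g : R -> R) T a b :
  filterlim f (at_left T) (locally a) -> filterlim g (at_left T) (locally b) ->
  filterlim (fun u => f u * g u) (at_left T) (locally (a * b)).
Proof.
  intros Hf Hg. exact (filterlim_comp_2 _ _ _ Hf Hg (filterlim_mult (K := R_AbsRing) a b)).
Qed.

Lemma left_limit_const (a T : R) : filterlim (fun _ : R => a) (at_left T) (locally a).
Proof. apply filterlim_const. Qed.

Lemma left_limit_continuous (f : R -> R) T :
  continuous f T -> filterlim f (at_left T) (locally (f T)).
Proof.
  intros H P HP. destruct (H P HP) as [d Hd]. exists d. intros y Hy _. now apply Hd.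
Qed.

Lemma left_limit_id T : filterlim (fun u : R => u) (at_left T) (locally T).
Proof. apply (left_limit_continuous (fun u => u)). apply continuous_id. Qed.

Lemma gronwall (f df : R -> R) (L a b : R) :
  a <= b ->
  (forall t, a <= t <= b -> is_derive f t (df t)) ->
  (forall t, a <= t <= b -> Rabs (df t) <= L * f t) ->
  f b <= f a * exp (L * (b - a)) /\ f a <= f b * exp (L * (b - a)).
Proof.
  intros Hab Hd Hb.
  assert (E : forall k t, is_derive (fun t => exp (k * (t - a))) t (k * exp (k * (t - a)))).
  { intros k t. auto_derive; [trivial|]. unfold Rminus. ring. }
  assert (H1 : f b * exp (- L * (b - a)) <= f a * exp (- L * (a - a))).
  { apply (nonincreasing_of_derive (fun t => f t * exp (- L * (t - a)))
      (fun t => df t * exp (- L * (t - a)) + f t * (- L * exp (- L * (t - a)))) a b Hab).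
    - intros t Ht. exact (derive_mult _ _ _ _ _ (Hd t Ht) (E (- L) t)).
    - intros t Ht. specialize (Hb t Ht). apply Rabs_le_between in Hb.
      pose proof (exp_pos (- L * (t - a))). nra. }
  assert (H2 : f a * exp (L * (a - a)) <= f b * exp (L * (b - a))).
  { apply (nondecreasing_of_derive (fun t => f t * exp (L * (t - a)))
      (fun t => df t * exp (L * (t - a)) + f t * (L * exp (L * (t - a)))) a b Hab).
    - intros t Ht. exact (derive_mult _ _ _ _ _ (Hd t Ht) (E L t)).
    - intros t Ht. specialize (Hb t Ht). apply Rabs_le_between in Hb.
      pose proof (exp_pos (L * (t - a))). nra. }
  rewrite !Rminus_diag, !Rmult_0_r, exp_0, !Rmult_1_r in *.
  split; [|exact H2].
  replace (- L * (b - a)) with (- (L * (b - a))) in H1 by ring.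
  rewrite exp_Ropp in H1. pose proof (exp_pos (L * (b - a))).
  apply Rmult_le_reg_r with (/ exp (L * (b - a))).
  - now apply Rinv_0_lt_compat.
  - rewrite Rmult_assoc, Rinv_r, Rmult_1_r; [exact H1 | lra].
Qed.

(** * Picard iteration *)

Section Picard.
Variables (F : bool -> R -> R -> R -> R) (L B t0 : R) (start : bool -> R).
Hypothesis L_pos : 0 < L.
Hypothesis F_bound : forall i t x y, Rabs (F i t x y) <= B.
Hypothesis F_lip : forall i t x y x' y',
  Rabs (F i t x y - F i t x' y') <= L * (Rabs (x - x') + Rabs (y - y')).
Hypothesis F_cont : forall i t x y, continuous (fun s => F i s x y) t.

Lemma continuous_along (i : bool) (x y : R -> R) :
  (forall t, continuous x t) -> (forall t, continuous y t) ->
  forall t, continuous (fun s => F i s (x s) (y s)) t.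
Proof.
  intros Hx Hy t. apply filterlim_locally. intros eps.
  assert (He : 0 < eps / (3 * L)) by (apply Rdiv_lt_0_compat; [apply cond_pos|lra]).
  pose proof (proj1 (filterlim_locally _ _) (Hx t) (mkposreal _ He)) as Ax.
  pose proof (proj1 (filterlim_locally _ _) (Hy t) (mkposreal _ He)) as Ay.
  assert (He' : 0 < eps / 3) by (pose proof (cond_pos eps); lra).
  pose proof (proj1 (filterlim_locally _ _) (F_cont i t (x t) (y t)) (mkposreal _ He')) as Af.
  generalize (filter_and _ _ Ax (filter_and _ _ Ay Af)). apply filter_imp.
  intros s [Bx [By Bf]].
  change (Rabs (x s - x t) < eps / (3 * L)) in Bx.
  change (Rabs (y s - y t) < eps / (3 * L)) in By.
  change (Rabs (F i s (x t) (y t) - F i t (x t) (y t)) < eps / 3) in Bf.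
  change (Rabs (F i s (x s) (y s) - F i t (x t) (y t)) < eps).
  pose proof (F_lip i s (x s) (y s) (x t) (y t)) as Hl.
  replace (F i s (x s) (y s) - F i t (x t) (y t)) with
    ((F i s (x s) (y s) - F i s (x t) (y t)) + (F i s (x t) (y t) - F i t (x t) (y t))) by ring.
  eapply Rle_lt_trans; [apply Rabs_triang|].
  assert (L * (Rabs (x s - x t) + Rabs (y s - y t)) < L * (eps / (3 * L) + eps / (3 * L)))
    by (apply Rmult_lt_compat_l; lra).
  replace (L * (eps / (3 * L) + eps / (3 * L))) with (2 * eps / 3) in H by (field; lra).
  lra.
Qed.

Fixpoint picard_iter (n : nat) : bool -> R -> R :=
  match n with
  | O => fun i _ => start i
  | S m => fun i t =>
      start i + RInt (fun s => F i s (picard_iter m true s) (picard_iter m false s)) t0 t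
  end.

Lemma is_derive_integral (f : R -> R) (a : R) :
  (forall t, continuous f t) ->
  forall t, is_derive (fun t => a + RInt f t0 t) t (f t).
Proof.
  intros Hf t. evar_last.
  - apply derive_plus. apply is_derive_const.
    apply (is_derive_RInt f (fun t => RInt f t0 t) t0 t); [|apply Hf].
    apply filter_forall. intros s. apply (RInt_correct (V := R_CompleteNormedModule)).
    apply (ex_RInt_continuous (V := R_CompleteNormedModule)). intros; apply Hf.
  - unfold zero; simpl; ring.
Qed.

Lemma picard_continuous n : forall i t, continuous (picard_iter n i) t.
Proof.
  induction n as [|n IH]; simpl; intros i t.
  - apply continuous_const.
  - eapply continuous_of_derive.
    apply (is_derive_integral (fun s => F i s (picard_iter n true s) (picard_iter n false s))).
    now apply continuous_along.
Qed.

Lemma picard_derive n i t :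
  is_derive (picard_iter (S n) i) t (F i t (picard_iter n true t) (picard_iter n false t)).
Proof.
  apply (is_derive_integral (fun s => F i s (picard_iter n true s) (picard_iter n false s))).
  apply continuous_along; apply picard_continuous.
Qed.

Lemma picard_start n i : picard_iter n i t0 = start i.
Proof.
  destruct n; simpl; [reflexivity|]. rewrite RInt_point. unfold zero; simpl. ring.
Qed.

Let D := B / (2 * L).
Let w t := exp (4 * L * Rabs (t - t0)).

Lemma B_nonneg : 0 <= B.
Proof. eapply Rle_trans; [apply Rabs_pos | apply (F_bound true 0 0 0)]. Qed.

Lemma D_nonneg : 0 <= D.
Proof. pose proof B_nonneg. unfold D. apply Rdiv_le_0_compat; lra. Qed.

Lemma picard_step n : forall i t,
  Rabs (picard_iter (S n) i t - picard_iter n i t) <= D / 2 * (1 / 2) ^ n * w t.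
Proof.
  pose proof B_nonneg as HB. pose proof D_nonneg as HD.
  induction n as [|n IH]; intros i t.
  - assert (Hw : forall s, 1 <= w s).
    { intros s. unfold w. rewrite <- exp_0. apply exp_monotone.
      apply Rmult_le_pos; [lra | apply Rabs_pos]. }
    replace (D / 2 * (1 / 2) ^ 0) with (B / (4 * L)) by (unfold D; simpl; field; lra).
    apply (exp_bound_of_derive (fun t => picard_iter 1 i t - picard_iter 0 i t)
      (fun t => F i t (start true) (start false)) B (4 * L) t0); [lra|lra| | | ].
    + rewrite !picard_start. ring.
    + intros s. evar_last.
      exact (derive_minus _ _ _ _ _ (picard_derive 0 i s) (is_derive_const _ s)).
      simpl. unfold zero; simpl; ring.
    + intros s. specialize (F_bound i s (start true) (start false)).
      specialize (Hw s). unfold w in Hw. nra.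
  - assert (Hp : 0 < (1 / 2) ^ n) by (apply pow_lt; lra).
    set (K := L * (D * (1 / 2) ^ n)).
    assert (HK : 0 <= K) by (unfold K; apply Rmult_le_pos; [lra|]; apply Rmult_le_pos; lra).
    replace (D / 2 * (1 / 2) ^ S n) with (K / (4 * L)) by (unfold K; simpl; field; lra).
    apply (exp_bound_of_derive (fun t => picard_iter (S (S n)) i t - picard_iter (S n) i t)
      (fun t => F i t (picard_iter (S n) true t) (picard_iter (S n) false t) -
                F i t (picard_iter n true t) (picard_iter n false t)) K (4 * L) t0);
      [lra|lra| | | ].
    + rewrite !picard_start. ring.
    + intros s. exact (derive_minus _ _ _ _ _ (picard_derive (S n) i s) (picard_derive n i s)).
    + intros s. eapply Rle_trans; [apply F_lip|].
      pose proof (IH true s). pose proof (IH false s). unfold K. fold (w s). nra.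
Qed.

Lemma geometric_cauchy (u : nat -> R) (K : R) :
  (forall n, Rabs (u (S n) - u n) <= K / 2 * (1 / 2) ^ n) ->
  exists l : R, forall n, Rabs (u n - l) <= K * (1 / 2) ^ n.
Proof.
  intros Hu.
  assert (Hk : forall n k, Rabs (u (n + k)%nat - u n) <= K * (1 / 2) ^ n - K * (1 / 2) ^ (n + k)).
  { intros n k; induction k as [|k IH].
    - rewrite Nat.add_0_r, Rminus_diag, Rabs_R0. lra.
    - rewrite Nat.add_succ_r.
      replace (u (S (n + k)) - u n) with ((u (S (n + k)) - u (n + k)%nat) + (u (n + k)%nat - u n)) by ring.
      eapply Rle_trans; [apply Rabs_triang|]. specialize (Hu (n + k)%nat).
      simpl pow. lra. }
  assert (HK : 0 <= K).
  { specialize (Hu 0%nat). simpl in Hu. pose proof (Rabs_pos (u 1%nat - u 0%nat)). lra. }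
  assert (Hpos : forall n, 0 <= K * (1 / 2) ^ n).
  { intros n. apply Rmult_le_pos; [exact HK|]. left. apply pow_lt. lra. }
  assert (Hz : is_lim_seq (fun n => K * (1 / 2) ^ n) 0).
  { replace (Finite 0) with (Rbar_mult K 0) by (simpl; f_equal; ring).
    apply is_lim_seq_scal_l. apply is_lim_seq_geom. rewrite Rabs_pos_eq; lra. }
  assert (Hex : ex_finite_lim_seq u).
  { apply ex_lim_seq_cauchy_corr. intros eps.
    assert (He2 : 0 < eps / 2) by (pose proof (cond_pos eps); lra).
    apply is_lim_seq_spec in Hz. destruct (Hz (mkposreal _ He2)) as [N HN]. simpl in HN.
    exists N. intros n m Hn Hm.
    pose proof (Hk N (n - N)%nat) as An. pose proof (Hk N (m - N)%nat) as Am.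
    replace (N + (n - N))%nat with n in An by lia.
    replace (N + (m - N))%nat with m in Am by lia.
    pose proof (HN N (Nat.le_refl _)) as BN. rewrite Rminus_0_r, Rabs_pos_eq in BN by apply Hpos.
    replace (u n - u m) with ((u n - u N) - (u m - u N)) by ring.
    eapply Rle_lt_trans; [apply Rabs_triang|]. rewrite Rabs_Ropp.
    pose proof (Hpos n). pose proof (Hpos m). lra. }
  destruct Hex as [l Hl]. exists l. intros n.
  rewrite Rabs_minus_sym.
  assert (Hc : is_lim_seq (fun k => Rabs (u (k + n)%nat - u n)) (Rabs (l - u n))).
  { apply (is_lim_seq_abs (fun k => u (k + n)%nat - u n) (Finite (l - u n))).
    apply (is_lim_seq_minus' (fun k => u (k + n)%nat) (fun _ => u n)).
    now apply (is_lim_seq_incr_n u n). apply is_lim_seq_const. }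
  apply (is_lim_seq_le _ (fun _ => K * (1 / 2) ^ n) _ _) with (2 := Hc) (3 := is_lim_seq_const _).
  intros k. specialize (Hk n k). rewrite (Nat.add_comm k n). pose proof (Hpos (n + k)%nat). lra.
Qed.

Lemma picard_lipschitz n i s t :
  Rabs (picard_iter n i s - picard_iter n i t) <= B * Rabs (s - t).
Proof.
  destruct n as [|n].
  - simpl. rewrite Rminus_diag, Rabs_R0. apply Rmult_le_pos; [apply B_nonneg|apply Rabs_pos].
  - eapply lipschitz_of_derive; [apply picard_derive|]. intros; apply F_bound.
Qed.

Lemma le_of_geometric (a b K : R) :
  (forall n, a <= b + K * (1 / 2) ^ n) -> a <= b.
Proof.
  intros H. apply Rnot_lt_le. intros Hlt.
  assert (Hz : is_lim_seq (fun n => b + K * (1 / 2) ^ n) (b + K * 0)).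
  { apply (is_lim_seq_plus' (fun _ => b)). apply is_lim_seq_const.
    apply (is_lim_seq_scal_l _ K 0). apply is_lim_seq_geom. rewrite Rabs_pos_eq; lra. }
  pose proof (is_lim_seq_le (fun _ => a) _ _ _ H (is_lim_seq_const a) Hz) as X.
  simpl in X. lra.
Qed.

Lemma continuous_of_lipschitz (f : R -> R) (K : R) :
  (forall s t, Rabs (f s - f t) <= K * Rabs (s - t)) -> forall t, continuous f t.
Proof.
  intros H t. apply filterlim_locally. intros eps.
  assert (HK : 0 <= K).
  { specialize (H 1 0). rewrite Rminus_0_r, Rabs_R1 in H.
    pose proof (Rabs_pos (f 1 - f 0)). lra. }
  assert (Hd : 0 < eps / (K + 1)) by (apply Rdiv_lt_0_compat; [apply cond_pos|lra]).
  exists (mkposreal _ Hd). intros s Hs.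
  change (Rabs (s - t) < eps / (K + 1)) in Hs. change (Rabs (f s - f t) < eps).
  apply Rlt_div_r in Hs; [|lra].
  specialize (H s t). pose proof (Rabs_pos (s - t)). nra.
Qed.

(** The weight [exp (4 L |t - t0|)] makes one integration a contraction by 1/2 on
    the whole line, so that no continuation argument is needed. *)
Theorem picard :
  exists x : bool -> R -> R, (forall i, x i t0 = start i) /\
    forall i t, is_derive (x i) t (F i t (x true t) (x false t)).
Proof.
  pose proof B_nonneg as HB. pose proof D_nonneg as HD.
  assert (Hw : forall t, 0 < w t) by (intros; apply exp_pos).
  assert (Hx : forall i t, exists l : R, forall n,
    Rabs (picard_iter n i t - l) <= D * w t * (1 / 2) ^ n).
  { intros i t. apply geometric_cauchy. intros n.
    eapply Rle_trans; [apply picard_step|]. right; field. }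
  set (x i t := proj1_sig (constructive_indefinite_description _ (Hx i t))).
  assert (Ex : forall i t n, Rabs (picard_iter n i t - x i t) <= D * w t * (1 / 2) ^ n).
  { intros i t. unfold x. now destruct constructive_indefinite_description. }
  clearbody x.
  assert (Cx : forall i t, continuous (x i) t).
  { intros i. apply (continuous_of_lipschitz _ B). intros s t.
    apply le_of_geometric with (D * w s + D * w t). intros n.
    pose proof (picard_lipschitz n i s t). pose proof (Ex i s n). pose proof (Ex i t n).
    replace (x i s - x i t) with ((picard_iter n i s - picard_iter n i t) -
      (picard_iter n i s - x i s) + (picard_iter n i t - x i t)) by ring.
    eapply Rle_trans; [apply Rabs_triang|].
    eapply Rle_trans; [apply Rplus_le_compat_r, Rabs_triang|]. rewrite Rabs_Ropp. lra. }
  set (J i t := start i + RInt (fun s => F i s (x true s) (x false s)) t0 t).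
  assert (DJ : forall i t, is_derive (J i) t (F i t (x true t) (x false t))).
  { intros i. apply (is_derive_integral (fun s => F i s (x true s) (x false s))).
    now apply continuous_along. }
  assert (Hfix : forall i t, x i t = J i t).
  { intros i t.
    assert (Hle : Rabs (x i t - J i t) <= 0).
    { apply le_of_geometric with (2 * D * w t). intros n.
      assert (Hp0 : 0 < (1 / 2) ^ n) by (apply pow_lt; lra).
      assert (Hd : Rabs (picard_iter (S n) i t - J i t)
               <= (L * (2 * D * (1 / 2) ^ n)) / (4 * L) * w t).
      { apply (exp_bound_of_derive (fun t => picard_iter (S n) i t - J i t)
          (fun t => F i t (picard_iter n true t) (picard_iter n false t) - F i t (x true t) (x false t))).
        - lra.
        - apply Rmult_le_pos; [lra|]. apply Rmult_le_pos; lra.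
        - rewrite picard_start. unfold J. rewrite RInt_point. unfold zero; simpl; ring.
        - intros s. exact (derive_minus _ _ _ _ _ (picard_derive n i s) (DJ i s)).
        - intros s. eapply Rle_trans; [apply F_lip|].
          pose proof (Ex true s n). pose proof (Ex false s n). fold (w s). nra. }
      pose proof (Ex i t (S n)) as Hq. simpl pow in Hq.
      replace (L * (2 * D * (1 / 2) ^ n) / (4 * L) * w t)
        with (D * w t * (1 / 2) ^ n / 2) in Hd by (field; lra).
      replace (x i t - J i t)
        with ((picard_iter (S n) i t - J i t) - (picard_iter (S n) i t - x i t)) by ring.
      eapply Rle_trans; [apply Rabs_triang|]. rewrite Rabs_Ropp.
      assert (0 <= D * w t * (1 / 2) ^ n).
      { apply Rmult_le_pos; [|lra]. apply Rmult_le_pos; [lra|left; apply Hw]. }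
      lra. }
    pose proof (Rabs_pos (x i t - J i t)).
    destruct (Req_dec (x i t - J i t) 0) as [h|h]; [lra|]. apply Rabs_pos_lt in h. lra. }
  exists x. split.
  - intros i. rewrite Hfix. unfold J. rewrite RInt_point. unfold zero; simpl; ring.
  - intros i t. apply (derive_ext (J i)); [intros; symmetry; apply Hfix|apply DJ].
Qed.

End Picard.

(** * Complex-valued functions of a real variable *)

Definition cderiv (f : R -> C) (t : R) (d : C) : Prop :=
  is_derive (fun s => Re (f s)) t (Re d) /\ is_derive (fun s => Im (f s)) t (Im d).

Definition sqmod (z : C) : R := Re z ^ 2 + Im z ^ 2.

Lemma C_ext (z w : C) : Re z = Re w -> Im z = Im w -> z = w.
Proof. destruct z, w; simpl; intros; now subst. Qed.

Lemma Cmod_sqmod z : Cmod z ^ 2 = sqmod z.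
Proof.
  unfold Cmod, sqmod, Re, Im. rewrite pow2_sqrt; [easy|].
  apply Rplus_le_le_0_compat; apply pow2_ge_0.
Qed.

Lemma sqmod_nonneg z : 0 <= sqmod z.
Proof. unfold sqmod. nra. Qed.

Lemma sqmod_pos z : z <> RtoC 0 -> 0 < sqmod z.
Proof.
  intros Hz. rewrite <- Cmod_sqmod. pose proof (Cmod_gt_0 z) as [H _].
  specialize (H Hz). nra.
Qed.

Lemma sqmod_pos_im z : Im z <> 0 -> 0 < sqmod z.
Proof. intros H. unfold sqmod. nra. Qed.

Lemma sqmod_zero z : sqmod z <= 0 -> z = RtoC 0.
Proof. unfold sqmod. intros H. apply C_ext; simpl; nra. Qed.

Lemma sqmod_mult z w : sqmod (z * w)%C = sqmod z * sqmod w.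
Proof. unfold sqmod, Re, Im; simpl. ring. Qed.

Lemma neq0_im z : Im z <> 0 -> z <> RtoC 0.
Proof. intros H E. apply H. rewrite E. reflexivity. Qed.

Lemma cderiv_ext_val f t d d' : cderiv f t d -> d = d' -> cderiv f t d'.
Proof. now intros H <-. Qed.

Lemma cderiv_plus f g t a b :
  cderiv f t a -> cderiv g t b -> cderiv (fun s => f s + g s)%C t (a + b)%C.
Proof.
  intros [H1 H2] [H3 H4]. split; simpl.
  - exact (derive_plus _ _ _ _ _ H1 H3).
  - exact (derive_plus _ _ _ _ _ H2 H4).
Qed.

Lemma cderiv_minus f g t a b :
  cderiv f t a -> cderiv g t b -> cderiv (fun s => f s - g s)%C t (a - b)%C.
Proof.
  intros [H1 H2] [H3 H4]. split; simpl.
  - exact (derive_minus _ _ _ _ _ H1 H3).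
  - exact (derive_minus _ _ _ _ _ H2 H4).
Qed.

Lemma cderiv_mult f g t a b :
  cderiv f t a -> cderiv g t b ->
  cderiv (fun s => f s * g s)%C t (a * g t + f t * b)%C.
Proof.
  intros [H1 H2] [H3 H4]. split.
  - evar_last. exact (derive_minus _ _ _ _ _ (derive_mult _ _ _ _ _ H1 H3)
                        (derive_mult _ _ _ _ _ H2 H4)).
    simpl. unfold Re, Im. ring.
  - evar_last. exact (derive_plus _ _ _ _ _ (derive_mult _ _ _ _ _ H1 H4)
                        (derive_mult _ _ _ _ _ H2 H3)).
    simpl. unfold Re, Im. ring.
Qed.

Lemma cderiv_const z t : cderiv (fun _ => z) t (RtoC 0).
Proof. split; [exact (is_derive_const (Re z) t) | exact (is_derive_const (Im z) t)]. Qed.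

Lemma cderiv_RtoC f t d : is_derive f t d -> cderiv (fun s => RtoC (f s)) t (RtoC d).
Proof. intros H. split; simpl; [exact H | exact (is_derive_const 0 t)]. Qed.

Lemma derive_sqmod f t d :
  cderiv f t d ->
  is_derive (fun s => sqmod (f s)) t (2 * (Re (f t) * Re d + Im (f t) * Im d)).
Proof.
  intros [H1 H2]. apply derive_ext with
    (fun s => Re (f s) * Re (f s) + Im (f s) * Im (f s)).
  - intros s. unfold sqmod. ring.
  - evar_last. exact (derive_plus _ _ _ _ _ (derive_mult _ _ _ _ _ H1 H1)
                        (derive_mult _ _ _ _ _ H2 H2)).
    simpl. ring.
Qed.

Lemma derive_sqmod_mult f t m :
  cderiv f t (m * f t)%C ->
  is_derive (fun s => sqmod (f s)) t (2 * Re m * sqmod (f t)).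
Proof.
  intros H. evar_last. exact (derive_sqmod _ _ _ H).
  unfold sqmod, Re, Im; simpl. ring.
Qed.

Lemma Re_le_Cmod z : Rabs (Re z) <= Cmod z.
Proof. exact (Rle_trans _ _ _ (Rmax_l _ _) (Rmax_Cmod z)). Qed.

Lemma Im_le_Cmod z : Rabs (Im z) <= Cmod z.
Proof. exact (Rle_trans _ _ _ (Rmax_r _ _) (Rmax_Cmod z)). Qed.

Lemma Cmod_le_abs z : Cmod z <= Rabs (Re z) + Rabs (Im z).
Proof.
  apply Rsqr_incr_0_var; [|apply Rplus_le_le_0_compat; apply Rabs_pos].
  unfold Rsqr. replace (Cmod z * Cmod z) with (Cmod z ^ 2) by ring.
  rewrite Cmod_sqmod. unfold sqmod. rewrite <- (pow2_abs (Re z)), <- (pow2_abs (Im z)).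
  pose proof (Rabs_pos (Re z)). pose proof (Rabs_pos (Im z)). nra.
Qed.

Lemma sqmod_minus_le z w : sqmod (z - w)%C <= 2 * (sqmod z + sqmod w).
Proof.
  unfold sqmod, Re, Im; simpl.
  pose proof (pow2_ge_0 (fst z + fst w)). pose proof (pow2_ge_0 (snd z + snd w)). nra.
Qed.

Lemma C_complete (u : nat -> C) :
  (forall e, 0 < e -> exists N, forall n m, (N <= n)%nat -> (N <= m)%nat ->
     sqmod (u n - u m)%C < e) ->
  exists l : C, forall e, 0 < e -> exists N, forall n, (N <= n)%nat -> sqmod (u n - l)%C < e.
Proof.
  intros H.
  assert (HP : forall P : C -> R, (forall z, Rabs (P z) <= Cmod z) ->
    (forall z w, P (z - w)%C = P z - P w) ->
    exists l : R, is_lim_seq (fun n => P (u n)) l).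
  { intros P HP HL. apply ex_lim_seq_cauchy_corr. intros e.
    assert (He : 0 < e ^ 2) by (apply pow_lt, cond_pos).
    destruct (H _ He) as [N HN]. exists N. intros n m Hn Hm.
    rewrite <- HL. eapply Rle_lt_trans; [apply HP|].
    specialize (HN n m Hn Hm). rewrite <- Cmod_sqmod in HN.
    pose proof (cond_pos e). pose proof (Cmod_ge_0 (u n - u m)%C). nra. }
  destruct (HP Re Re_le_Cmod) as [a Ha]; [intros; unfold Re; simpl; ring|].
  destruct (HP Im Im_le_Cmod) as [b Hb]; [intros; unfold Im; simpl; ring|].
  exists (a, b). intros e He.
  assert (He2 : 0 < sqrt (e / 2)) by (apply sqrt_lt_R0; lra).
  apply is_lim_seq_spec in Ha. apply is_lim_seq_spec in Hb.
  destruct (Ha (mkposreal _ He2)) as [N1 H1]. destruct (Hb (mkposreal _ He2)) as [N2 H2].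
  simpl in H1, H2. exists (N1 + N2)%nat. intros n Hn.
  specialize (H1 n ltac:(lia)). specialize (H2 n ltac:(lia)).
  assert (Es : sqrt (e / 2) ^ 2 = e / 2) by (apply pow2_sqrt; lra).
  unfold sqmod. replace (Re (u n - (a, b))%C) with (Re (u n) - a) by (unfold Re; simpl; ring).
  replace (Im (u n - (a, b))%C) with (Im (u n) - b) by (unfold Im; simpl; ring).
  rewrite <- (pow2_abs (Re (u n) - a)), <- (pow2_abs (Im (u n) - b)).
  pose proof (Rabs_pos (Re (u n) - a)). pose proof (Rabs_pos (Im (u n) - b)). nra.
Qed.

Lemma sqmod_triangle a b c : sqmod (a - c)%C <= 2 * (sqmod (a - b)%C + sqmod (b - c)%C).
Proof.
  replace (a - c)%C with ((a - b) - (c - b))%C by ring.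
  eapply Rle_trans; [apply sqmod_minus_le|].
  replace (sqmod (c - b)%C) with (sqmod (b - c)%C)
    by (unfold sqmod, Re, Im; simpl; ring). lra.
Qed.

Lemma sqmod_sym a b : sqmod (a - b)%C = sqmod (b - a)%C.
Proof. unfold sqmod, Re, Im; simpl; ring. Qed.

Lemma C_eq_of_sqmod a b : (forall e, 0 < e -> sqmod (a - b)%C <= e) -> a = b.
Proof.
  intros H. assert (Hz : sqmod (a - b)%C <= 0).
  { apply Rnot_lt_le. intros Hlt. specialize (H (sqmod (a - b)%C / 2) ltac:(lra)). lra. }
  apply sqmod_zero in Hz. replace a with (a - b + b)%C by ring. rewrite Hz. ring.
Qed.

Lemma cderiv_inv f t d : cderiv f t d -> f t <> RtoC 0 ->
  cderiv (fun s => / f s)%C t (- d / (f t * f t))%C.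
Proof.
  intros [H1 H2] Hn. apply sqmod_pos in Hn. unfold sqmod in Hn.
  assert (D2 : is_derive (fun s => Re (f s) ^ 2 + Im (f s) ^ 2) t
    (2 * (Re (f t) * Re d + Im (f t) * Im d))) by exact (derive_sqmod f t d (conj H1 H2)).
  assert (D3 := derive_inv _ _ _ D2 ltac:(lra)).
  assert (Hsq : Re (f t * f t)%C ^ 2 + Im (f t * f t)%C ^ 2 = (Re (f t) ^ 2 + Im (f t) ^ 2) ^ 2)
    by (unfold Re, Im; simpl; ring).
  assert (Hq : Re (- d / (f t * f t))%C = - (Re d * Re (f t * f t)%C + Im d * Im (f t * f t)%C) /
     (Re (f t) ^ 2 + Im (f t) ^ 2) ^ 2 /\
     Im (- d / (f t * f t))%C = - (Im d * Re (f t * f t)%C - Re d * Im (f t * f t)%C) /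
     (Re (f t) ^ 2 + Im (f t) ^ 2) ^ 2).
  { rewrite <- Hsq. unfold Cdiv, Cinv. generalize (f t * f t)%C. intros z.
    unfold Re, Im; simpl. unfold Rdiv. split; ring. }
  destruct Hq as [Q1 Q2]. split.
  - evar_last. exact (derive_mult _ _ _ _ _ H1 D3). rewrite Q1.
    unfold Re, Im in *; simpl in *. field. lra.
  - evar_last. exact (derive_mult _ _ _ _ _ (derive_opp _ _ _ H2) D3). rewrite Q2.
    unfold Re, Im in *; simpl in *. field. lra.
Qed.

(** * The Loewner flow of a continuous driving function *)

Definition vel (z : C) (l : R) : C := (RtoC 2 / (z - RtoC l))%C.

Lemma Re_vel z l : Re (vel z l) = 2 * (Re z - l) / ((Re z - l) ^ 2 + Im z ^ 2).
Proof.
  unfold vel, Re, Im; simpl. unfold Rminus, Rdiv.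
  rewrite Ropp_0, !Rplus_0_r. ring.
Qed.

Lemma Im_vel z l : Im (vel z l) = - 2 * Im z / ((Re z - l) ^ 2 + Im z ^ 2).
Proof.
  unfold vel, Re, Im; simpl. unfold Rminus, Rdiv.
  rewrite Ropp_0, !Rplus_0_r. ring.
Qed.

Lemma sumsq_pos x y : 0 < y -> 0 < x ^ 2 + y ^ 2.
Proof. intros H. pose proof (pow2_ge_0 x). pose proof (pow_lt y 2 H). lra. Qed.

Lemma vel_lipschitz (z w : C) (l l' y0 : R) :
  0 < y0 -> y0 <= Im z -> y0 <= Im w ->
  Cmod (vel z l - vel w l')%C <= 2 / y0 ^ 2 * (Cmod (z - w)%C + Rabs (l - l')).
Proof.
  intros Hy Hz Hw.
  set (a := (z - RtoC l)%C). set (b := (w - RtoC l')%C).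
  assert (Ha : y0 <= Cmod a).
  { eapply Rle_trans; [|apply Im_le_Cmod]. unfold a, Im in *; simpl.
    rewrite Rabs_pos_eq; lra. }
  assert (Hb : y0 <= Cmod b).
  { eapply Rle_trans; [|apply Im_le_Cmod]. unfold b, Im in *; simpl.
    rewrite Rabs_pos_eq; lra. }
  assert (Na : a <> RtoC 0) by (intros E; rewrite E, Cmod_0 in Ha; lra).
  assert (Nb : b <> RtoC 0) by (intros E; rewrite E, Cmod_0 in Hb; lra).
  unfold vel. fold a b.
  replace (RtoC 2 / a - RtoC 2 / b)%C with (RtoC 2 * (b - a) / (a * b))%C by (field; now split).
  rewrite Cmod_div, !Cmod_mult, Cmod_R, (Rabs_pos_eq 2) by (lra || now apply Cmult_neq_0).
  assert (Hba : Cmod (b - a)%C <= Cmod (z - w)%C + Rabs (l - l')).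
  { replace (b - a)%C with (- (z - w) + RtoC (l - l'))%C.
    - eapply Rle_trans; [apply Cmod_triangle|]. rewrite Cmod_opp, Cmod_R. lra.
    - unfold a, b. rewrite RtoC_minus. ring. }
  assert (Hab : y0 ^ 2 <= Cmod a * Cmod b) by nra.
  assert (0 < y0 ^ 2) by nra.
  unfold Rdiv.
  apply Rle_trans with (2 * Cmod (b - a)%C * / y0 ^ 2).
  - apply Rmult_le_compat_l.
    + pose proof (Cmod_ge_0 (b - a)%C). lra.
    + now apply Rinv_le_contravar.
  - pose proof (Rinv_0_lt_compat _ H). nra.
Qed.

Lemma vel_bound (z : C) (l y0 : R) :
  0 < y0 -> y0 <= Im z -> Cmod (vel z l) <= 2 / y0.
Proof.
  intros Hy Hz. set (a := (z - RtoC l)%C).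
  assert (Ha : y0 <= Cmod a).
  { eapply Rle_trans; [|apply Im_le_Cmod]. unfold a, Im in *; simpl.
    rewrite Rabs_pos_eq; lra. }
  assert (Na : a <> RtoC 0) by (intros E; rewrite E, Cmod_0 in Ha; lra).
  unfold vel. fold a. rewrite Cmod_div, Cmod_R, (Rabs_pos_eq 2) by (lra || easy).
  unfold Rdiv. apply Rmult_le_compat_l; [lra|]. now apply Rinv_le_contravar.
Qed.

Definition lift (y0 : R) (z : C) : C := (Re z, Rmax (Im z) y0).

Lemma lift_lipschitz y0 z w : Cmod (lift y0 z - lift y0 w)%C <=
  Rabs (Re z - Re w) + Rabs (Im z - Im w).
Proof.
  eapply Rle_trans; [apply Cmod_le_abs|]. unfold Re, Im; simpl.
  apply Rplus_le_compat_l. unfold Rmax.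
  repeat destruct Rle_dec; unfold Rabs; repeat destruct Rcase_abs; unfold Re, Im in *; lra.
Qed.

Lemma lift_id y0 z : y0 <= Im z -> lift y0 z = z.
Proof. intros H. unfold lift. rewrite Rmax_left by lra. now destruct z. Qed.

Lemma lift_im y0 z : y0 <= Im (lift y0 z).
Proof. apply Rmax_r. Qed.

Section Flow.
Variable lam : R -> R.
Hypothesis lam_cont : forall t, continuous lam t.

Definition solves (g : R -> C) (t : R) : Prop :=
  cderiv g t (vel (g t) (lam t)) /\ 0 < Im (g t).

(** Lifting the point to height [y0] before evaluating the field removes its
    singularity; as long as the imaginary part stays above [y0] the lifted
    equation is the Loewner equation. *)
Lemma lifted_flow (y0 t0 : R) (w : C) :
  0 < y0 ->
  exists g : R -> C, g t0 = w /\ forall t, cderiv g t (vel (lift y0 (g t)) (lam t)).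
Proof.
  intros Hy.
  set (F t x y := vel (lift y0 (x, y)) (lam t)).
  assert (Hy2 : 0 < 2 / y0 ^ 2) by (apply Rdiv_lt_0_compat; nra).
  assert (Hlip : forall t x y x' y',
    Cmod (F t x y - F t x' y')%C <= 2 / y0 ^ 2 * (Rabs (x - x') + Rabs (y - y'))).
  { intros. unfold F. eapply Rle_trans; [apply (vel_lipschitz _ _ _ _ y0); auto using lift_im|].
    rewrite Rminus_diag, Rabs_R0, Rplus_0_r.
    apply Rmult_le_compat_l; [lra|]. apply (lift_lipschitz y0 (x, y) (x', y')). }
  assert (Hcont : forall s t x y,
    Cmod (F s x y - F t x y)%C <= 2 / y0 ^ 2 * Rabs (lam s - lam t)).
  { intros. unfold F. eapply Rle_trans; [apply (vel_lipschitz _ _ _ _ y0); auto using lift_im|].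
    replace (lift y0 (x, y) - lift y0 (x, y))%C with (RtoC 0) by ring.
    rewrite Cmod_0. lra. }
  assert (Hc : forall P : C -> R, (forall z w, Rabs (P z - P w) <= Cmod (z - w)%C) ->
    forall t x y, continuous (fun s => P (F s x y)) t).
  { intros P HP t x y. apply filterlim_locally. intros eps.
    assert (He : 0 < eps / (2 / y0 ^ 2)) by (apply Rdiv_lt_0_compat; [apply cond_pos|lra]).
    generalize (proj1 (filterlim_locally _ _) (lam_cont t) (mkposreal _ He)).
    apply filter_imp. intros s Hs.
    unfold ball in *; simpl in *; unfold AbsRing_ball, abs, minus, plus, opp in *; simpl in *.
    eapply Rle_lt_trans; [apply HP|]. eapply Rle_lt_trans; [apply Hcont|].
    apply Rlt_le_trans with (2 / y0 ^ 2 * (eps / (2 / y0 ^ 2))).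
    - apply Rmult_lt_compat_l; [exact Hy2|exact Hs].
    - right. set (K := 2 / y0 ^ 2). assert (0 < K) by exact Hy2. field. lra. }
  assert (HRe : forall z w, Rabs (Re z - Re w) <= Cmod (z - w)%C)
    by (intros; apply (Re_le_Cmod (z - w0)%C)).
  assert (HIm : forall z w, Rabs (Im z - Im w) <= Cmod (z - w)%C)
    by (intros; apply (Im_le_Cmod (z - w0)%C)).
  destruct (picard (fun (i : bool) t x y => if i then Re (F t x y) else Im (F t x y))
    (2 / y0 ^ 2) (2 / y0) t0 (fun i : bool => if i then Re w else Im w)) as [x [Hx Hd]]; auto.
  - intros [|] t x y; (eapply Rle_trans; [apply Re_le_Cmod || apply Im_le_Cmod|]);
      apply vel_bound; auto using lift_im.
  - intros [|] t x y x' y'; (eapply Rle_trans; [apply HRe || apply HIm|]); apply Hlip.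
  - intros [|]; [now apply (Hc Re)|now apply (Hc Im)].
  - exists (fun t => (x true t, x false t)). split.
    + rewrite !Hx. now destruct w.
    + intros t. split; [exact (Hd true t)|exact (Hd false t)].
Qed.

Lemma Im_vel_neg z l : 0 < Im z -> Im (vel z l) < 0.
Proof.
  intros H. rewrite Im_vel.
  pose proof (sumsq_pos (Re z - l) (Im z) H).
  apply Ropp_lt_cancel. replace (- (- 2 * Im z / ((Re z - l) ^ 2 + Im z ^ 2)))
    with (2 * Im z / ((Re z - l) ^ 2 + Im z ^ 2)) by (field; lra).
  rewrite Ropp_0. apply Rdiv_lt_0_compat; lra.
Qed.

(** Backwards in time the height increases, so the lift at the initial height
    is never felt. *)
Lemma backward_flow (t0 : R) (w : C) :
  0 < Im w ->
  exists g : R -> C, g t0 = w /\ forall t, t <= t0 -> solves g t /\ Im w <= Im (g t).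
Proof.
  intros Hw. destruct (lifted_flow (Im w) t0 w Hw) as [g [H0 Hg]].
  assert (Hm : forall t, t <= t0 -> Im w <= Im (g t)).
  { intros t Ht. rewrite <- H0.
    apply (nonincreasing_of_derive (fun t => Im (g t))
      (fun t => Im (vel (lift (Im w) (g t)) (lam t))) t t0 Ht).
    - intros s _. apply Hg.
    - intros s _. left. apply Im_vel_neg. pose proof (lift_im (Im w) (g s)). lra. }
  exists g. split; [exact H0|]. intros t Ht. specialize (Hm t Ht).
  split; [|exact Hm]. split; [|lra].
  specialize (Hg t). now rewrite lift_id in Hg.
Qed.

Lemma Im_decreasing g a b :
  a <= b -> (forall t, a <= t <= b -> solves g t) -> Im (g b) <= Im (g a).
Proof.
  intros Hab H.
  apply (nonincreasing_of_derive (fun t => Im (g t)) (fun t => Im (vel (g t) (lam t))) a b Hab).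
  - intros t Ht. apply H; auto.
  - intros t Ht. left. apply Im_vel_neg. apply H; auto.
Qed.

Lemma gap_neq0 g t : 0 < Im (g t) -> (g t - RtoC (lam t))%C <> RtoC 0.
Proof. intros H. apply neq0_im. unfold Im in *; simpl. lra. Qed.

(** Solutions of the same equation are compared through this linear
    homogeneous one. *)
Lemma cderiv_difference g1 g2 t :
  solves g1 t -> solves g2 t ->
  cderiv (fun s => g1 s - g2 s)%C t
    ((- RtoC 2 / ((g1 t - RtoC (lam t)) * (g2 t - RtoC (lam t)))) * (g1 t - g2 t))%C.
Proof.
  intros [H1 P1] [H2 P2]. eapply cderiv_ext_val; [exact (cderiv_minus _ _ _ _ _ H1 H2)|].
  unfold vel. field. split; apply gap_neq0; auto.
Qed.

Lemma flow_gronwall g1 g2 a b m :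
  a <= b -> (forall t, a <= t <= b -> solves g1 t) ->
  (forall t, a <= t <= b -> solves g2 t) ->
  0 < m -> m <= Im (g1 b) -> m <= Im (g2 b) ->
  sqmod (g1 b - g2 b)%C <= sqmod (g1 a - g2 a)%C * exp (4 / m ^ 2 * (b - a)) /\
  sqmod (g1 a - g2 a)%C <= sqmod (g1 b - g2 b)%C * exp (4 / m ^ 2 * (b - a)).
Proof.
  intros Hab S1 S2 Hm M1 M2.
  apply (gronwall (fun t => sqmod (g1 t - g2 t)%C)
    (fun t => 2 * Re (- RtoC 2 / ((g1 t - RtoC (lam t)) * (g2 t - RtoC (lam t))))%C
              * sqmod (g1 t - g2 t)%C)); auto.
  - intros t Ht. apply (derive_sqmod_mult (fun t => g1 t - g2 t)%C).
    apply cderiv_difference; auto.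
  - intros t Ht. rewrite Rabs_mult, (Rabs_pos_eq (sqmod _)) by apply sqmod_nonneg.
    apply Rmult_le_compat_r; [apply sqmod_nonneg|].
    rewrite Rabs_mult, (Rabs_pos_eq 2) by lra.
    assert (N1 : m <= Cmod (g1 t - RtoC (lam t))%C).
    { eapply Rle_trans; [|apply Im_le_Cmod].
      assert (Im (g1 b) <= Im (g1 t)) by (apply Im_decreasing; [lra|intros; apply S1; lra]).
      unfold Im in *; simpl. rewrite Rabs_pos_eq; lra. }
    assert (N2 : m <= Cmod (g2 t - RtoC (lam t))%C).
    { eapply Rle_trans; [|apply Im_le_Cmod].
      assert (Im (g2 b) <= Im (g2 t)) by (apply Im_decreasing; [lra|intros; apply S2; lra]).
      unfold Im in *; simpl. rewrite Rabs_pos_eq; lra. }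
    assert (Z1 : (g1 t - RtoC (lam t))%C <> RtoC 0) by (apply gap_neq0; now apply S1).
    assert (Z2 : (g2 t - RtoC (lam t))%C <> RtoC 0) by (apply gap_neq0; now apply S2).
    eapply Rle_trans; [apply Rmult_le_compat_l; [lra|apply Re_le_Cmod]|].
    rewrite Cmod_div, Cmod_opp, Cmod_mult, Cmod_R, (Rabs_pos_eq 2)
      by (lra || now apply Cmult_neq_0).
    assert (m ^ 2 <= Cmod (g1 t - RtoC (lam t))%C * Cmod (g2 t - RtoC (lam t))%C) by nra.
    assert (0 < m ^ 2) by nra.
    pose proof (Rinv_le_contravar _ _ H0 H). unfold Rdiv. lra.
Qed.

Lemma solution_unique g1 g2 a b c :
  (forall t, a <= t <= b -> solves g1 t) ->
  (forall t, a <= t <= b -> solves g2 t) ->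
  a <= c <= b -> g1 c = g2 c -> forall t, a <= t <= b -> g1 t = g2 t.
Proof.
  intros S1 S2 Hc E t Ht.
  assert (Ez : sqmod (g1 c - g2 c)%C = 0).
  { rewrite E. unfold sqmod, Re, Im; simpl. ring. }
  assert (Hfin : sqmod (g1 t - g2 t)%C <= 0 -> g1 t = g2 t).
  { intros H. apply sqmod_zero in H.
    replace (g1 t) with (g1 t - g2 t + g2 t)%C by ring. rewrite H. ring. }
  apply Hfin.
  assert (B1 : 0 < Im (g1 b)) by (apply S1; lra).
  assert (B2 : 0 < Im (g2 b)) by (apply S2; lra).
  assert (Hdec : forall s, a <= s <= b ->
    Rmin (Im (g1 b)) (Im (g2 b)) <= Im (g1 s) /\ Rmin (Im (g1 b)) (Im (g2 b)) <= Im (g2 s)).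
  { intros s Hs. split.
    - eapply Rle_trans; [apply Rmin_l|]. apply Im_decreasing; [lra|intros; apply S1; lra].
    - eapply Rle_trans; [apply Rmin_r|]. apply Im_decreasing; [lra|intros; apply S2; lra]. }
  assert (Hm : 0 < Rmin (Im (g1 b)) (Im (g2 b))) by (apply Rmin_glb_lt; auto).
  destruct (Rle_dec c t) as [h|h].
  - destruct (flow_gronwall g1 g2 c t _ h
      ltac:(intros; apply S1; lra) ltac:(intros; apply S2; lra) Hm
      (proj1 (Hdec t Ht)) (proj2 (Hdec t Ht))) as [H _].
    rewrite Ez in H. lra.
  - destruct (flow_gronwall g1 g2 t c _ ltac:(lra)
      ltac:(intros; apply S1; lra) ltac:(intros; apply S2; lra) Hm
      (proj1 (Hdec c Hc)) (proj2 (Hdec c Hc))) as [_ H].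
    rewrite Ez in H. lra.
Qed.
Lemma sqmod_gap g t :
  sqmod (g t - RtoC (lam t))%C = (Re (g t) - lam t) ^ 2 + Im (g t) ^ 2.
Proof. unfold sqmod, Re, Im; simpl. ring. Qed.

Lemma solves_components g t :
  solves g t ->
  is_derive (fun u => Re (g u)) t
    (2 * (Re (g t) - lam t) / ((Re (g t) - lam t) ^ 2 + Im (g t) ^ 2)) /\
  is_derive (fun u => Im (g u)) t
    (- 2 * Im (g t) / ((Re (g t) - lam t) ^ 2 + Im (g t) ^ 2)) /\
  0 < Im (g t).
Proof.
  intros [[H1 H2] H3]. rewrite Re_vel in H1. rewrite Im_vel in H2. auto.
Qed.

Lemma derive_height_sq g t :
  solves g t ->
  is_derive (fun u => Im (g u) ^ 2) t
    (- 4 * Im (g t) ^ 2 / ((Re (g t) - lam t) ^ 2 + Im (g t) ^ 2)).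
Proof.
  intros H. destruct (solves_components g t H) as [_ [D HY]].
  pose proof (sumsq_pos (Re (g t) - lam t) (Im (g t)) HY).
  evar_last. apply (is_derive_pow _ 2 t _ D). simpl. field. lra.
Qed.

End Flow.

(** * Topology of the plane *)

Lemma C_ball_Cmod (z w : C) e : ball z e w -> Cmod (w - z)%C < 2 * e.
Proof.
  intros [H1 H2]. eapply Rle_lt_trans; [apply Cmod_le_abs|].
  change (Rabs (Re w - Re z) < e) in H1. change (Rabs (Im w - Im z) < e) in H2.
  change (Rabs (Re w - Re z) + Rabs (Im w - Im z) < 2 * e). lra.
Qed.

Lemma Cmod_ball_C (z w : C) e : Cmod (w - z)%C < e -> ball z e w.
Proof.
  intros H. split.
  - change (Rabs (Re (w - z)%C) < e). eapply Rle_lt_trans; [apply Re_le_Cmod|exact H].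
  - change (Rabs (Im (w - z)%C) < e). eapply Rle_lt_trans; [apply Im_le_Cmod|exact H].
Qed.

Lemma open_C_eps (U : C -> Prop) :
  open U <-> forall z, U z -> exists d, 0 < d /\ forall w, Cmod (w - z)%C < d -> U w.
Proof.
  split.
  - intros H z Hz. destruct (H z Hz) as [d Hd]. exists d. split; [apply cond_pos|].
    intros w Hw. apply Hd. now apply Cmod_ball_C.
  - intros H z Hz. destruct (H z Hz) as [d [Hd HU]].
    assert (Hd2 : 0 < d / 2) by lra. exists (mkposreal _ Hd2). intros w Hw.
    apply HU. apply C_ball_Cmod in Hw. simpl in Hw. lra.
Qed.

Lemma continuous_on_eps (D : R -> Prop) (f : R -> C) :
  continuous_on D f <-> forall s, D s -> forall e, 0 < e -> exists d, 0 < d /\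
    forall t, D t -> Rabs (t - s) < d -> Cmod (f t - f s)%C < e.
Proof.
  split.
  - intros H s Ds e He. assert (He2 : 0 < e / 2) by lra.
    destruct (proj1 (filterlim_locally _ _) (H s Ds) (mkposreal _ He2)) as [d Hd].
    exists d. split; [apply cond_pos|]. intros t Dt Hts.
    pose proof (C_ball_Cmod _ _ _ (Hd t Hts Dt)) as Hb. simpl in Hb. lra.
  - intros H s Ds. apply filterlim_locally. intros e.
    destruct (H s Ds e (cond_pos e)) as [d [Hd Ht]]. exists (mkposreal d Hd).
    intros t Hts Dt. apply Cmod_ball_C. exact (Ht t Dt Hts).
Qed.

Lemma Cmod_sym z w : Cmod (z - w)%C = Cmod (w - z)%C.
Proof. rewrite <- Cmod_opp. f_equal. ring. Qed.

Lemma Cmod_dist_triangle a b c : Cmod (a - c)%C <= Cmod (a - b)%C + Cmod (b - c)%C.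
Proof. replace (a - c)%C with ((a - b) + (b - c))%C by ring. apply Cmod_triangle. Qed.

Lemma connected_of_paths (A : C -> Prop) :
  (forall z w, A z -> A w -> exists (b : R -> C) (K : R),
     b 0 = z /\ b 1 = w /\ (forall s, 0 <= s <= 1 -> A (b s)) /\
     forall s t, 0 <= s <= 1 -> 0 <= t <= 1 -> Cmod (b s - b t)%C <= K * Rabs (s - t)) ->
  connected_set A.
Proof.
  intros HA U V HU HV Hcov [z [Az Uz]] [w [Aw Vw]].
  destruct (HA z w Az Aw) as [b [K [H0 [H1 [Hb HK]]]]].
  rewrite open_C_eps in HU, HV.
  apply NNPP. intros Hno.
  assert (Hdis : forall s, 0 <= s <= 1 -> U (b s) -> V (b s) -> False).
  { intros s Hs Us Vs. apply Hno. exists (b s). auto. }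
  assert (HK0 : 0 <= K).
  { specialize (HK 1 0 ltac:(lra) ltac:(lra)). rewrite Rminus_0_r, Rabs_R1 in HK.
    pose proof (Cmod_ge_0 (b 1 - b 0)%C). lra. }
  assert (Hloc : forall W : C -> Prop,
    (forall z, W z -> exists d, 0 < d /\ forall w, Cmod (w - z)%C < d -> W w) ->
    forall s, 0 <= s <= 1 -> W (b s) -> exists d, 0 < d /\
      forall t, 0 <= t <= 1 -> Rabs (t - s) < d -> W (b t)).
  { intros W HW s Hs Ws. destruct (HW _ Ws) as [d [Hd Hd']].
    exists (d / (K + 1)). split; [apply Rdiv_lt_0_compat; lra|].
    intros t Ht Hts. apply Hd'. eapply Rle_lt_trans; [apply HK; auto|].
    apply Rle_lt_trans with ((K + 1) * Rabs (t - s)).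
    - pose proof (Rabs_pos (t - s)). nra.
    - apply Rlt_le_trans with ((K + 1) * (d / (K + 1))).
      apply Rmult_lt_compat_l; lra. right; field; lra. }
  set (E s := 0 <= s <= 1 /\ U (b s)).
  destruct (completeness E) as [m [Hub Hleast]].
  { exists 1. intros s [Hs _]; lra. }
  { exists 0. split; [lra|]. now rewrite H0. }
  assert (Hm : 0 <= m <= 1).
  { split; [apply Hub; split; [lra|now rewrite H0]|]. apply Hleast. intros s [Hs _]; lra. }
  (* [m] is the last parameter of [U]: in [U] it can only be 1, and in [V] there
     would be no parameter of [U] just below it. *)
  destruct (Hcov (b m) (Hb m Hm)) as [Um|Vm].
  - destruct (Rle_lt_or_eq_dec _ _ (proj2 Hm)) as [h|h].
    + destruct (Hloc U HU m Hm Um) as [d [Hd Hd']].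
      set (t := Rmin 1 (m + d / 2)).
      assert (Ht : m < t <= 1 /\ t <= m + d / 2).
      { unfold t. split; [split|]; [apply Rmin_glb_lt; lra|apply Rmin_l|apply Rmin_r]. }
      assert (E t); [|pose proof (Hub t H); lra].
      split; [lra|]. apply Hd'; [lra|]. rewrite Rabs_pos_eq; lra.
    + subst m. apply (Hdis 1); [lra|exact Um|]. now rewrite H1.
  - destruct (Hloc V HV m Hm Vm) as [d [Hd Hd']].
    assert (m <= m - d); [|lra]. apply Hleast. intros s [Hs Us].
    apply Rnot_lt_le. intros Hlt. pose proof (Hub s (conj Hs Us)).
    apply (Hdis s Hs Us). apply Hd'; [exact Hs|]. rewrite Rabs_left1; lra.
Qed.

Lemma connected_union (A B : C -> Prop) (p : C) :
  connected_set A -> connected_set B -> A p -> B p -> connected_set (fun z => A z \/ B z).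
Proof.
  intros HA HB Ap Bp.
  (* It suffices to treat the side of the cover that contains [p]. *)
  assert (Hside : forall U V : C -> Prop, open U -> open V ->
    (forall z, A z \/ B z -> U z \/ V z) -> (exists z, (A z \/ B z) /\ V z) -> U p ->
    exists z, (A z \/ B z) /\ U z /\ V z).
  { intros U V HU HV Hcov [z [[Az|Bz] Vz]] Up.
    - destruct (HA U V HU HV) as [x [Ax [Ux Vx]]]; eauto.
    - destruct (HB U V HU HV) as [x [Ax [Ux Vx]]]; eauto. }
  intros U V HU HV Hcov HeU HeV.
  destruct (Hcov p (or_introl Ap)) as [Up|Vp].
  - now apply Hside.
  - destruct (Hside V U HV HU) as [x [Ax [Vx Ux]]]; auto.
    + intros z Hz. destruct (Hcov z Hz); auto.
    + now exists x.
Qed.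

Definition segment (z w : C) (s : R) : C := (z + RtoC s * (w - z))%C.

Lemma segment_lipschitz z w s t :
  Cmod (segment z w s - segment z w t)%C = Cmod (w - z)%C * Rabs (s - t).
Proof.
  unfold segment. replace (z + RtoC s * (w - z) - (z + RtoC t * (w - z)))%C
    with (RtoC (s - t) * (w - z))%C by (rewrite RtoC_minus; ring).
  rewrite Cmod_mult, Cmod_R. ring.
Qed.

Lemma connected_of_segments (A : C -> Prop) :
  (forall z w s, A z -> A w -> 0 <= s <= 1 -> A (segment z w s)) -> connected_set A.
Proof.
  intros H. apply connected_of_paths. intros z w Az Aw.
  exists (segment z w), (Cmod (w - z)%C).
  split; [unfold segment; ring|]. split; [unfold segment; ring|].
  split; [intros; now apply H|]. intros. rewrite segment_lipschitz. lra.
Qed.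

Lemma ball_segment c r z w s :
  Cmod (z - c)%C < r -> Cmod (w - c)%C < r -> 0 <= s <= 1 -> Cmod (segment z w s - c)%C < r.
Proof.
  intros Hz Hw Hs. unfold segment.
  replace (z + RtoC s * (w - z) - c)%C with (RtoC (1 - s) * (z - c) + RtoC s * (w - c))%C
    by (rewrite RtoC_minus; ring).
  eapply Rle_lt_trans; [apply Cmod_triangle|].
  rewrite !Cmod_mult, !Cmod_R, !Rabs_pos_eq by lra.
  set (m := Rmax (Cmod (z - c)%C) (Cmod (w - c)%C)).
  assert (Hm : m < r) by (now apply Rmax_lub_lt).
  assert (Cmod (z - c)%C <= m) by apply Rmax_l.
  assert (Cmod (w - c)%C <= m) by apply Rmax_r. nra.
Qed.

Lemma connected_ball c r : connected_set (fun z => Cmod (z - c)%C < r).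
Proof. apply connected_of_segments. intros. now apply ball_segment. Qed.

Lemma clamp_lipschitz a b s t : a <= b ->
  Rabs (Rmax a (Rmin s b) - Rmax a (Rmin t b)) <= Rabs (s - t).
Proof.
  intros H. unfold Rmax, Rmin.
  repeat destruct Rle_dec; unfold Rabs; repeat destruct Rcase_abs; lra.
Qed.

Lemma clamp_range a b s : a <= b -> a <= Rmax a (Rmin s b) <= b.
Proof.
  intros H. split; [apply Rmax_l|]. apply Rmax_lub; [exact H|apply Rmin_r].
Qed.

Lemma clamp_id a b s : a <= s <= b -> Rmax a (Rmin s b) = s.
Proof. intros H. rewrite Rmin_left by lra. rewrite Rmax_right; lra. Qed.

Lemma continuous_on_subset (D D' : R -> Prop) (f : R -> C) :
  (forall t, D' t -> D t) -> continuous_on D f -> continuous_on D' f.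
Proof.
  intros H Hc. rewrite continuous_on_eps in *. intros s Ds e He.
  destruct (Hc s (H s Ds) e He) as [d [Hd Ht]]. exists d. split; [exact Hd|].
  intros t Dt. apply Ht. auto.
Qed.

(** The distance to [p] attains its minimum on the compact curve. *)
Lemma off_curve_distance (gamma : R -> C) a b p :
  a <= b -> continuous_on (fun t => a <= t <= b) gamma ->
  (forall s, a <= s <= b -> gamma s <> p) ->
  exists r, 0 < r /\ forall s, a <= s <= b -> r <= Cmod (gamma s - p)%C.
Proof.
  intros Hab Hc Hp. rewrite continuous_on_eps in Hc.
  set (f s := Cmod (gamma (Rmax a (Rmin s b)) - p)%C).
  assert (Cf : forall s, a <= s <= b -> continuity_pt f s).
  { intros s _. apply continuity_pt_filterlim. apply filterlim_locally. intros e.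
    destruct (Hc _ (clamp_range a b s Hab) e (cond_pos e)) as [d [Hd Ht]].
    exists (mkposreal d Hd). intros t Hts.
    change (Rabs (f t - f s) < e). unfold f.
    specialize (Ht _ (clamp_range a b t Hab)).
    eapply Rle_lt_trans; [|apply Ht].
    - apply Rabs_le_between.
      pose proof (Cmod_dist_triangle (gamma (Rmax a (Rmin t b))) (gamma (Rmax a (Rmin s b))) p).
      pose proof (Cmod_dist_triangle (gamma (Rmax a (Rmin s b))) (gamma (Rmax a (Rmin t b))) p).
      rewrite (Cmod_sym (gamma (Rmax a (Rmin s b))) (gamma (Rmax a (Rmin t b)))) in H0. lra.
    - eapply Rle_lt_trans; [apply clamp_lipschitz; exact Hab|exact Hts]. }
  destruct (continuity_ab_min f a b Hab Cf) as [m [Hmin Hm]].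
  exists (f m). split.
  - unfold f. rewrite clamp_id by exact Hm. apply Cmod_gt_0. intros E. apply (Hp m Hm).
    replace (gamma m) with (gamma m - p + p)%C by ring. rewrite E. ring.
  - intros s Hs. specialize (Hmin s Hs). unfold f in *. now rewrite (clamp_id a b s) in Hmin.
Qed.

(** Removing the middle point separates the other two along the arc, but not
    along the segment between them. *)
Lemma arc_no_detour (gamma : R -> C) b s1 s2 s3 :
  0 <= s1 -> s1 < s2 -> s2 < s3 -> s3 <= b ->
  continuous_on (fun t => 0 <= t <= b) gamma ->
  (forall s t, 0 <= s <= b -> 0 <= t <= b -> gamma s = gamma t -> s = t) ->
  (forall s, 0 <= s <= 1 -> exists t, 0 <= t <= b /\ gamma t = segment (gamma s1) (gamma s3) s) ->
  exists s, 0 <= s <= 1 /\ segment (gamma s1) (gamma s3) s = gamma s2.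
Proof.
  intros H1 H12 H23 H3 Hc Hinj Hseg. apply NNPP. intros Hno.
  set (A z := exists s, 0 <= s <= 1 /\ z = segment (gamma s1) (gamma s3) s).
  assert (HA : connected_set A).
  { apply connected_of_segments. intros z w s [a [Ha ->]] [b' [Hb ->]] Hs.
    exists (a + s * (b' - a)). split; [nra|]. unfold segment.
    rewrite RtoC_plus, RtoC_mult, RtoC_minus. ring. }
  assert (Hopen : forall a c, 0 <= a -> a <= c -> c <= b ->
    open (fun z => forall s, a <= s <= c -> gamma s <> z)).
  { intros a c Ha Hac Hcb. apply open_C_eps. intros z Hz.
    destruct (off_curve_distance gamma a c z Hac) as [r [Hr Hd]]; auto.
    { apply (continuous_on_subset (fun t => 0 <= t <= b)); [intros; lra|exact Hc]. }
    exists r. split; [exact Hr|]. intros w Hw s Hs E. specialize (Hd s Hs).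
    rewrite E in Hd. lra. }
  destruct (HA _ _ (Hopen s2 b ltac:(lra) ltac:(lra) ltac:(lra))
                   (Hopen 0 s2 ltac:(lra) ltac:(lra) ltac:(lra)))
    as [z [[s [Hs ->]] [N1 N2]]].
  - intros z [s [Hs ->]]. destruct (Hseg s Hs) as [t [Ht Et]].
    assert (t <> s2) by (intros ->; apply Hno; exists s; auto).
    destruct (Rlt_or_le t s2) as [h|h].
    + left. intros u Hu E. rewrite <- Et in E. apply Hinj in E; lra.
    + right. intros u Hu E. rewrite <- Et in E. apply Hinj in E; lra.
  - exists (gamma s1). split.
    + exists 0. split; [lra|]. unfold segment; ring.
    + intros u Hu E. apply Hinj in E; lra.
  - exists (gamma s3). split.
    + exists 1. split; [lra|]. unfold segment; ring.
    + intros u Hu E. apply Hinj in E; lra.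
  - destruct (Hseg s Hs) as [t [Ht Et]]. destruct (Rlt_or_le t s2) as [h|h].
    + apply (N2 t); [lra|exact Et].
    + apply (N1 t); [lra|exact Et].
Qed.

(** If the arc covered a disc, it would contain three points of the disc that
    are not collinear, and the middle one along the arc would not lie on the
    segment between the other two, against [arc_no_detour]. *)
Lemma arc_empty_interior (gamma : R -> C) b p r :
  0 < r -> continuous_on (fun t => 0 <= t <= b) gamma ->
  (forall s t, 0 <= s <= b -> 0 <= t <= b -> gamma s = gamma t -> s = t) ->
  exists z, Cmod (z - p)%C < r /\ forall s, 0 <= s <= b -> gamma s <> z.
Proof.
  intros Hr Hc Hinj. apply NNPP. intros Hno.
  assert (Hall : forall z, Cmod (z - p)%C < r -> exists s, 0 <= s <= b /\ gamma s = z).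
  { intros z Hz. apply NNPP. intros H. apply Hno. exists z. split; [exact Hz|].
    intros s Hs E. apply H. now exists s. }
  set (q := (p + RtoC (r / 2))%C). set (w := (p + (0%R, (r / 2)%R))%C).
  assert (Bp : Cmod (p - p)%C < r).
  { replace (p - p)%C with (RtoC 0) by ring. rewrite Cmod_0. lra. }
  assert (Bq : Cmod (q - p)%C < r).
  { unfold q. replace (p + RtoC (r / 2) - p)%C with (RtoC (r / 2)) by ring.
    rewrite Cmod_R, Rabs_pos_eq; lra. }
  assert (Bw : Cmod (w - p)%C < r).
  { unfold w. replace (p + (0%R, (r / 2)%R) - p)%C with ((0%R, (r / 2)%R) : C) by (apply C_ext; simpl; ring).
    eapply Rle_lt_trans; [apply Cmod_le_abs|]. simpl. rewrite Rabs_R0, Rabs_pos_eq; lra. }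
  destruct (Hall p Bp) as [a [Ha Ea]]. destruct (Hall q Bq) as [c [Hcc Ec]].
  destruct (Hall w Bw) as [d [Hd Ed]].
  assert (Hsplit : forall s1 s2 s3, 0 <= s1 <= b -> 0 <= s2 <= b -> 0 <= s3 <= b ->
    Cmod (gamma s1 - p)%C < r -> Cmod (gamma s3 - p)%C < r ->
    (forall s, segment (gamma s1) (gamma s3) s <> gamma s2) -> s1 < s2 < s3 -> False).
  { intros s1 s2 s3 H1 H2 H3 B1 B3 Hn H.
    destruct (arc_no_detour gamma b s1 s2 s3) as [s [Hs E]]; try lra; auto.
    - intros s Hs. apply Hall. now apply ball_segment.
    - now apply (Hn s). }
  assert (Hpq : p <> q /\ p <> w /\ q <> w).
  { unfold q, w. repeat split; intros E; [apply (f_equal Re) in E|apply (f_equal Im) in E|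
      apply (f_equal Re) in E]; unfold Re, Im in E; simpl in E; lra. }
  assert (a <> c) by (intros ->; rewrite Ea in Ec; tauto).
  assert (a <> d) by (intros ->; rewrite Ea in Ed; tauto).
  assert (c <> d) by (intros ->; rewrite Ec in Ed; tauto).
  assert (Nw : forall s, segment p q s <> w /\ segment q p s <> w).
  { intros s; split; intros E; apply (f_equal Im) in E; unfold segment, q, w, Im in E;
      simpl in E; lra. }
  assert (Nq : forall s, segment p w s <> q /\ segment w p s <> q).
  { intros s; split; intros E; apply (f_equal Re) in E; unfold segment, q, w, Re in E;
      simpl in E; lra. }
  assert (Np : forall s, segment q w s <> p /\ segment w q s <> p).
  { intros s; split; intros E; pose proof (f_equal Re E) as E1; pose proof (f_equal Im E) as E2;
      unfold segment, q, w, Re, Im in E1, E2; simpl in E1, E2; nra. }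
  destruct (Rtotal_order a c) as [K|[K|K]]; [|tauto|];
    destruct (Rtotal_order a d) as [K'|[K'|K']]; try tauto;
    destruct (Rtotal_order c d) as [K''|[K''|K'']]; try tauto; try lra.
  - apply (Hsplit a c d); rewrite ?Ea, ?Ec, ?Ed; auto. intros; apply Nq.
  - apply (Hsplit a d c); rewrite ?Ea, ?Ec, ?Ed; auto. intros; apply Nw.
  - apply (Hsplit d a c); rewrite ?Ea, ?Ec, ?Ed; auto. intros; apply Np.
  - apply (Hsplit c a d); rewrite ?Ea, ?Ec, ?Ed; auto. intros; apply Np.
  - apply (Hsplit c d a); rewrite ?Ea, ?Ec, ?Ed; auto. intros; apply Nw.
  - apply (Hsplit d c a); rewrite ?Ea, ?Ec, ?Ed; auto. intros; apply Nq.
Qed.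

(** * Multiplicative errors, exponential and logarithm *)

Lemma cderiv_comp_rev f t a d : cderiv f (a - t) d -> cderiv (fun s => f (a - s)) t (- d)%C.
Proof.
  intros [H1 H2]. split.
  - evar_last. exact (derive_comp (fun s => Re (f s)) (fun s => a - s) t _ _ H1 (derive_rev a t)).
    unfold Re; simpl. ring.
  - evar_last. exact (derive_comp (fun s => Im (f s)) (fun s => a - s) t _ _ H2 (derive_rev a t)).
    unfold Im; simpl. ring.
Qed.

Lemma Re_mult_conj_le a b : Re a * Re b + Im a * Im b <= Cmod a * Cmod b.
Proof.
  pose proof (Cmod_sqmod a) as Ha. pose proof (Cmod_sqmod b) as Hb.
  pose proof (Cmod_ge_0 a). pose proof (Cmod_ge_0 b). unfold sqmod in *.
  apply Rnot_lt_le. intros Hlt.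
  assert (H1 : (Cmod a * Cmod b) ^ 2 < (Re a * Re b + Im a * Im b) ^ 2).
  { assert (0 <= Cmod a * Cmod b) by now apply Rmult_le_pos. nra. }
  replace ((Cmod a * Cmod b) ^ 2) with ((Re a ^ 2 + Im a ^ 2) * (Re b ^ 2 + Im b ^ 2)) in H1
    by (rewrite <- Ha, <- Hb; ring).
  pose proof (pow2_ge_0 (Re a * Im b - Im a * Re b)). nra.
Qed.

(** The modulus of [f] grows at most like [exp E], hence [|f'|] is at most
    the derivative of [|f a| exp (E - E a)]; comparing along the direction of
    [f b - f a] gives the bound without a logarithm of [f]. *)
Lemma log_derivative_bound (f e : R -> C) (E dE : R -> R) a b :
  a <= b ->
  (forall t, a <= t <= b -> cderiv f t (e t * f t)%C) ->
  (forall t, a <= t <= b -> is_derive E t (dE t)) ->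
  (forall t, a <= t <= b -> Cmod (e t) <= dE t) ->
  Cmod (f b - f a)%C <= Cmod (f a) * (exp (E b - E a) - 1).
Proof.
  intros Hab Hf HE He.
  assert (Hgrow : forall t, a <= t <= b -> Cmod (f t) <= Cmod (f a) * exp (E t - E a)).
  { intros t Ht.
    assert (H : sqmod (f t) * exp (-2 * E t) <= sqmod (f a) * exp (-2 * E a)).
    { apply (nonincreasing_of_derive (fun t => sqmod (f t) * exp (-2 * E t))
        (fun t => 2 * Re (e t) * sqmod (f t) * exp (-2 * E t) +
                  sqmod (f t) * (exp (-2 * E t) * (-2 * dE t))) a t); [lra| |].
      - intros s Hs.
        apply (derive_mult (fun t => sqmod (f t)) (fun t => exp (-2 * E t))).
        + apply derive_sqmod_mult. apply Hf. lra.
        + apply (derive_comp exp (fun t => -2 * E t)); [apply is_derive_exp|].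
          evar_last. exact (derive_mult _ _ _ _ _ (is_derive_const (-2) s) (HE s ltac:(lra))).
          unfold zero; simpl; ring.
      - intros s Hs. pose proof (Re_le_Cmod (e s)) as R1. pose proof (He s ltac:(lra)) as R2.
        apply Rabs_le_between in R1.
        pose proof (exp_pos (-2 * E s)). pose proof (sqmod_nonneg (f s)).
        replace (2 * Re (e s) * sqmod (f s) * exp (-2 * E s) + sqmod (f s) * (exp (-2 * E s) * (-2 * dE s)))
          with (- (sqmod (f s) * exp (-2 * E s) * (2 * (dE s - Re (e s))))) by ring.
        assert (0 <= sqmod (f s) * exp (-2 * E s) * (2 * (dE s - Re (e s)))).
        { apply Rmult_le_pos; [apply Rmult_le_pos|]; lra. }
        lra. }
    apply Rsqr_incr_0_var.
    - unfold Rsqr. replace (Cmod (f t) * Cmod (f t)) with (sqmod (f t)) by (rewrite <- Cmod_sqmod; ring).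
      replace (Cmod (f a) * exp (E t - E a) * (Cmod (f a) * exp (E t - E a)))
        with (sqmod (f a) * exp (-2 * E a) * exp (2 * E t)).
      + apply Rmult_le_reg_r with (exp (-2 * E t)); [apply exp_pos|].
        eapply Rle_trans; [exact H|]. right. rewrite Rmult_assoc, <- exp_plus.
        replace (2 * E t + -2 * E t) with 0 by ring. rewrite exp_0. ring.
      + rewrite <- Cmod_sqmod. rewrite !Rmult_assoc, <- exp_plus.
        replace (exp (E t - E a) * (Cmod (f a) * exp (E t - E a)))
          with (Cmod (f a) * (exp (E t - E a) * exp (E t - E a))) by ring.
        rewrite <- exp_plus. replace (E t - E a + (E t - E a)) with (-2 * E a + 2 * E t) by ring. ring.
    - apply Rmult_le_pos; [apply Cmod_ge_0|left; apply exp_pos]. }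
  destruct (Req_dec (Cmod (f b - f a)%C) 0) as [h|h].
  { rewrite h. apply Rmult_le_pos; [apply Cmod_ge_0|].
    assert (Hm : E a <= E b).
    { apply (nondecreasing_of_derive E dE a b Hab HE). intros t Ht.
      pose proof (Cmod_ge_0 (e t)). specialize (He t Ht). lra. }
    pose proof (exp_monotone 0 (E b - E a) ltac:(lra)). rewrite exp_0 in H. lra. }
  (* Compare in the direction [n] of the displacement. *)
  set (n := (f b - f a)%C) in *.
  assert (Hn : 0 < Cmod n) by (pose proof (Cmod_ge_0 n); lra).
  set (g t := Re n * Re (f t) + Im n * Im (f t)).
  assert (Hg : Cmod n * (Cmod (f a) * exp (E a - E a)) - g a <=
               Cmod n * (Cmod (f a) * exp (E b - E a)) - g b).
  { apply (nondecreasing_of_derive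
      (fun t => Cmod n * (Cmod (f a) * exp (E t - E a)) - g t)
      (fun t => Cmod n * (Cmod (f a) * (exp (E t - E a) * dE t)) -
        (Re n * Re (e t * f t)%C + Im n * Im (e t * f t)%C)) a b Hab).
    - intros t Ht. destruct (Hf t Ht) as [D1 D2].
      apply (derive_minus (fun t => Cmod n * (Cmod (f a) * exp (E t - E a))) g).
      + assert (D3 : is_derive (fun t => E t - E a) t (dE t)).
        { evar_last. exact (derive_minus _ _ _ _ _ (HE t Ht) (is_derive_const (E a) t)).
          unfold zero; simpl; ring. }
        assert (D4 := derive_comp exp _ t _ _ (is_derive_exp _) D3).
        assert (D5 := derive_mult _ _ _ _ _ (is_derive_const (Cmod (f a)) t) D4).
        evar_last. exact (derive_mult _ _ _ _ _ (is_derive_const (Cmod n) t) D5).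
        unfold zero; simpl; ring.
      + evar_last. exact (derive_plus _ _ _ _ _
          (derive_mult _ _ _ _ _ (is_derive_const (Re n) t) D1)
          (derive_mult _ _ _ _ _ (is_derive_const (Im n) t) D2)).
        unfold zero; simpl; ring.
    - intros t Ht. pose proof (Re_mult_conj_le n (e t * f t)%C) as Hip.
      rewrite Cmod_mult in Hip.
      assert (Cmod (e t) * Cmod (f t) <= dE t * (Cmod (f a) * exp (E t - E a))).
      { apply Rmult_le_compat; auto using Cmod_ge_0. }
      assert (Cmod n * (Cmod (e t) * Cmod (f t)) <= Cmod n * (dE t * (Cmod (f a) * exp (E t - E a))))
        by (apply Rmult_le_compat_l; lra).
      lra. }
  rewrite Rminus_diag, exp_0 in Hg.
  assert (Hgn : g b - g a = Cmod n ^ 2).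
  { rewrite Cmod_sqmod. unfold g, sqmod, n, Re, Im; simpl. ring. }
  apply Rmult_le_reg_l with (Cmod n); [exact Hn|]. nra.
Qed.

Lemma log_derivative_bound_rev (f e : R -> C) (E dE : R -> R) a b :
  a <= b ->
  (forall t, a <= t <= b -> cderiv f t (e t * f t)%C) ->
  (forall t, a <= t <= b -> is_derive E t (dE t)) ->
  (forall t, a <= t <= b -> Cmod (e t) <= dE t) ->
  Cmod (f a - f b)%C <= Cmod (f b) * (exp (E b - E a) - 1).
Proof.
  intros Hab Hf HE He.
  pose proof (log_derivative_bound (fun s => f (a + b - s)) (fun s => (- e (a + b - s)%R)%C)
    (fun s => - E (a + b - s)) (fun s => dE (a + b - s)) a b Hab) as H.
  cbv beta in H.
  replace (a + b - a) with b in H by ring. replace (a + b - b) with a in H by ring.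
  replace (- E a - - E b) with (E b - E a) in H by ring.
  apply H.
  - intros t Ht. eapply cderiv_ext_val; [apply cderiv_comp_rev; apply Hf; lra|]. ring.
  - intros t Ht. evar_last.
    exact (derive_opp _ _ _ (derive_comp E (fun s => a + b - s) t _ _ (HE (a + b - t) ltac:(lra))
       (derive_rev (a + b) t))).
    ring.
  - intros t Ht. rewrite Cmod_opp. apply He. lra.
Qed.

(** Measured through [exp], errors add up under multiplication. *)
Definition near (x : R) (z : C) : Prop := Cmod (z - RtoC 1)%C <= exp x - 1.

Lemma near_mult x y a b : near x a -> near y b -> near (x + y) (a * b)%C.
Proof.
  unfold near. intros Ha Hb.
  replace (a * b - RtoC 1)%C with ((a - RtoC 1) * (b - RtoC 1) + ((a - RtoC 1) + (b - RtoC 1)))%C by ring.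
  eapply Rle_trans; [apply Cmod_triangle|]. rewrite Cmod_mult, exp_plus.
  pose proof (Cmod_triangle (a - RtoC 1)%C (b - RtoC 1)%C).
  pose proof (Cmod_ge_0 (a - RtoC 1)%C). pose proof (Cmod_ge_0 (b - RtoC 1)%C). nra.
Qed.

Lemma near_monotone x y a : x <= y -> near x a -> near y a.
Proof. unfold near. intros H Ha. apply exp_monotone in H. lra. Qed.

Lemma near_of_dist x z : Cmod (z - RtoC 1)%C <= x -> near x z.
Proof. unfold near. intros H. pose proof (exp_ineq1_le x). lra. Qed.

Lemma near_of_quotient x z w : w <> RtoC 0 ->
  Cmod (z - w)%C <= Cmod w * (exp x - 1) -> near x (z / w)%C.
Proof.
  intros Hw H. unfold near.
  replace (z / w - RtoC 1)%C with ((z - w) / w)%C by (field; exact Hw).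
  rewrite Cmod_div by exact Hw. apply Cmod_gt_0 in Hw.
  apply Rmult_le_reg_r with (Cmod w); [exact Hw|]. unfold Rdiv.
  rewrite Rmult_assoc, Rinv_l, Rmult_1_r by lra. lra.
Qed.

Lemma Cexp_plus z w : Cexp (z + w)%C = (Cexp z * Cexp w)%C.
Proof.
  unfold Cexp. apply C_ext; unfold Re, Im; simpl; rewrite exp_plus.
  - rewrite cos_plus. ring.
  - rewrite sin_plus. ring.
Qed.

Lemma Cexp_0 : Cexp (RtoC 0) = RtoC 1.
Proof.
  unfold Cexp. apply C_ext; unfold Re, Im; simpl; rewrite exp_0.
  - rewrite cos_0. ring.
  - rewrite sin_0. ring.
Qed.

Lemma Cexp_neq0 z : Cexp z <> RtoC 0.
Proof.
  intros E. assert (H : (Cexp z * Cexp (- z))%C = RtoC 1).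
  { rewrite <- Cexp_plus. replace (z + - z)%C with (RtoC 0) by ring. apply Cexp_0. }
  rewrite E in H. replace (RtoC 0 * Cexp (- z))%C with (RtoC 0) in H by ring.
  apply (f_equal Re) in H. simpl in H. lra.
Qed.

Lemma Cexp_RtoC x : Cexp (RtoC x) = RtoC (exp x).
Proof.
  unfold Cexp. apply C_ext; unfold Re, Im; simpl.
  - rewrite cos_0. ring.
  - rewrite sin_0. ring.
Qed.

Lemma Cmod_Cexp z : Cmod (Cexp z) = exp (Re z).
Proof.
  transitivity (sqrt (exp (Re z) ^ 2)); [|apply sqrt_pow2; left; apply exp_pos].
  unfold Cmod, Cexp. f_equal. pose proof (sin2_cos2 (Im z)) as H. unfold Rsqr in H.
  rewrite <- (Rmult_1_r (exp (Re z) ^ 2)), <- H. unfold Re, Im; simpl. ring.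
Qed.

Lemma cderiv_Cexp q t d : cderiv q t d -> cderiv (fun s => Cexp (q s)) t (d * Cexp (q t))%C.
Proof.
  intros [H1 H2].
  assert (D0 := derive_comp exp _ t _ _ (is_derive_exp _) H1).
  assert (D1 := derive_comp cos _ t _ _ (is_derive_cos _) H2).
  assert (D2 := derive_comp sin _ t _ _ (is_derive_sin _) H2).
  split; unfold Cexp.
  - evar_last. exact (derive_mult _ _ _ _ _ D0 D1). unfold Re, Im; simpl. ring.
  - evar_last. exact (derive_mult _ _ _ _ _ D0 D2). unfold Re, Im; simpl. ring.
Qed.

Lemma near_Cexp z : near (Cmod z) (Cexp z).
Proof.
  pose proof (log_derivative_bound (fun t => Cexp (RtoC t * z)%C) (fun _ => z)
    (fun t => t * Cmod z) (fun _ => Cmod z) 0 1 ltac:(lra)) as H.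
  cbv beta in H.
  replace (RtoC 0 * z)%C with (RtoC 0) in H by ring.
  replace (RtoC 1 * z)%C with z in H by ring.
  rewrite Cexp_0, Cmod_R, Rabs_R1, Rmult_1_l in H.
  replace (1 * Cmod z - 0 * Cmod z) with (Cmod z) in H by ring. apply H.
  - intros t _. apply cderiv_Cexp.
    eapply cderiv_ext_val; [apply (cderiv_mult (fun t => RtoC t) (fun _ => z))|].
    + apply (cderiv_RtoC (fun t => t)). apply is_derive_id.
    + apply cderiv_const.
    + simpl. unfold one; simpl. ring.
  - intros t _. auto_derive; [trivial|ring].
  - intros. lra.
Qed.

(** The logarithm with argument in [(0, PI)]; the quotient [Re z / Im z] keeps
    [atan] smooth on the upper half-plane. *)
Definition clog (z : C) : C := (ln (sqmod z) / 2, PI / 2 - atan (Re z / Im z)).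

Lemma cderiv_clog f t d :
  cderiv f t d -> 0 < Im (f t) -> cderiv (fun s => clog (f s)) t (d / f t)%C.
Proof.
  intros H HY. pose proof H as [H1 H2].
  assert (Hq : 0 < sqmod (f t)) by (apply sqmod_pos_im; lra).
  split; unfold clog.
  - evar_last.
    + exact (derive_mult _ _ _ _ _ (derive_ln _ _ _ (derive_sqmod f t d H) Hq)
               (is_derive_const (/ 2) t)).
    + unfold sqmod, zero, Re, Im in *; simpl in *. field. nra.
  - assert (D := derive_mult _ _ _ _ _ H1 (derive_inv _ _ _ H2 ltac:(lra))).
    assert (D' := derive_comp atan _ t _ _ (is_derive_atan _) D).
    evar_last.
    + exact (derive_minus _ _ _ _ _ (is_derive_const (PI / 2) t) D').
    + unfold sqmod, zero, Re, Im, Rsqr in *; simpl in *. field.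
      repeat split; try lra; nra.
Qed.

Lemma clog_scale r z : 0 < r -> 0 < Im z -> clog (RtoC r * z)%C = (RtoC (ln r) + clog z)%C.
Proof.
  intros Hr HY. assert (Hq : 0 < sqmod z) by (apply sqmod_pos_im; lra).
  unfold clog. apply C_ext.
  - rewrite sqmod_mult. replace (sqmod (RtoC r)) with (r * r)
      by (unfold sqmod, Re, Im; simpl; ring).
    rewrite ln_mult, ln_mult by (auto; nra). simpl. field.
  - assert (E : Re (RtoC r * z)%C / Im (RtoC r * z)%C = Re z / Im z).
    { unfold Re, Im in *; simpl. field. split; lra. }
    rewrite E. unfold Im; simpl. ring.
Qed.

Lemma clog_lipschitz z w m : 0 < m -> m <= Im z -> m <= Im w ->
  Cmod (clog z - clog w)%C <= 2 / m * Cmod (z - w)%C.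
Proof.
  intros Hm Hz Hw.
  assert (Hseg : forall s, 0 <= s <= 1 -> m <= Im (segment w z s)).
  { intros s Hs. replace (Im (segment w z s)) with ((1 - s) * Im w + s * Im z)
      by (unfold segment, Im; simpl; ring). nra. }
  assert (Hd : forall s, 0 <= s <= 1 ->
    cderiv (fun s => clog (segment w z s)) s ((z - w) / segment w z s)%C).
  { intros s Hs. apply cderiv_clog; [|pose proof (Hseg s Hs); lra].
    unfold segment. eapply cderiv_ext_val.
    - apply (cderiv_plus (fun _ => w) (fun s => RtoC s * (z - w))%C).
      + apply cderiv_const.
      + apply (cderiv_mult (fun s => RtoC s) (fun _ => (z - w)%C)).
        * apply (cderiv_RtoC (fun s => s)). apply is_derive_id.
        * apply cderiv_const.
    - simpl. unfold one; simpl. ring. }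
  assert (Hb : forall s, 0 <= s <= 1 -> Cmod ((z - w) / segment w z s)%C <= Cmod (z - w)%C / m).
  { intros s Hs. pose proof (Hseg s Hs) as HI.
    assert (Hc : m <= Cmod (segment w z s)).
    { eapply Rle_trans; [|apply Im_le_Cmod]. rewrite Rabs_pos_eq; lra. }
    rewrite Cmod_div by (apply neq0_im; lra).
    unfold Rdiv. apply Rmult_le_compat_l; [apply Cmod_ge_0|]. apply Rinv_le_contravar; lra. }
  assert (E0 : segment w z 0 = w) by (unfold segment; ring).
  assert (E1 : segment w z 1 = z) by (unfold segment; ring).
  pose proof (displacement_le (fun s => Re (clog (segment w z s)))
    (fun s => Re ((z - w) / segment w z s)%C) (Cmod (z - w)%C / m) 0 1 ltac:(lra)
    (fun s Hs => proj1 (Hd s Hs))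
    (fun s Hs => Rle_trans _ _ _ (Re_le_Cmod _) (Hb s Hs))) as B1.
  pose proof (displacement_le (fun s => Im (clog (segment w z s)))
    (fun s => Im ((z - w) / segment w z s)%C) (Cmod (z - w)%C / m) 0 1 ltac:(lra)
    (fun s Hs => proj2 (Hd s Hs))
    (fun s Hs => Rle_trans _ _ _ (Im_le_Cmod _) (Hb s Hs))) as B2.
  cbv beta in B1, B2. rewrite E0, E1 in B1, B2.
  eapply Rle_trans; [apply Cmod_le_abs|].
  change (Rabs (Re (clog z) - Re (clog w)) + Rabs (Im (clog z) - Im (clog w))
          <= 2 / m * Cmod (z - w)%C).
  unfold Rdiv in *. lra.
Qed.

(** * Left limits of complex functions *)

Definition climit (f : R -> C) (T : R) (l : C) : Prop :=
  forall e, 0 < e -> exists d, 0 < d /\ forall u, T - d < u < T -> Cmod (f u - l)%C < e.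

Lemma climit_mult f g T a b : climit f T a -> climit g T b ->
  climit (fun u => f u * g u)%C T (a * b)%C.
Proof.
  intros Hf Hg e He.
  set (k := Cmod a + Cmod b + 1).
  pose proof (Cmod_ge_0 a). pose proof (Cmod_ge_0 b).
  assert (Hk : 1 <= k) by (unfold k; lra).
  assert (Hek : 0 < Rmin 1 (e / k)) by (apply Rmin_glb_lt; [lra|apply Rdiv_lt_0_compat; lra]).
  destruct (Hf _ Hek) as [d1 [Hd1 K1]]. destruct (Hg _ Hek) as [d2 [Hd2 K2]].
  exists (Rmin d1 d2). split; [now apply Rmin_glb_lt|]. intros u Hu.
  pose proof (Rmin_l d1 d2). pose proof (Rmin_r d1 d2).
  specialize (K1 u ltac:(lra)). specialize (K2 u ltac:(lra)).
  set (m := Rmin 1 (e / k)) in *.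
  assert (Hm1 : m <= 1) by apply Rmin_l. assert (Hm2 : m <= e / k) by apply Rmin_r.
  replace (f u * g u - a * b)%C with ((f u - a) * (g u - b) + (a * (g u - b) + b * (f u - a)))%C by ring.
  eapply Rle_lt_trans; [apply Cmod_triangle|].
  eapply Rle_lt_trans; [apply Rplus_le_compat_l, Cmod_triangle|].
  rewrite !Cmod_mult.
  pose proof (Cmod_ge_0 (f u - a)%C). pose proof (Cmod_ge_0 (g u - b)%C).
  assert (m * k <= e).
  { apply Rle_trans with (e / k * k); [apply Rmult_le_compat_r; lra|]. right; field; lra. }
  set (x := Cmod (f u - a)%C) in *. set (y := Cmod (g u - b)%C) in *.
  assert (x * y <= x) by nra.
  assert (Cmod a * y <= Cmod a * m) by (apply Rmult_le_compat_l; lra).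
  assert (Cmod b * x <= Cmod b * m) by (apply Rmult_le_compat_l; lra).
  unfold k in *. nra.
Qed.

Lemma climit_Cexp f T l : climit f T l -> climit (fun u => Cexp (f u)) T (Cexp l).
Proof.
  intros Hf e He.
  assert (Hl : 0 < Cmod (Cexp l)) by (apply Cmod_gt_0, Cexp_neq0).
  assert (Hln : 0 < ln (1 + e / Cmod (Cexp l))).
  { rewrite <- ln_1. apply ln_increasing; [lra|].
    pose proof (Rdiv_lt_0_compat _ _ He Hl). lra. }
  destruct (Hf _ Hln) as [d [Hd K]]. exists d. split; [exact Hd|]. intros u Hu.
  specialize (K u Hu).
  replace (Cexp (f u)) with (Cexp l * Cexp (f u - l))%C
    by (rewrite <- Cexp_plus; f_equal; ring).
  replace (Cexp l * Cexp (f u - l) - Cexp l)%C with (Cexp l * (Cexp (f u - l) - RtoC 1))%C by ring.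
  rewrite Cmod_mult. pose proof (near_Cexp (f u - l)%C) as Hn. unfold near in Hn.
  apply exp_increasing in K. rewrite exp_ln in K
    by (pose proof (Rdiv_lt_0_compat _ _ He Hl); lra).
  apply Rle_lt_trans with (Cmod (Cexp l) * (exp (Cmod (f u - l)%C) - 1)).
  - apply Rmult_le_compat_l; lra.
  - apply Rlt_le_trans with (Cmod (Cexp l) * (e / Cmod (Cexp l))).
    + apply Rmult_lt_compat_l; lra.
    + right. field. lra.
Qed.

Lemma climit_scal a f T l : climit f T l -> climit (fun u => a * f u)%C T (a * l)%C.
Proof.
  intros Hf. apply climit_mult; [|exact Hf].
  intros e He. exists 1. split; [lra|]. intros u _.
  replace (a - a)%C with (RtoC 0) by ring. now rewrite Cmod_0.
Qed.

Lemma climit_clog f T l m : 0 < m -> m <= Im l ->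
  (exists d, 0 < d /\ forall u, T - d < u < T -> m <= Im (f u)) ->
  climit f T l -> climit (fun u => clog (f u)) T (clog l).
Proof.
  intros Hm Hl [d0 [Hd0 Hf0]] Hf e He.
  destruct (Hf (e * m / 2)) as [d [Hd K]]; [apply Rdiv_lt_0_compat; nra|].
  exists (Rmin d0 d). split; [now apply Rmin_glb_lt|]. intros u Hu.
  pose proof (Rmin_l d0 d). pose proof (Rmin_r d0 d).
  specialize (K u ltac:(lra)). specialize (Hf0 u ltac:(lra)).
  eapply Rle_lt_trans; [now apply (clog_lipschitz _ _ m)|].
  apply Rlt_le_trans with (2 / m * (e * m / 2)).
  - apply Rmult_lt_compat_l; [apply Rdiv_lt_0_compat; lra|exact K].
  - right. field. lra.
Qed.

Lemma climit_le f T l K x a : 0 <= K -> (exists d, 0 < d /\ forall u, T - d < u < T ->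
    Cmod (f u - a)%C <= Cmod (f u) * K + x) -> climit f T l ->
  Cmod (l - a)%C <= Cmod l * K + x.
Proof.
  intros HK [d0 [Hd0 H]] Hf. apply le_epsilon. intros e He.
  destruct (Hf (e / (K + 1))) as [d [Hd Hu]]; [apply Rdiv_lt_0_compat; lra|].
  set (u := T - Rmin d0 d / 2).
  assert (Hm : 0 < Rmin d0 d) by now apply Rmin_glb_lt.
  pose proof (Rmin_l d0 d). pose proof (Rmin_r d0 d).
  specialize (Hu u ltac:(unfold u; lra)). specialize (H u ltac:(unfold u; lra)).
  pose proof (Cmod_dist_triangle l (f u) a) as T1. rewrite (Cmod_sym l (f u)) in T1.
  assert (T2 : Cmod (f u) <= Cmod l + Cmod (f u - l)%C).
  { replace (f u) with (l + (f u - l))%C at 1 by ring. apply Cmod_triangle. }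
  assert (Cmod (f u) * K <= (Cmod l + Cmod (f u - l)%C) * K) by (apply Rmult_le_compat_r; lra).
  assert (Cmod (f u - l)%C * (K + 1) <= e).
  { apply Rle_trans with (e / (K + 1) * (K + 1)); [apply Rmult_le_compat_r; lra|].
    right; field; lra. }
  nra.
Qed.

(** * The cone condition *)

(** Since [a / 2 + y2 + (4 - C) / 4 <= 2 - e / 2], clearing the denominator
    leaves [e (e - 2)^2 / 2 + y2 (2 + e / 2) >= 0]; the square is what makes 4
    the critical constant. *)
Lemma excursion_inequality (C a e y2 : R) :
  C < 4 -> 0 <= a -> 0 <= e -> a + e <= C -> 0 < y2 <= (4 - C) / 4 ->
  a / 2 + y2 + (4 - C) / 4 <= (2 * e + 4 * y2) / (e ^ 2 + y2).
Proof.
  intros HC Ha He Hae Hy.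
  assert (Hq : 0 < e ^ 2 + y2) by nra.
  apply Rmult_le_reg_r with (e ^ 2 + y2); [exact Hq|].
  replace ((2 * e + 4 * y2) / (e ^ 2 + y2) * (e ^ 2 + y2)) with (2 * e + 4 * y2) by (field; lra).
  assert (H1 : a / 2 + y2 + (4 - C) / 4 <= 2 - e / 2) by lra.
  apply Rle_trans with ((2 - e / 2) * (e ^ 2 + y2)).
  - apply Rmult_le_compat_r; lra.
  - enough (0 <= e * (e - 2) ^ 2 / 2 + y2 * (2 + e / 2)) by nra.
    assert (0 <= e * (e - 2) ^ 2) by (apply Rmult_le_pos; [lra|apply pow2_ge_0]).
    nra.
Qed.

Definition excursion_const (C : R) : R := (4 - C) / 4 * exp (- 4 / ((4 - C) / 4)).

Section Excursion.
Variables (x Y l : R -> R) (C : R).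
Hypothesis C_lt : C < 4.
Let q u := (x u - l u) ^ 2 + Y u ^ 2.
Let eps := (4 - C) / 4.

Lemma excursion_const_pos : 0 < excursion_const C.
Proof. apply Rmult_lt_0_compat; [lra|apply exp_pos]. Qed.

(** While the height [Y] is small compared with the square root of the
    remaining time [s], the scale-invariant quantity
    [(p - x) / sqrt s + Y^2 / s] moves at a definite speed in logarithmic time.
    It is bounded, so [Y] cannot be small over a long logarithmic interval; and
    [Y] is monotone, so it cannot be small at all. *)
Lemma excursion_height (p t t1 : R) :
  t < t1 ->
  (forall u, t <= u < t1 ->
     is_derive x u (2 * (x u - l u) / q u) /\ is_derive Y u (- 2 * Y u / q u) /\
     0 < Y u /\ 0 < x u - l u /\ x u <= p /\ p - l u <= C * sqrt (t1 - u)) ->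
  excursion_const C * (t1 - t) <= Y t ^ 2.
Proof.
  intros Ht H. apply Rnot_lt_le. intros Hlt.
  assert (He : 0 < eps) by (unfold eps; lra).
  set (rho := exp (- 4 / eps)).
  assert (Hr : 0 < rho < 1).
  { split; [apply exp_pos|]. unfold rho. rewrite <- exp_0. apply exp_increasing.
    unfold Rdiv. pose proof (Rinv_0_lt_compat _ He). nra. }
  unfold excursion_const in Hlt. fold eps in Hlt. fold rho in Hlt.
  set (u1 := t1 - rho * (t1 - t)).
  assert (Hu1 : t <= u1 < t1) by (unfold u1; nra).
  set (G u := (p - x u) * / sqrt (t1 - u) + Y u ^ 2 * / (t1 - u)).
  assert (HY : forall u, t <= u <= u1 -> Y u <= Y t).
  { intros u Hu. apply (nonincreasing_of_derive Y (fun u => - 2 * Y u / q u)); [lra| |].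
    - intros v Hv. apply H; lra.
    - intros v Hv. destruct (H v ltac:(lra)) as [_ [_ [P _]]].
      pose proof (sumsq_pos (x v - l v) (Y v) P). unfold q, Rdiv.
      pose proof (Rinv_0_lt_compat _ H0). nra. }
  assert (HG : G u1 - eps * ln (t1 - u1) <= G t - eps * ln (t1 - t)).
  { apply (nonincreasing_of_derive (fun u => G u - eps * ln (t1 - u))
     (fun u => ((- (2 * (x u - l u) / q u)) * / sqrt (t1 - u) +
               (p - x u) * (- ((-1) / (2 * sqrt (t1 - u))) / sqrt (t1 - u) ^ 2) +
               ((2 * Y u * (- 2 * Y u / q u)) * / (t1 - u) +
                Y u ^ 2 * (- (-1) / (t1 - u) ^ 2))) - eps * ((-1) / (t1 - u))) t u1);
     [lra| |].
    - intros u Hu. destruct (H u ltac:(lra)) as [Dx [DY _]].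
      assert (Hs : 0 < t1 - u) by lra.
      assert (Hsq : 0 < sqrt (t1 - u)) by now apply sqrt_lt_R0.
      assert (D0 := derive_rev t1 u).
      assert (D1 := derive_inv _ _ _ (derive_sqrt _ _ _ D0 Hs) ltac:(lra)).
      assert (D2 := derive_inv _ _ _ D0 ltac:(lra)).
      assert (D3 := derive_ln _ _ _ D0 Hs).
      assert (D4 : is_derive (fun u => p - x u) u (- (2 * (x u - l u) / q u))).
      { evar_last. exact (derive_minus _ _ _ _ _ (is_derive_const p u) Dx).
        unfold zero; simpl; ring. }
      assert (D5 : is_derive (fun u => Y u ^ 2) u (2 * Y u * (- 2 * Y u / q u))).
      { evar_last. apply (is_derive_pow Y 2 u _ DY). simpl; ring. }
      assert (D6 : is_derive (fun u => eps * ln (t1 - u)) u (eps * ((-1) / (t1 - u)))).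
      { evar_last. exact (derive_mult _ _ _ _ _ (is_derive_const eps u) D3).
        unfold zero; simpl; ring. }
      exact (derive_minus _ _ _ _ _ (derive_plus _ _ _ _ _
        (derive_mult _ _ _ _ _ D4 D1) (derive_mult _ _ _ _ _ D5 D2)) D6).
    - intros u Hu. destruct (H u ltac:(lra)) as [_ [_ [HYp [HX [Hxp Hp]]]]].
      pose proof (HY u Hu) as HYt.
      assert (Hs : 0 < t1 - u) by lra.
      set (s := sqrt (t1 - u)) in *.
      assert (Hsq : 0 < s) by now apply sqrt_lt_R0.
      assert (Es : t1 - u = s ^ 2) by (unfold s; rewrite pow2_sqrt; lra).
      set (a := (p - x u) / s). set (e := (x u - l u) / s). set (y2 := Y u ^ 2 / s ^ 2).
      assert (Ea : p - x u = a * s) by (unfold a; field; lra).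
      assert (Ee : x u - l u = e * s) by (unfold e; field; lra).
      assert (Ey : Y u ^ 2 = y2 * s ^ 2) by (unfold y2; field; lra).
      assert (Hy2 : 0 < y2) by (unfold y2; apply Rdiv_lt_0_compat; nra).
      assert (Hy2' : y2 <= eps).
      { apply Rmult_le_reg_r with (s ^ 2); [nra|]. rewrite <- Ey, <- Es.
        assert (rho * (t1 - t) <= t1 - u) by (unfold u1 in Hu; lra). nra. }
      assert (Ha : 0 <= a) by (unfold a; apply Rdiv_le_0_compat; lra).
      assert (He0 : 0 <= e) by (unfold e; apply Rdiv_le_0_compat; lra).
      assert (Hae : a + e <= C).
      { apply Rmult_le_reg_r with s; [exact Hsq|]. rewrite Rmult_plus_distr_r, <- Ea, <- Ee. lra. }
      pose proof (excursion_inequality C a e y2 C_lt Ha He0 Hae (conj Hy2 Hy2')) as Hmain.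
      fold eps in Hmain. unfold q. rewrite Es, Ea, Ee.
      assert (Hq : 0 < e ^ 2 + y2) by nra.
      assert (Hs2 : 0 < s ^ 2) by nra.
      replace (2 * Y u * (-2 * Y u / ((e * s) ^ 2 + Y u ^ 2)))
        with (- 4 * Y u ^ 2 / ((e * s) ^ 2 + Y u ^ 2)) by (field; rewrite Ey; nra).
      rewrite Ey.
      replace (- (2 * (e * s) / ((e * s) ^ 2 + y2 * s ^ 2)) * / s +
        a * s * (- (-1 / (2 * s)) / s ^ 2) +
        (-4 * (y2 * s ^ 2) / ((e * s) ^ 2 + y2 * s ^ 2) * / s ^ 2 +
         y2 * s ^ 2 * (- -1 / (s ^ 2) ^ 2)) - eps * (-1 / s ^ 2))
      with (/ s ^ 2 * (a / 2 + y2 + eps - (2 * e + 4 * y2) / (e ^ 2 + y2))).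
      + pose proof (Rinv_0_lt_compat _ Hs2). nra.
      + field. repeat split; nra. }
  destruct (H t ltac:(lra)) as [_ [_ [HYp [HX [Hxp Hp]]]]].
  destruct (H u1 ltac:(lra)) as [_ [_ [HYp1 [HX1 [Hxp1 Hp1]]]]].
  assert (Hs : 0 < t1 - t) by lra.
  assert (Hsq : 0 < sqrt (t1 - t)) by now apply sqrt_lt_R0.
  assert (G1 : 0 <= G u1).
  { unfold G. assert (0 < t1 - u1) by lra.
    pose proof (Rinv_0_lt_compat _ (sqrt_lt_R0 _ H0)).
    pose proof (Rinv_0_lt_compat _ H0). pose proof (pow2_ge_0 (Y u1)). nra. }
  assert (G0 : G t <= C + eps * rho).
  { unfold G. apply Rplus_le_compat.
    - apply Rmult_le_reg_r with (sqrt (t1 - t)); [exact Hsq|].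
      rewrite Rmult_assoc, Rinv_l, Rmult_1_r by lra. lra.
    - apply Rmult_le_reg_r with (t1 - t); [exact Hs|].
      rewrite Rmult_assoc, Rinv_l, Rmult_1_r by lra. lra. }
  assert (E1 : ln (t1 - u1) = - 4 / eps + ln (t1 - t)).
  { replace (t1 - u1) with (rho * (t1 - t)) by (unfold u1; ring).
    rewrite ln_mult by lra. unfold rho at 1. now rewrite ln_exp. }
  rewrite E1 in HG.
  replace (eps * (- 4 / eps + ln (t1 - t))) with (- 4 + eps * ln (t1 - t)) in HG
    by (field; lra).
  assert (eps * rho < eps) by nra. unfold eps in *. lra.
Qed.

End Excursion.

(** The first term serves excursions shorter than [eta], the second the longer
    ones, on which only the bound [M] is available. *)
Definition cone_const (C eta M : R) : R :=
  16 / excursion_const C + 8 * M ^ 2 / (excursion_const C * eta).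

Section ConeHalf.
Variables (x Y l : R -> R) (C eta M T t : R).
Hypothesis C_range : 0 < C < 4.
Hypothesis eta_pos : 0 < eta.
Hypothesis l_cont : forall u, continuous l u.
Hypothesis l_lip : forall u v, Rabs (u - v) < eta -> Rabs (l u - l v) <= C * sqrt (Rabs (u - v)).
Hypothesis l_bound : forall u, Rabs (l u) <= M.
Hypothesis t_lt : t < T.
Hypothesis flow : forall u, t <= u < T ->
  is_derive x u (2 * (x u - l u) / ((x u - l u) ^ 2 + Y u ^ 2)) /\
  is_derive Y u (- 2 * Y u / ((x u - l u) ^ 2 + Y u ^ 2)) /\ 0 < Y u.
Hypothesis tip : filterlim (fun u => x u - l u) (at_left T) (locally 0).
Hypothesis start : 0 < x t - l t.

Lemma gap_continuous u : t <= u < T -> continuous (fun u => x u - l u) u.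
Proof.
  intros Hu. apply (continuous_minus x l).
  - apply continuous_of_derive with (2 * (x u - l u) / ((x u - l u) ^ 2 + Y u ^ 2)).
    now apply flow.
  - apply l_cont.
Qed.

(** The two ways in which an excursion can end, at a zero of the gap or at
    [T], look alike from the left. *)
Lemma excursion_end :
  exists t1, t < t1 <= T /\ (forall u, t <= u < t1 -> 0 < x u - l u) /\
    forall e, 0 < e -> exists d, 0 < d /\
      forall u, t1 - d < u < t1 -> t <= u -> Rabs (x u - l t1) < e.
Proof.
  destruct (first_exit (fun u => x u - l u) t T t_lt gap_continuous start)
    as [t1 [Ht1 [Hpos Hzero]]].
  exists t1. split; [exact Ht1|]. split; [exact Hpos|].
  intros e He.
  destruct (continuous_eps _ _ (l_cont t1) (e / 2) ltac:(lra)) as [d1 [Hd1 Hl]].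
  assert (Hx : exists d, 0 < d /\ forall u, t1 - d < u < t1 -> Rabs (x u - l u) < e / 2).
  { destruct (Rle_lt_or_eq_dec _ _ (proj2 Ht1)) as [h|h].
    - destruct (continuous_eps _ _ (gap_continuous t1 ltac:(lra)) (e / 2) ltac:(lra)) as [d [Hd Hd']].
      exists d. split; [exact Hd|]. intros u Hu. rewrite (Hzero h) in Hd'. specialize (Hd' u).
      rewrite Rminus_0_r in Hd'. apply Hd'. rewrite Rabs_left; lra.
    - rewrite left_limit_eps in tip. destruct (tip (e / 2) ltac:(lra)) as [d [Hd Hu]].
      exists d. split; [exact Hd|]. intros u Hu'. specialize (Hu u ltac:(lra)).
      now rewrite Rminus_0_r in Hu. }
  destruct Hx as [d2 [Hd2 Hx]].
  exists (Rmin d1 d2). split; [now apply Rmin_glb_lt|].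
  intros u Hu _. pose proof (Rmin_l d1 d2). pose proof (Rmin_r d1 d2).
  specialize (Hx u ltac:(lra)).
  specialize (Hl u ltac:(rewrite Rabs_left; lra)).
  replace (x u - l t1) with ((x u - l u) + (l u - l t1)) by ring.
  eapply Rle_lt_trans; [apply Rabs_triang|]. lra.
Qed.

(** Over an excursion of length [s] the gap is at most of order [sqrt s] and
    the height at least of that order. If [s >= eta], the last [eta / 2] of
    the excursion already give the height, which only decreases in time. *)
Lemma cone_half : (x t - l t) ^ 2 <= cone_const C eta M * Y t ^ 2.
Proof.
  destruct excursion_end as [t1 [Ht1 [Hpos Hend]]].
  assert (Hmono : forall u v, t <= u <= v -> v < t1 -> x u <= x v).
  { intros u v Huv Hv.
    apply (nondecreasing_of_derive x (fun u => 2 * (x u - l u) / ((x u - l u) ^ 2 + Y u ^ 2)));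
      [lra| |].
    - intros w Hw. apply flow; lra.
    - intros w Hw. pose proof (Hpos w ltac:(lra)).
      apply Rdiv_le_0_compat; [lra|]. apply sumsq_pos. apply flow; lra. }
  assert (Hx : forall u, t <= u < t1 -> x u <= l t1).
  { intros u Hu. apply Rnot_lt_le. intros Hlt.
    destruct (Hend (x u - l t1) ltac:(lra)) as [d [Hd Hd']].
    set (v := Rmax u (t1 - d / 2)).
    assert (Hv : u <= v < t1 /\ t1 - d / 2 <= v).
    { unfold v. split; [split|]; [apply Rmax_l|apply Rmax_lub_lt; lra|apply Rmax_r]. }
    specialize (Hd' v ltac:(lra) ltac:(lra)).
    pose proof (Hmono u v ltac:(lra) ltac:(lra)). apply Rabs_lt_between in Hd'. lra. }
  assert (Hcore : forall u, t <= u < t1 -> t1 - u < eta ->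
    excursion_const C * (t1 - u) <= Y u ^ 2).
  { intros u Hu Hs. apply (excursion_height x Y l C (proj2 C_range) (l t1)); [lra|].
    intros v Hv. destruct (flow v ltac:(lra)) as [D1 [D2 D3]].
    split; [exact D1|split; [exact D2|split; [exact D3|split; [|split]]]].
    - apply Hpos; lra.
    - apply Hx; lra.
    - pose proof (l_lip t1 v) as L. rewrite Rabs_pos_eq in L by lra.
      specialize (L ltac:(lra)). apply Rabs_le_between in L. lra. }
  pose proof (excursion_const_pos C (proj2 C_range)) as Hc.
  pose proof (Hpos t ltac:(lra)) as HX. pose proof (Hx t ltac:(lra)) as HX'.
  destruct (flow t ltac:(lra)) as [_ [_ HY]].
  assert (HY2 : 0 < Y t ^ 2) by nra.
  assert (HM : 0 <= 8 * M ^ 2 / (excursion_const C * eta)).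
  { apply Rdiv_le_0_compat; [pose proof (pow2_ge_0 M); lra|]. now apply Rmult_lt_0_compat. }
  assert (H16 : 0 <= 16 / excursion_const C) by (apply Rdiv_le_0_compat; lra).
  unfold cone_const. destruct (Rlt_dec (t1 - t) eta) as [h|h].
  - pose proof (Hcore t ltac:(lra) h) as HYc.
    pose proof (l_lip t1 t) as L. rewrite (Rabs_pos_eq (t1 - t)) in L by lra.
    specialize (L h). apply Rabs_le_between in L.
    assert (Hs : 0 <= sqrt (t1 - t)) by apply sqrt_pos.
    assert (Es : sqrt (t1 - t) ^ 2 = t1 - t) by (apply pow2_sqrt; lra).
    assert (x t - l t <= 4 * sqrt (t1 - t)) by nra.
    assert ((x t - l t) ^ 2 <= 16 * (t1 - t)) by nra.
    apply Rle_trans with (16 / excursion_const C * Y t ^ 2); [|nra].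
    apply Rle_trans with (16 / excursion_const C * (excursion_const C * (t1 - t))).
    + replace (16 / excursion_const C * (excursion_const C * (t1 - t))) with (16 * (t1 - t))
        by (field; lra). lra.
    + nra.
  - set (u := t1 - eta / 2).
    pose proof (Hcore u ltac:(unfold u; lra) ltac:(unfold u; lra)) as HYc.
    assert (HYu : Y u <= Y t).
    { apply (nonincreasing_of_derive Y (fun u => - 2 * Y u / ((x u - l u) ^ 2 + Y u ^ 2)));
        [unfold u; lra| |].
      - intros v Hv. apply flow. unfold u in Hv. lra.
      - intros v Hv. destruct (flow v ltac:(unfold u in Hv; lra)) as [_ [_ P]].
        pose proof (sumsq_pos (x v - l v) (Y v) P) as Q. apply Rinv_0_lt_compat in Q.
        unfold Rdiv. nra. }
    destruct (flow u ltac:(unfold u; lra)) as [_ [_ HYu0]].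
    replace (t1 - u) with (eta / 2) in HYc by (unfold u; ring).
    assert (HYt : excursion_const C * eta / 2 <= Y t ^ 2) by nra.
    pose proof (l_bound t1) as B1. pose proof (l_bound t) as B2.
    apply Rabs_le_between in B1. apply Rabs_le_between in B2.
    assert ((x t - l t) ^ 2 <= 4 * M ^ 2) by nra.
    apply Rle_trans with (8 * M ^ 2 / (excursion_const C * eta) * Y t ^ 2); [|nra].
    apply Rle_trans with (8 * M ^ 2 / (excursion_const C * eta) * (excursion_const C * eta / 2)).
    + eapply Rle_trans; [exact H|]. right. field. split; lra.
    + now apply Rmult_le_compat_l.
Qed.
End ConeHalf.

(** * Solutions on half-open intervals and the hull *)

Lemma C_norm (z : C_R_NormedModule) : norm z = Cmod z.
Proof.
  unfold norm; simpl. unfold prod_norm, Cmod, norm; simpl. unfold abs; simpl.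
  do 2 f_equal; unfold Rabs; destruct Rcase_abs; ring.
Qed.

Lemma is_derive_eps (f : R -> R) t d :
  is_derive f t d <->
  forall e, 0 < e -> exists de, 0 < de /\ forall s, Rabs (s - t) < de ->
    Rabs (f s - f t - (s - t) * d) <= e * Rabs (s - t).
Proof.
  split.
  - intros [_ H] e He.
    destruct (H t (fun P HP => HP) (mkposreal e He)) as [de Hde].
    exists de. split; [apply cond_pos|]. intros s Hs. apply (Hde s Hs).
  - intros H. split; [apply is_linear_scal_l|].
    intros x Hx e. pose proof (is_filter_lim_locally_unique (V := AbsRing_NormedModule R_AbsRing) t x Hx) as Hxt.
    simpl in Hxt. subst x.
    destruct (H e (cond_pos e)) as [de [Hde Hs]].
    exists (mkposreal de Hde). intros s Hst. apply (Hs s Hst).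
Qed.

Lemma filterdiff_within_eps (g : R -> C) (D : R -> Prop) t (d : C) :
  D t ->
  filterdiff (K := R_AbsRing) (U := R_NormedModule) (V := C_R_NormedModule)
    g (within D (locally t)) (fun h => scal h d) <->
  forall e, 0 < e -> exists de, 0 < de /\ forall s, D s -> Rabs (s - t) < de ->
    Cmod (g s - g t - RtoC (s - t) * d)%C <= e * Rabs (s - t).
Proof.
  intros Dt.
  assert (E : forall s, norm (minus (minus (g s) (g t)) (scal (minus s t) d) : C_R_NormedModule)
                        = Cmod (g s - g t - RtoC (s - t) * d)%C).
  { intros s. rewrite C_norm. f_equal. apply C_ext; unfold Re, Im; simpl;
      unfold minus, plus, opp, scal; simpl; unfold scal, mult; simpl; unfold mult; simpl; ring. }
  split.
  - intros [_ H] e He.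
    assert (Hlim : is_filter_lim (within D (locally t)) t).
    { intros P [de HP]. exists de. intros s Hs _. now apply HP. }
    destruct (H t Hlim (mkposreal e He)) as [de Hde].
    exists de. split; [apply cond_pos|]. intros s Ds Hs. rewrite <- E. apply (Hde s Hs Ds).
  - intros H. split; [exact (is_linear_scal_l (K := R_AbsRing) (V := C_R_NormedModule) d)|].
    intros x Hx e.
    assert (x = t).
    { apply NNPP. intros Hn.
      assert (Hd : 0 < Rabs (t - x)) by (apply Rabs_pos_lt; lra).
      assert (HP : locally x (fun y => y <> t)).
      { exists (mkposreal _ Hd). intros y Hy Hyt. subst y. apply (Rlt_irrefl _ Hy). }
      destruct (Hx _ HP) as [de Hde]. apply (Hde t (ball_center t de) Dt eq_refl). }
    subst x. destruct (H e (cond_pos e)) as [de [Hde Hs]].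
    exists (mkposreal de Hde). intros s Hst Ds.
    eapply Rle_trans; [right; exact (E s)|]. exact (Hs s Ds Hst).
Qed.

Lemma cderiv_eps (f : R -> C) t d :
  cderiv f t d <->
  forall e, 0 < e -> exists de, 0 < de /\ forall s, Rabs (s - t) < de ->
    Cmod (f s - f t - RtoC (s - t) * d)%C <= e * Rabs (s - t).
Proof.
  split.
  - intros [H1 H2] e He. rewrite is_derive_eps in H1, H2.
    destruct (H1 (e / 2) ltac:(lra)) as [d1 [Hd1 K1]].
    destruct (H2 (e / 2) ltac:(lra)) as [d2 [Hd2 K2]].
    exists (Rmin d1 d2). split; [now apply Rmin_glb_lt|].
    intros s Hs. pose proof (Rmin_l d1 d2). pose proof (Rmin_r d1 d2).
    specialize (K1 s ltac:(lra)). specialize (K2 s ltac:(lra)).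
    eapply Rle_trans; [apply Cmod_le_abs|].
    replace (Re (f s - f t - RtoC (s - t) * d)%C) with (Re (f s) - Re (f t) - (s - t) * Re d)
      by (unfold Re, Im; simpl; ring).
    replace (Im (f s - f t - RtoC (s - t) * d)%C) with (Im (f s) - Im (f t) - (s - t) * Im d)
      by (unfold Re, Im; simpl; ring). lra.
  - intros H. split; apply is_derive_eps; intros e He;
      destruct (H e He) as [de [Hde Hs]]; exists de; (split; [exact Hde|]); intros s Hst;
      specialize (Hs s Hst).
    + replace (Re (f s) - Re (f t) - (s - t) * Re d) with (Re (f s - f t - RtoC (s - t) * d)%C)
        by (unfold Re, Im; simpl; ring).
      eapply Rle_trans; [apply Re_le_Cmod|exact Hs].
    + replace (Im (f s) - Im (f t) - (s - t) * Im d) with (Im (f s - f t - RtoC (s - t) * d)%C)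
        by (unfold Re, Im; simpl; ring).
      eapply Rle_trans; [apply Im_le_Cmod|exact Hs].
Qed.

Lemma cderiv_ext_loc (f g : R -> C) t d a b :
  a < t < b -> (forall s, a < s < b -> f s = g s) -> cderiv f t d -> cderiv g t d.
Proof.
  intros Ht E H. rewrite cderiv_eps in *. intros e He.
  destruct (H e He) as [de [Hde Hs]].
  exists (Rmin de (Rmin (t - a) (b - t))). split; [repeat apply Rmin_glb_lt; lra|].
  intros s Hst. pose proof (Rmin_l de (Rmin (t - a) (b - t))).
  pose proof (Rmin_r de (Rmin (t - a) (b - t))).
  pose proof (Rmin_l (t - a) (b - t)). pose proof (Rmin_r (t - a) (b - t)).
  assert (a < s < b) by (apply Rabs_lt_between in Hst; lra).
  rewrite <- !E by lra. apply Hs. lra.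
Qed.

(** The solutions that reach the point [lam T + i e] at time [T]; for [e = 0]
    these are the ones absorbed by the driving point. *)
Definition chord (lam : R -> R) (g : R -> C) (T e : R) : Prop :=
  (forall t, 0 <= t < T -> solves lam g t) /\ 0 <= e /\
  filterlim (fun t => Re (g t) - lam t) (at_left T) (locally 0) /\
  filterlim (fun t => Im (g t)) (at_left T) (locally e).

Lemma loewner_solution_of_solves lam g T :
  (forall t, 0 <= t < T -> solves lam g t) -> loewner_solution lam (g 0) T g.
Proof.
  intros H. split; [reflexivity|]. intros t Ht. destruct (H t Ht) as [D HY]. split.
  - intros E. rewrite E in HY. simpl in HY. lra.
  - apply filterdiff_within_eps; [exact Ht|]. rewrite cderiv_eps in D.
    intros e He. destruct (D e He) as [de [Hde Hs]]. exists de. split; [exact Hde|].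
    intros s _. apply Hs.
Qed.

(** Extending by the tangent at 0 makes the derivative there two-sided. On a
    compact time interval the solution keeps away from the driving point, so
    the height changes at a bounded logarithmic rate and remains positive. *)
Lemma solves_extension lam z T g :
  (forall t, continuous lam t) -> 0 < T -> 0 < Im z -> loewner_solution lam z T g ->
  exists f, (forall t, 0 <= t < T -> f t = g t) /\ forall t, 0 <= t < T -> solves lam f t.
Proof.
  intros Hc HT Hz [H0 Hg].
  set (f t := if Rlt_dec t 0 then (z + RtoC t * vel z (lam 0))%C else g t).
  assert (Ef : forall t, 0 <= t -> f t = g t).
  { intros t Ht. unfold f. destruct Rlt_dec; [lra|reflexivity]. }
  assert (Df : forall t, 0 <= t < T -> cderiv f t (vel (f t) (lam t))).
  { intros t Ht. destruct (Hg t Ht) as [_ D].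
    rewrite (filterdiff_within_eps g _ t _ Ht) in D.
    rewrite Ef by lra. apply cderiv_eps. intros e He.
    destruct (D e He) as [de [Hde Hs]].
    destruct (Rlt_or_le 0 t) as [h|h].
    - exists (Rmin de (Rmin t (T - t))). split; [repeat apply Rmin_glb_lt; lra|].
      intros s Hst. pose proof (Rmin_l de (Rmin t (T - t))).
      pose proof (Rmin_r de (Rmin t (T - t))).
      pose proof (Rmin_l t (T - t)). pose proof (Rmin_r t (T - t)).
      assert (0 < s < T) by (apply Rabs_lt_between in Hst; lra).
      rewrite !Ef by lra. apply Hs; lra.
    - assert (t = 0) by lra. subst t.
      exists (Rmin de T). split; [apply Rmin_glb_lt; lra|].
      intros s Hst. pose proof (Rmin_l de T). pose proof (Rmin_r de T).
      rewrite (Ef 0) by lra. destruct (Rlt_or_le s 0) as [h'|h'].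
      + unfold f. destruct Rlt_dec; [|lra]. rewrite H0.
        replace (z + RtoC s * vel z (lam 0) - z - RtoC (s - 0) * vel z (lam 0))%C
          with (RtoC 0) by (rewrite Rminus_0_r; ring).
        rewrite Cmod_0. apply Rmult_le_pos; [lra|apply Rabs_pos].
      + rewrite Ef by lra. apply Hs; [|lra].
        rewrite Rminus_0_r, Rabs_pos_eq in Hst; lra. }
  exists f. split; [intros; apply Ef; lra|].
  assert (HY : forall t, 0 <= t < T -> 0 < Im (f t) ^ 2).
  { intros t Ht.
    set (q u := (Re (f u) - lam u) ^ 2 + Im (f u) ^ 2).
    assert (Cq : forall u, 0 <= u <= t -> continuity_pt q u).
    { intros u Hu. apply continuity_pt_filterlim. destruct (Df u ltac:(lra)) as [D1 D2].
      apply continuous_of_derive in D1. apply continuous_of_derive in D2.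
      unfold q. simpl.
      assert (CX : continuous (fun u => Re (f u) - lam u) u)
        by (apply (continuous_minus (fun u => Re (f u)) lam); [exact D1|apply Hc]).
      apply (continuous_plus (fun u => (Re (f u) - lam u) * ((Re (f u) - lam u) * 1))
                             (fun u => Im (f u) * (Im (f u) * 1))).
      - apply (continuous_mult (fun u => Re (f u) - lam u) (fun u => (Re (f u) - lam u) * 1)); [exact CX|].
        apply (continuous_mult (fun u => Re (f u) - lam u) (fun _ => 1)); [exact CX|apply continuous_const].
      - apply (continuous_mult (fun u => Im (f u)) (fun u => Im (f u) * 1)); [exact D2|].
        apply (continuous_mult (fun u => Im (f u)) (fun _ => 1)); [exact D2|apply continuous_const]. }
    destruct (continuity_ab_min q 0 t (proj1 Ht) Cq) as [u0 [Hmin Hu0]].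
    assert (Hq0 : 0 < q u0).
    { destruct (Hg u0 ltac:(lra)) as [N _]. unfold q. rewrite Ef by lra.
      destruct (Req_dec (Im (g u0)) 0) as [h|h].
      - destruct (Req_dec (Re (g u0) - lam u0) 0) as [h'|h'].
        + exfalso. apply N. apply C_ext; simpl; lra.
        + pose proof (pow2_gt_0 _ h'). pose proof (pow2_ge_0 (Im (g u0))). lra.
      - pose proof (pow2_gt_0 _ h). pose proof (pow2_ge_0 (Re (g u0) - lam u0)). lra. }
    destruct (gronwall (fun u => Im (f u) ^ 2) (fun u => - 4 * Im (f u) ^ 2 / q u) (4 / q u0) 0 t)
      as [_ G]; [lra| | |].
    - intros u Hu. destruct (Df u ltac:(lra)) as [_ D]. rewrite Im_vel in D.
      evar_last. apply (is_derive_pow _ 2 u _ D). fold (q u). generalize (q u). intros r. unfold Rdiv. simpl. ring.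
    - intros u Hu. pose proof (Hmin u Hu). pose proof (pow2_ge_0 (Im (f u))).
      replace (-4 * Im (f u) ^ 2 / q u) with (- (4 * Im (f u) ^ 2 / q u)) by (unfold Rdiv; ring).
      rewrite Rabs_Ropp, Rabs_pos_eq by (apply Rdiv_le_0_compat; lra).
      unfold Rdiv. replace (4 * / q u0 * Im (f u) ^ 2) with (4 * Im (f u) ^ 2 * / q u0) by ring.
      apply Rmult_le_compat_l; [lra|]. now apply Rinv_le_contravar.
    - assert (0 < Im (f 0) ^ 2) by (rewrite Ef, H0 by lra; nra).
      pose proof (exp_pos (4 / q u0 * (t - 0))). nra. }
  intros t Ht. split; [now apply Df|].
  apply Rnot_le_lt. intros Hle.
  pose proof (HY t Ht) as Ht2.
  assert (Hf0 : 0 < Im (f 0)) by (rewrite Ef, H0; lra).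
  assert (Ht0 : 0 < t).
  { destruct (Req_dec t 0) as [h|h]; [subst; lra|lra]. }
  destruct (IVT_interv (fun u => - Im (f u)) 0 t) as [u [Hu Eu]]; try lra.
  - intros u Hu. apply continuity_pt_filterlim.
    exact (continuous_of_derive _ _ _ (derive_opp _ _ _ (proj2 (Df u ltac:(lra))))).
  - nra.
  - pose proof (HY u ltac:(lra)). replace (Im (f u)) with 0 in H by lra. lra.
Qed.

Lemma chord_of_hull lam t z :
  (forall u, continuous lam u) -> loewner_hull lam t z ->
  exists g T, 0 < T <= t /\ chord lam g T 0 /\ g 0 = z.
Proof.
  intros Hc [Hz [T [g [HT [Hg Hlim]]]]].
  destruct (solves_extension lam z T g Hc (proj1 HT) Hz Hg) as [f [Ef Hf]].
  exists f, T. split; [exact HT|]. split.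
  - split; [exact Hf|]. split; [lra|]. rewrite left_limit_eps in Hlim.
    split; apply left_limit_eps; intros e He; destruct (Hlim e He) as [d [Hd Hu]];
      exists (Rmin d T); (split; [apply Rmin_glb_lt; lra|]); intros u Hu';
      pose proof (Rmin_l d T); pose proof (Rmin_r d T); specialize (Hu u ltac:(lra));
      rewrite Rminus_0_r, Rabs_pos_eq in Hu by apply Cmod_ge_0;
      rewrite Ef by lra; (eapply Rle_lt_trans; [|exact Hu]).
    + replace (Re (g u) - lam u - 0) with (Re (g u - RtoC (lam u))%C)
        by (unfold Re; simpl; ring). apply Re_le_Cmod.
    + replace (Im (g u) - 0) with (Im (g u - RtoC (lam u))%C)
        by (unfold Im; simpl; ring). apply Im_le_Cmod.
  - rewrite Ef by lra. now destruct Hg.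
Qed.

Lemma hull_of_chord lam g T t :
  0 < T <= t -> chord lam g T 0 -> loewner_hull lam t (g 0).
Proof.
  intros HT [Hs [_ [HX HY]]]. split; [apply Hs; lra|].
  exists T, g. split; [exact HT|]. split; [now apply loewner_solution_of_solves|].
  rewrite left_limit_eps in *. intros e He.
  destruct (HX (e / 2) ltac:(lra)) as [d1 [Hd1 K1]].
  destruct (HY (e / 2) ltac:(lra)) as [d2 [Hd2 K2]].
  exists (Rmin d1 d2). split; [now apply Rmin_glb_lt|].
  intros u Hu. pose proof (Rmin_l d1 d2). pose proof (Rmin_r d1 d2).
  specialize (K1 u ltac:(lra)). specialize (K2 u ltac:(lra)).
  rewrite Rminus_0_r in *. rewrite Rabs_pos_eq by apply Cmod_ge_0.
  eapply Rle_lt_trans; [apply Cmod_le_abs|].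
  replace (Re (g u - RtoC (lam u))%C) with (Re (g u) - lam u) by (unfold Re; simpl; ring).
  replace (Im (g u - RtoC (lam u))%C) with (Im (g u)) by (unfold Im; simpl; ring). lra.
Qed.

(** * Forward solutions: survival or absorption *)

Section Dichotomy.
Variable lam : R -> R.
Hypothesis lam_cont : forall t, continuous lam t.

Lemma continuous_gap_sq g t : solves lam g t -> continuous (fun u => sqmod (g u - RtoC (lam u))%C) t.
Proof.
  intros [[D1 D2] _]. apply continuous_of_derive in D1. apply continuous_of_derive in D2.
  apply (continuous_ext (fun u => (Re (g u) - lam u) * (Re (g u) - lam u) + Im (g u) * Im (g u))).
  - intros u. rewrite sqmod_gap. simpl. ring.
  - assert (CX : continuous (fun u => Re (g u) - lam u) t)
      by (apply (continuous_minus (fun u => Re (g u)) lam); [exact D1|apply lam_cont]).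
    apply (continuous_plus (fun u => (Re (g u) - lam u) * (Re (g u) - lam u))
                           (fun u => Im (g u) * Im (g u))).
    + now apply (continuous_mult (fun u => Re (g u) - lam u) (fun u => Re (g u) - lam u)).
    + now apply (continuous_mult (fun u => Im (g u)) (fun u => Im (g u))).
Qed.

Lemma height_lower g u v r :
  0 < r -> u <= v -> (forall w, u <= w <= v -> solves lam g w) ->
  (forall w, u <= w <= v -> r <= sqmod (g w - RtoC (lam w))%C) ->
  Im (g u) ^ 2 <= Im (g v) ^ 2 * exp (4 / r * (v - u)).
Proof.
  intros Hr Huv Hs Hq.
  apply (gronwall (fun w => Im (g w) ^ 2)
    (fun w => - 4 * Im (g w) ^ 2 / ((Re (g w) - lam w) ^ 2 + Im (g w) ^ 2)) (4 / r) u v Huv).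
  - intros w Hw. apply derive_height_sq. now apply Hs.
  - intros w Hw. specialize (Hq w Hw). rewrite sqmod_gap in Hq.
    pose proof (pow2_ge_0 (Im (g w))).
    set (q := (Re (g w) - lam w) ^ 2 + Im (g w) ^ 2) in *.
    replace (-4 * Im (g w) ^ 2 / q) with (- (4 * Im (g w) ^ 2 * / q)) by (unfold Rdiv; ring).
    rewrite Rabs_Ropp, Rabs_pos_eq.
    + replace (4 / r * Im (g w) ^ 2) with (4 * Im (g w) ^ 2 * / r) by (unfold Rdiv; ring).
      apply Rmult_le_compat_l; [lra|]. now apply Rinv_le_contravar.
    + apply Rmult_le_pos; [lra|]. left. apply Rinv_0_lt_compat. lra.
Qed.

(** At a time close to the end the solution can no longer move far from a
    position away from the driving point, and there the height decays at a
    bounded rate. *)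
Lemma collapse g T :
  0 < T -> (forall t, 0 <= t < T -> solves lam g t) ->
  (forall y, 0 < y -> exists t, 0 <= t < T /\ Im (g t) < y) ->
  forall r, 0 < r -> exists d, 0 < d /\ forall u, T - d < u < T -> 0 <= u ->
    sqmod (g u - RtoC (lam u))%C < r ^ 2.
Proof.
  intros HT Hg Hlow r Hr.
  destruct (continuous_eps lam T (lam_cont T) (r / 32) ltac:(lra)) as [d [Hd Hlam]].
  exists (Rmin d (r ^ 2 / 64)). split; [apply Rmin_glb_lt; nra|].
  intros u Hu Hu0. pose proof (Rmin_l d (r ^ 2 / 64)). pose proof (Rmin_r d (r ^ 2 / 64)).
  apply Rnot_le_lt. intros Hbig.
  assert (Hstay : forall v, u <= v < T -> (r / 2) ^ 2 < sqmod (g v - RtoC (lam v))%C).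
  { apply barrier.
    - intros v Hv. apply continuous_gap_sq. apply Hg. lra.
    - nra.
    - intros v Hv Hq.
      assert (Hvel : forall w, u <= w <= v -> Cmod (vel (g w) (lam w)) <= 4 / r).
      { intros w Hw. specialize (Hq w Hw). rewrite <- Cmod_sqmod in Hq.
        assert (Hc : r / 2 <= Cmod (g w - RtoC (lam w))%C).
        { pose proof (Cmod_ge_0 (g w - RtoC (lam w))%C). nra. }
        unfold vel. rewrite Cmod_div, Cmod_R, (Rabs_pos_eq 2) by
          (lra || (apply (gap_neq0 lam); apply Hg; lra)).
        replace (4 / r) with (2 / (r / 2)) by (field; lra).
        unfold Rdiv. apply Rmult_le_compat_l; [lra|]. apply Rinv_le_contravar; lra. }
      assert (H4 : 4 / r * (v - u) <= r / 16).
      { apply Rle_trans with (4 / r * (r ^ 2 / 64)).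
        - apply Rmult_le_compat_l; [left; apply Rdiv_lt_0_compat; lra|lra].
        - right. field. lra. }
      assert (M1 : Rabs (Re (g v) - Re (g u)) <= 4 / r * (v - u)).
      { apply (displacement_le (fun w => Re (g w)) (fun w => Re (vel (g w) (lam w)))); [lra| |].
        - intros w Hw. apply Hg. lra.
        - intros w Hw. eapply Rle_trans; [apply Re_le_Cmod|]. now apply Hvel. }
      assert (M2 : Rabs (Im (g v) - Im (g u)) <= 4 / r * (v - u)).
      { apply (displacement_le (fun w => Im (g w)) (fun w => Im (vel (g w) (lam w)))); [lra| |].
        - intros w Hw. apply Hg. lra.
        - intros w Hw. eapply Rle_trans; [apply Im_le_Cmod|]. now apply Hvel. }
      pose proof (Hlam v ltac:(rewrite Rabs_left; lra)) as L1.
      pose proof (Hlam u ltac:(rewrite Rabs_left; lra)) as L2.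
      apply Rabs_lt_between in L1. apply Rabs_lt_between in L2.
      rewrite <- !Cmod_sqmod in *.
      assert (Hcu : r <= Cmod (g u - RtoC (lam u))%C).
      { pose proof (Cmod_ge_0 (g u - RtoC (lam u))%C). nra. }
      pose proof (Cmod_dist_triangle (g u) (g v) (RtoC (lam u))) as T1.
      assert (T2 : Cmod (g v - RtoC (lam u))%C <= Cmod (g v - RtoC (lam v))%C + r / 16).
      { pose proof (Cmod_dist_triangle (g v) (RtoC (lam v)) (RtoC (lam u))) as T2.
        rewrite <- RtoC_minus, Cmod_R in T2.
        assert (Rabs (lam v - lam u) <= r / 16) by (apply Rabs_le_between; lra). lra. }
      assert (T3 : Cmod (g u - g v)%C <= r / 8).
      { rewrite Cmod_sym. eapply Rle_trans; [apply Cmod_le_abs|].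
        change (Rabs (Re (g v) - Re (g u)) + Rabs (Im (g v) - Im (g u)) <= r / 8). lra. }
      assert (r / 2 < Cmod (g v - RtoC (lam v))%C) by lra. nra. }
  set (K := exp (4 / (r / 2) ^ 2 * T)).
  assert (HK : 0 < K) by apply exp_pos.
  assert (HY : 0 < Im (g u)) by (apply Hg; lra).
  assert (HYK : 0 < Im (g u) / K) by (apply Rdiv_lt_0_compat; lra).
  assert (HK1 : 1 <= K).
  { unfold K. rewrite <- exp_0. apply exp_monotone. apply Rmult_le_pos; [|lra].
    left. apply Rdiv_lt_0_compat; nra. }
  destruct (Hlow _ HYK) as [t [Ht Hyt]].
  assert (HYle : Im (g u) / K <= Im (g u)).
  { apply Rmult_le_reg_r with K; [lra|].
    replace (Im (g u) / K * K) with (Im (g u)) by (field; lra). nra. }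
  destruct (Rlt_or_le t u) as [h|h].
  - pose proof (Im_decreasing lam g t u ltac:(lra) ltac:(intros; apply Hg; lra)). lra.
  - pose proof (height_lower g u t ((r / 2) ^ 2) ltac:(nra) h
      ltac:(intros; apply Hg; lra) ltac:(intros; left; apply Hstay; lra)) as Hh.
    assert (exp (4 / (r / 2) ^ 2 * (t - u)) <= K).
    { apply exp_monotone. apply Rmult_le_compat_l; [left; apply Rdiv_lt_0_compat; nra|lra]. }
    assert (HYt : 0 < Im (g t)) by (apply Hg; lra).
    assert (Im (g t) * K < Im (g u)).
    { apply Rlt_le_trans with (Im (g u) / K * K); [apply Rmult_lt_compat_r; lra|].
      right; field; lra. }
    assert (Im (g u) ^ 2 <= Im (g t) ^ 2 * K).
    { eapply Rle_trans; [exact Hh|]. apply Rmult_le_compat_l; [apply pow2_ge_0|lra]. }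
    assert (Im (g t) ^ 2 * K <= (Im (g t) * K) ^ 2) by nra.
    nra.
Qed.

Lemma lifted_unique y0 g G tau :
  0 < y0 -> 0 <= tau ->
  (forall t, 0 <= t <= tau -> cderiv g t (vel (lift y0 (g t)) (lam t))) ->
  (forall t, 0 <= t <= tau -> cderiv G t (vel (lift y0 (G t)) (lam t))) ->
  g 0 = G 0 -> g tau = G tau.
Proof.
  intros Hy Htau Hg HG H0.
  set (L := 4 / y0 ^ 2).
  assert (HL : 0 < L) by (unfold L; apply Rdiv_lt_0_compat; nra).
  destruct (gronwall (fun t => sqmod (g t - G t)%C)
    (fun t => 2 * (Re (g t - G t)%C * Re (vel (lift y0 (g t)) (lam t) - vel (lift y0 (G t)) (lam t))%C +
                   Im (g t - G t)%C * Im (vel (lift y0 (g t)) (lam t) - vel (lift y0 (G t)) (lam t))%C))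
    (4 * L) 0 tau Htau) as [Hb _].
  - intros t Ht. apply (derive_sqmod (fun t => g t - G t)%C).
    apply cderiv_minus; auto.
  - intros t Ht.
    set (D := (g t - G t)%C). set (V := (vel (lift y0 (g t)) (lam t) - vel (lift y0 (G t)) (lam t))%C).
    assert (HV : Cmod V <= L * Cmod D).
    { unfold V. eapply Rle_trans; [apply (vel_lipschitz _ _ _ _ y0); auto using lift_im|].
      rewrite Rminus_diag, Rabs_R0, Rplus_0_r.
      assert (Cmod (lift y0 (g t) - lift y0 (G t))%C <= 2 * Cmod D).
      { eapply Rle_trans; [apply lift_lipschitz|].
        pose proof (Re_le_Cmod D). pose proof (Im_le_Cmod D).
        change (Rabs (Re D) + Rabs (Im D) <= 2 * Cmod D). lra. }
      unfold L. apply Rle_trans with (2 / y0 ^ 2 * (2 * Cmod D)).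
      - apply Rmult_le_compat_l; [left; apply Rdiv_lt_0_compat; nra|lra].
      - right. field. lra. }
    rewrite <- Cmod_sqmod.
    pose proof (Re_le_Cmod D). pose proof (Im_le_Cmod D).
    pose proof (Re_le_Cmod V). pose proof (Im_le_Cmod V).
    pose proof (Rabs_pos (Re D)). pose proof (Rabs_pos (Im D)).
    pose proof (Rabs_pos (Re V)). pose proof (Rabs_pos (Im V)).
    rewrite Rabs_mult, (Rabs_pos_eq 2) by lra.
    apply Rle_trans with (2 * (Rabs (Re D) * Rabs (Re V) + Rabs (Im D) * Rabs (Im V))).
    + apply Rmult_le_compat_l; [lra|]. eapply Rle_trans; [apply Rabs_triang|].
      rewrite !Rabs_mult. lra.
    + assert (Rabs (Re D) * Rabs (Re V) <= Cmod D * Cmod V) by (apply Rmult_le_compat; lra).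
      assert (Rabs (Im D) * Rabs (Im V) <= Cmod D * Cmod V) by (apply Rmult_le_compat; lra).
      pose proof (Cmod_ge_0 D). nra.
  - rewrite H0 in Hb. replace (G 0 - G 0)%C with (RtoC 0) in Hb by ring.
    replace (sqmod (RtoC 0)) with 0 in Hb by (unfold sqmod, Re, Im; simpl; ring).
    rewrite Rmult_0_l in Hb. apply sqmod_zero in Hb.
    replace (g tau) with (g tau - G tau + G tau)%C by ring. rewrite Hb. ring.
Qed.

(** At the supremum of the survival times either the heights have a positive
    lower bound, and the lifted flow continues the solution, or they have not,
    and [collapse] shows absorption. *)
Lemma survives_or_absorbed z t :
  0 <= t -> 0 < Im z ->
  (exists g, g 0 = z /\ forall s, 0 <= s <= t -> solves lam g s) \/ loewner_hull lam t z.
Proof.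
  intros Ht Hz.
  set (E tau := 0 <= tau <= t /\ exists g, g 0 = z /\ forall s, 0 <= s <= tau -> solves lam g s).
  destruct (completeness E) as [T [Hub Hleast]].
  { exists t. intros x [Hx _]; lra. }
  { exists 0. split; [lra|]. destruct (backward_flow lam lam_cont 0 z Hz) as [g [H0 Hg]].
    exists g. split; [exact H0|]. intros s Hs. apply Hg. lra. }
  assert (HT0 : 0 <= T <= t).
  { split; [|apply Hleast; intros x [Hx _]; lra].
    apply Hub. split; [lra|]. destruct (backward_flow lam lam_cont 0 z Hz) as [g [H0 Hg]].
    exists g. split; [exact H0|]. intros s Hs. apply Hg. lra. }
  assert (Hdown : forall s, 0 <= s < T -> exists g, g 0 = z /\
    forall u, 0 <= u <= s -> solves lam g u).
  { intros s Hs. apply NNPP. intros Hn. assert (T <= s); [|lra].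
    apply Hleast. intros x [Hx [g [H0 Hg]]]. apply Rnot_lt_le. intros Hlt.
    apply Hn. exists g. split; [exact H0|]. intros u Hu. apply Hg. lra. }
  destruct (classic (exists y0, 0 < y0 /\ forall s g, 0 <= s < T \/ s = 0 -> g 0 = z ->
    (forall u, 0 <= u <= s -> solves lam g u) -> 2 * y0 <= Im (g s))) as [[y0 [Hy0 Hhigh]]|Hlow].
  - left. destruct (lifted_flow lam lam_cont y0 0 z Hy0) as [G [HG0 HG]].
    assert (HGhigh : forall s, 0 <= s < T \/ s = 0 -> 2 * y0 <= Im (G s)).
    { intros s Hs.
      assert (Hex : exists g, g 0 = z /\ forall u, 0 <= u <= s -> solves lam g u).
      { destruct Hs as [Hs|Hs]; [now apply Hdown|]. subst s.
        destruct (backward_flow lam lam_cont 0 z Hz) as [g [H0 Hg]].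
        exists g. split; [exact H0|]. intros u Hu. apply Hg. lra. }
      destruct Hex as [g [H0 Hg]].
      rewrite <- (lifted_unique y0 g G s Hy0).
      - now apply Hhigh.
      - lra.
      - intros u Hu. rewrite lift_id; [apply Hg; auto|].
        assert (2 * y0 <= Im (g s)) by now apply Hhigh.
        pose proof (Im_decreasing lam g u s ltac:(lra) ltac:(intros; apply Hg; lra)). lra.
      - intros u _. apply HG.
      - now rewrite H0, HG0. }
    assert (CG : forall s, continuous (fun s => Im (G s)) s).
    { intros s. eapply continuous_of_derive. apply HG. }
    assert (HGT : 2 * y0 <= Im (G T)).
    { destruct (Req_dec T 0) as [h|h]; [apply HGhigh; now right|].
      apply (left_limit_le (fun s => Im (G s)) 0 T); [lra| |].
      - apply (left_limit_continuous (fun s => Im (G s))). apply CG.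
      - intros u Hu. apply HGhigh. left. lra. }
    destruct (continuous_eps _ _ (CG T) y0 Hy0) as [d [Hd Hd']].
    set (T' := Rmin t (T + d / 2)).
    assert (HT' : 0 <= T' <= t /\ T <= T').
    { unfold T'. split; [split; [apply Rmin_glb; lra|apply Rmin_l]|apply Rmin_glb; lra]. }
    assert (HGs : forall s, 0 <= s <= T' -> solves lam G s).
    { intros s Hs. assert (Hy : y0 < Im (G s)).
      { destruct (Rlt_or_le s T) as [h|h]; [pose proof (HGhigh s ltac:(left; lra)); lra|].
        assert (T' <= T + d / 2) by apply Rmin_r.
        specialize (Hd' s). rewrite Rabs_pos_eq in Hd' by lra. specialize (Hd' ltac:(lra)).
        apply Rabs_lt_between in Hd'. lra. }
      split; [|lra]. specialize (HG s). now rewrite lift_id in HG by lra. }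
    assert (T' <= T).
    { apply Hub. split; [lra|]. now exists G. }
    assert (T' = t).
    { unfold T', Rmin in *. destruct Rle_dec; lra. }
    exists G. split; [exact HG0|]. intros s Hs. apply HGs. lra.
  - right.
    assert (Hlow' : forall y, 0 < y -> exists s g, (0 <= s < T \/ s = 0) /\ g 0 = z /\
      (forall u, 0 <= u <= s -> solves lam g u) /\ Im (g s) < y).
    { intros y Hy. apply NNPP. intros Hn. apply Hlow. exists (y / 2). split; [lra|].
      intros s g Hs H0 Hg. apply Rnot_lt_le. intros Hlt. apply Hn. exists s, g.
      split; [exact Hs|]. split; [exact H0|]. split; [exact Hg|lra]. }
    assert (HT : 0 < T).
    { destruct (Hlow' (Im z) Hz) as [s [g [Hs [H0 [Hg Hlt]]]]].
      destruct Hs as [Hs|Hs]; [lra|]. subst s. rewrite H0 in Hlt. lra. }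
    assert (Hch : forall s, exists g, 0 <= s < T -> g 0 = z /\
      forall u, 0 <= u <= (s + T) / 2 -> solves lam g u).
    { intros s. destruct (classic (0 <= s < T)) as [Hs|Hs]; [|exists (fun _ => z); tauto].
      destruct (Hdown ((s + T) / 2) ltac:(lra)) as [g Hg]. now exists g. }
    set (p s := proj1_sig (constructive_indefinite_description _ (Hch s))).
    assert (Hp : forall s, 0 <= s < T -> p s 0 = z /\
      forall u, 0 <= u <= (s + T) / 2 -> solves lam (p s) u).
    { intros s. unfold p. now destruct constructive_indefinite_description. }
    clearbody p.
    set (g s := p s s).
    assert (Hgp : forall s u, 0 <= s < T -> 0 <= u < (s + T) / 2 -> g u = p s u).
    { intros s u Hs Hu. unfold g. destruct (Hp s Hs) as [A1 A2].
      destruct (Hp u ltac:(lra)) as [B1 B2].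
      apply (solution_unique lam (p u) (p s) 0 u 0); try lra.
      - intros v Hv. apply B2. lra.
      - intros v Hv. apply A2. lra.
      - now rewrite A1, B1. }
    assert (Hsol : loewner_solution lam z T g).
    { split; [apply Hp; lra|]. intros s Hs.
      destruct (Hp s Hs) as [_ HS]. destruct (HS s ltac:(lra)) as [D HY].
      assert (Egs : g s = p s s) by reflexivity.
      split.
      - intros Eq. rewrite Egs in Eq. rewrite Eq in HY. simpl in HY. lra.
      - apply filterdiff_within_eps; [exact Hs|]. rewrite cderiv_eps in D.
        intros e He. destruct (D e He) as [de [Hde Hd']].
        exists (Rmin de ((T - s) / 2)). split; [apply Rmin_glb_lt; lra|].
        intros u Hu Hus. pose proof (Rmin_l de ((T - s) / 2)).
        pose proof (Rmin_r de ((T - s) / 2)).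
        rewrite (Hgp s u), (Hgp s s) by
          (try lra; split; try lra; apply Rabs_lt_between in Hus; lra).
        apply Hd'. lra. }
    destruct (solves_extension lam z T g lam_cont HT Hz Hsol) as [f [Ef Hf]].
    split; [exact Hz|]. exists T, g. split; [lra|]. split; [exact Hsol|].
    apply left_limit_eps. intros r Hr.
    destruct (collapse f T HT Hf) with (r := r) as [d [Hd Hcol]]; [|exact Hr|].
    + intros y Hy. destruct (Hlow' (Rmin y (Im z))) as [s [h [Hs [H0 [Hh Hlt]]]]].
      { now apply Rmin_glb_lt. }
      pose proof (Rmin_l y (Im z)). pose proof (Rmin_r y (Im z)).
      destruct Hs as [Hs|Hs]; [|subst s; rewrite H0 in Hlt; lra].
      exists s. split; [exact Hs|].
      rewrite (solution_unique lam f h 0 s 0); try lra.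
      * intros u Hu. apply Hf. lra.
      * exact Hh.
      * rewrite Ef, H0 by lra. apply Hsol.
    + exists (Rmin d T). split; [apply Rmin_glb_lt; lra|]. intros u Hu.
      pose proof (Rmin_l d T). pose proof (Rmin_r d T).
      specialize (Hcol u ltac:(lra) ltac:(lra)).
      rewrite Rminus_0_r, Rabs_pos_eq by apply Cmod_ge_0.
      rewrite <- Ef by lra. rewrite <- Cmod_sqmod in Hcol.
      pose proof (Cmod_ge_0 (f u - RtoC (lam u))%C). nra.
Qed.
End Dichotomy.

(** * Solutions that run into the driving point *)

Record regular_driver (lam : R -> R) (c0 eta M : R) : Prop := {
  rd_C : 0 < c0 < 4;
  rd_eta : 0 < eta;
  rd_cont : forall t, continuous lam t;
  rd_lip : forall u v, Rabs (u - v) < eta ->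
    Rabs (lam u - lam v) <= c0 * sqrt (Rabs (u - v));
  rd_bound : forall t, Rabs (lam t) <= M }.

Section Driver.
Variables (lam : R -> R) (c0 eta M : R).
Hypothesis driver : regular_driver lam c0 eta M.

(** In the cone, [coneb] bounds [(Re Z)^2 / |Z|^2] and [conec] is the least
    rate of decrease of the squared height. *)
Definition coneA : R := cone_const c0 eta M.
Definition coneb : R := coneA / (1 + coneA).
Definition conec : R := 4 / (1 + coneA).

Lemma coneA_pos : 0 < coneA.
Proof.
  destruct driver as [HC He _ _ _]. unfold coneA, cone_const.
  pose proof (excursion_const_pos c0 (proj2 HC)).
  apply Rplus_lt_le_0_compat.
  - apply Rdiv_lt_0_compat; lra.
  - apply Rdiv_le_0_compat; [pose proof (pow2_ge_0 M); lra|]. now apply Rmult_lt_0_compat.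
Qed.

Lemma coneb_range : 0 < coneb < 1.
Proof.
  pose proof coneA_pos. unfold coneb. split.
  - apply Rdiv_lt_0_compat; lra.
  - apply Rmult_lt_reg_r with (1 + coneA); [lra|].
    replace (coneA / (1 + coneA) * (1 + coneA)) with coneA by (field; lra). lra.
Qed.

Lemma conec_range : 0 < conec <= 4.
Proof.
  pose proof coneA_pos. unfold conec. split.
  - apply Rdiv_lt_0_compat; lra.
  - apply Rmult_le_reg_r with (1 + coneA); [lra|].
    replace (4 / (1 + coneA) * (1 + coneA)) with 4 by (field; lra). lra.
Qed.

Definition in_cone (g : R -> C) (t : R) : Prop :=
  (Re (g t) - lam t) ^ 2 <= coneA * Im (g t) ^ 2.

(** [cone_half] applies to the gap or, after reflection in the imaginary axis,
    to its negative. *)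
Lemma chord_cone g T e t : chord lam g T e -> 0 <= t < T -> in_cone g t.
Proof.
  intros [Hg [_ [Hlim _]]] Ht. unfold in_cone.
  destruct driver as [HC He Hcont Hlip Hb].
  destruct (Rtotal_order (Re (g t) - lam t) 0) as [Hn|[Hz|Hp]].
  - pose proof (cone_half (fun u => - Re (g u)) (fun u => Im (g u)) (fun u => - lam u)
      c0 eta M T t HC He) as H.
    unfold coneA. replace (Re (g t) - lam t) with (- (- Re (g t) - - lam t)) by ring.
    rewrite <- Rsqr_pow2, <- Rsqr_neg, Rsqr_pow2.
    apply H; try lra.
    + intros u. apply (continuous_opp lam). apply Hcont.
    + intros u v Huv. replace (- lam u - - lam v) with (- (lam u - lam v)) by ring.
      rewrite Rabs_Ropp. now apply Hlip.
    + intros u. rewrite Rabs_Ropp. apply Hb.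
    + intros u Hu. destruct (solves_components lam g u (Hg u ltac:(lra))) as [D1 [D2 D3]].
      replace (- Re (g u) - - lam u) with (- (Re (g u) - lam u)) by ring.
      replace ((- (Re (g u) - lam u)) ^ 2) with ((Re (g u) - lam u) ^ 2) by ring.
      split; [|split; assumption].
      evar_last. exact (derive_opp _ _ _ D1). unfold Rdiv; ring.
    + replace 0 with (-1 * 0) by ring.
      eapply filterlim_ext; [|exact (left_limit_mult _ _ _ _ _ (left_limit_const (-1) T) Hlim)].
      intros u; simpl; ring.
  - rewrite Hz. pose proof coneA_pos. pose proof (pow2_ge_0 (Im (g t))). nra.
  - apply (cone_half (fun u => Re (g u)) (fun u => Im (g u)) lam c0 eta M T t HC He); auto; try lra.
    intros u Hu. apply solves_components. apply Hg. lra.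
Qed.

Lemma height_step g a b :
  a <= b -> (forall t, a <= t <= b -> solves lam g t) ->
  (forall t, a <= t <= b -> in_cone g t) ->
  Im (g b) ^ 2 + conec * (b - a) <= Im (g a) ^ 2 <= Im (g b) ^ 2 + 4 * (b - a).
Proof.
  intros Hab Hs Hc. pose proof coneA_pos as HA.
  assert (L : forall k t, is_derive (fun t => k * t) t k).
  { intros k t. auto_derive; [trivial|ring]. }
  split.
  - enough (Im (g b) ^ 2 + conec * b <= Im (g a) ^ 2 + conec * a) by lra.
    apply (nonincreasing_of_derive (fun t => Im (g t) ^ 2 + conec * t)
     (fun t => - 4 * Im (g t) ^ 2 / ((Re (g t) - lam t) ^ 2 + Im (g t) ^ 2) + conec) a b Hab).
    + intros t Ht. exact (derive_plus _ _ _ _ _ (derive_height_sq lam g t (Hs t Ht)) (L conec t)).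
    + intros t Ht. specialize (Hc t Ht). unfold in_cone in Hc.
      destruct (Hs t Ht) as [_ HY].
      pose proof (sumsq_pos (Re (g t) - lam t) (Im (g t)) HY) as Hq.
      apply Rmult_le_reg_r with ((Re (g t) - lam t) ^ 2 + Im (g t) ^ 2); [exact Hq|].
      unfold conec. rewrite Rmult_0_l.
      replace ((-4 * Im (g t) ^ 2 / ((Re (g t) - lam t) ^ 2 + Im (g t) ^ 2) + 4 / (1 + coneA)) *
         ((Re (g t) - lam t) ^ 2 + Im (g t) ^ 2))
        with (4 * (/ (1 + coneA)) * ((Re (g t) - lam t) ^ 2 - coneA * Im (g t) ^ 2))
        by (field; lra).
      assert (0 < / (1 + coneA)) by (apply Rinv_0_lt_compat; lra). nra.
  - enough (Im (g a) ^ 2 + 4 * a <= Im (g b) ^ 2 + 4 * b) by lra.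
    apply (nondecreasing_of_derive (fun t => Im (g t) ^ 2 + 4 * t)
     (fun t => - 4 * Im (g t) ^ 2 / ((Re (g t) - lam t) ^ 2 + Im (g t) ^ 2) + 4) a b Hab).
    + intros t Ht. exact (derive_plus _ _ _ _ _ (derive_height_sq lam g t (Hs t Ht)) (L 4 t)).
    + intros t Ht. destruct (Hs t Ht) as [_ HY].
      pose proof (sumsq_pos (Re (g t) - lam t) (Im (g t)) HY) as Hq.
      replace (-4 * Im (g t) ^ 2 / ((Re (g t) - lam t) ^ 2 + Im (g t) ^ 2) + 4)
        with (4 * (Re (g t) - lam t) ^ 2 / ((Re (g t) - lam t) ^ 2 + Im (g t) ^ 2))
        by (field; lra).
      apply Rdiv_le_0_compat; [|exact Hq]. pose proof (pow2_ge_0 (Re (g t) - lam t)). lra.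
Qed.

Lemma chord_height g T e t :
  chord lam g T e -> 0 <= t < T ->
  e ^ 2 + conec * (T - t) <= Im (g t) ^ 2 <= e ^ 2 + 4 * (T - t).
Proof.
  intros Hg Ht. pose proof Hg as [Hs [He [_ Hlim]]].
  assert (Hstep : forall u, t < u < T ->
    Im (g u) ^ 2 + conec * (u - t) <= Im (g t) ^ 2 <= Im (g u) ^ 2 + 4 * (u - t)).
  { intros u Hu. apply height_step; [lra| |].
    - intros v Hv. apply Hs; lra.
    - intros v Hv. apply (chord_cone g T e); [exact Hg|lra]. }
  assert (Hl : forall k, filterlim (fun u => Im (g u) ^ 2 + k * (u - t)) (at_left T)
                      (locally (e ^ 2 + k * (T - t)))).
  { intros k. apply left_limit_plus.
    - replace (e ^ 2) with (e * e) by ring.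
      eapply filterlim_ext; [|exact (left_limit_mult _ _ _ _ _ Hlim Hlim)].
      intros u; simpl; ring.
    - apply left_limit_mult; [apply left_limit_const|].
      apply (left_limit_plus (fun u => u) (fun _ => - t)).
      apply left_limit_id. apply left_limit_const. }
  split.
  - apply Ropp_le_cancel.
    apply (left_limit_le (fun u => - (Im (g u) ^ 2 + conec * (u - t))) t T); [lra| |].
    + replace (- (e ^ 2 + conec * (T - t))) with (-1 * (e ^ 2 + conec * (T - t))) by ring.
      eapply filterlim_ext; [|exact (left_limit_mult _ _ _ _ _ (left_limit_const (-1) T) (Hl conec))].
      intros u; simpl; ring.
    + intros u Hu. specialize (Hstep u Hu). lra.
  - apply (left_limit_le _ t T _ _ (proj2 Ht) (Hl 4)).
    intros u Hu. apply Hstep; auto.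
Qed.

Lemma chord_size g T e t :
  chord lam g T e -> 0 <= t < T ->
  sqmod (g t - RtoC (lam t))%C <= (1 + coneA) * (e ^ 2 + 4 * (T - t)).
Proof.
  intros Hg Ht. rewrite sqmod_gap.
  pose proof (chord_height g T e t Hg Ht). pose proof (chord_cone g T e t Hg Ht).
  unfold in_cone in *. pose proof coneA_pos. nra.
Qed.

(** For two solutions in the cone the rate at which their distance grows
    backwards in time is [2 Re (1 / (Z1 Z2))], at most [coneb < 1] times the
    logarithmic rate at which the product of their heights grows. *)
Lemma pair_monotone g1 g2 a b :
  a <= b ->
  (forall t, a <= t <= b -> solves lam g1 t /\ in_cone g1 t) ->
  (forall t, a <= t <= b -> solves lam g2 t /\ in_cone g2 t) ->
  sqmod (g1 a - g2 a)%C <=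
    sqmod (g1 b - g2 b)%C *
      exp (coneb * (ln (Im (g1 a)) + ln (Im (g2 a)) - (ln (Im (g1 b)) + ln (Im (g2 b))))).
Proof.
  intros Hab H1 H2. pose proof coneA_pos as HA. pose proof coneb_range as Hb.
  set (L t := ln (Im (g1 t)) + ln (Im (g2 t))).
  set (q1 t := (Re (g1 t) - lam t) ^ 2 + Im (g1 t) ^ 2).
  set (q2 t := (Re (g2 t) - lam t) ^ 2 + Im (g2 t) ^ 2).
  set (m t := (- RtoC 2 / ((g1 t - RtoC (lam t)) * (g2 t - RtoC (lam t))))%C).
  assert (Hmain : sqmod (g1 a - g2 a)%C * exp (- coneb * L a)
                  <= sqmod (g1 b - g2 b)%C * exp (- coneb * L b)).
  { apply (nondecreasing_of_derive (fun t => sqmod (g1 t - g2 t)%C * exp (- coneb * L t))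
      (fun t => 2 * Re (m t) * sqmod (g1 t - g2 t)%C * exp (- coneb * L t) +
        sqmod (g1 t - g2 t)%C * (exp (- coneb * L t) * (- coneb * (- 2 / q1 t + - 2 / q2 t))))
      a b Hab).
    - intros t Ht. destruct (H1 t Ht) as [S1 _]. destruct (H2 t Ht) as [S2 _].
      destruct (solves_components lam g1 t S1) as [_ [D1 Y1]].
      destruct (solves_components lam g2 t S2) as [_ [D2 Y2]].
      assert (DL : is_derive L t (- 2 / q1 t + - 2 / q2 t)).
      { evar_last. exact (derive_plus _ _ _ _ _ (derive_ln _ _ _ D1 Y1) (derive_ln _ _ _ D2 Y2)).
        pose proof (sumsq_pos (Re (g1 t) - lam t) (Im (g1 t)) Y1).
        pose proof (sumsq_pos (Re (g2 t) - lam t) (Im (g2 t)) Y2).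
        unfold q1, q2; simpl. field. lra. }
      apply (derive_mult (fun t => sqmod (g1 t - g2 t)%C) (fun t => exp (- coneb * L t))).
      + apply (derive_sqmod_mult (fun t => g1 t - g2 t)%C). now apply cderiv_difference.
      + apply (derive_comp exp (fun t => - coneb * L t)); [apply is_derive_exp|].
        evar_last. exact (derive_mult _ _ _ _ _ (is_derive_const (- coneb) t) DL).
        unfold zero; simpl. ring.
    - intros t Ht. destruct (H1 t Ht) as [[_ Y1] C1]. destruct (H2 t Ht) as [[_ Y2] C2].
      unfold in_cone in *.
      pose proof (sumsq_pos (Re (g1 t) - lam t) (Im (g1 t)) Y1) as Q1. fold (q1 t) in Q1.
      pose proof (sumsq_pos (Re (g2 t) - lam t) (Im (g2 t)) Y2) as Q2. fold (q2 t) in Q2.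
      pose proof (exp_pos (- coneb * L t)) as He.
      pose proof (sqmod_nonneg (g1 t - g2 t)%C) as Hd.
      set (X1 := Re (g1 t) - lam t) in *. set (X2 := Re (g2 t) - lam t) in *.
      assert (Em : Re (m t) = - 2 * (X1 * X2 - Im (g1 t) * Im (g2 t)) / (q1 t * q2 t)).
      { unfold m, q1, q2. fold X1 X2.
        replace (g1 t - RtoC (lam t))%C with ((X1, Im (g1 t)) : C)
          by (apply C_ext; unfold X1, Re, Im; simpl; ring).
        replace (g2 t - RtoC (lam t))%C with ((X2, Im (g2 t)) : C)
          by (apply C_ext; unfold X2, Re, Im; simpl; ring).
        unfold q1 in Q1; unfold q2 in Q2. fold X1 in Q1; fold X2 in Q2.
        unfold Re; simpl. field.
        replace (X1 * X2 - Im (g1 t) * Im (g2 t)) with (X1 * X2 - Im (g1 t) * Im (g2 t)) by ring.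
        repeat split; try lra.
        replace ((X1 * X2 - Im (g1 t) * Im (g2 t)) * (X1 * X2 - Im (g1 t) * Im (g2 t)) +
          (X1 * Im (g2 t) + Im (g1 t) * X2) * (X1 * Im (g2 t) + Im (g1 t) * X2))
        with ((X1 ^ 2 + Im (g1 t) ^ 2) * (X2 ^ 2 + Im (g2 t) ^ 2)) by ring.
        apply Rgt_not_eq. now apply Rmult_lt_0_compat. }
      assert (B1 : X1 ^ 2 <= coneb * q1 t).
      { unfold coneb, q1. fold X1. apply Rmult_le_reg_r with (1 + coneA); [lra|].
        replace (coneA / (1 + coneA) * (X1 ^ 2 + Im (g1 t) ^ 2) * (1 + coneA))
          with (coneA * (X1 ^ 2 + Im (g1 t) ^ 2)) by (field; lra). nra. }
      assert (B2 : X2 ^ 2 <= coneb * q2 t).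
      { unfold coneb, q2. fold X2. apply Rmult_le_reg_r with (1 + coneA); [lra|].
        replace (coneA / (1 + coneA) * (X2 ^ 2 + Im (g2 t) ^ 2) * (1 + coneA))
          with (coneA * (X2 ^ 2 + Im (g2 t) ^ 2)) by (field; lra). nra. }
      replace (2 * Re (m t) * sqmod (g1 t - g2 t)%C * exp (- coneb * L t) +
        sqmod (g1 t - g2 t)%C * (exp (- coneb * L t) * (- coneb * (- 2 / q1 t + - 2 / q2 t))))
      with (sqmod (g1 t - g2 t)%C * exp (- coneb * L t) *
        (2 * (Re (m t) + coneb * (/ q1 t + / q2 t)))) by (field; lra).
      apply Rmult_le_pos; [apply Rmult_le_pos; lra|].
      apply Rmult_le_pos; [lra|]. rewrite Em.
      replace (-2 * (X1 * X2 - Im (g1 t) * Im (g2 t)) / (q1 t * q2 t) + coneb * (/ q1 t + / q2 t))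
      with ((coneb * (q1 t + q2 t) - 2 * (X1 * X2) + 2 * (Im (g1 t) * Im (g2 t))) / (q1 t * q2 t))
        by (field; lra).
      apply Rdiv_le_0_compat; [|now apply Rmult_lt_0_compat].
      assert (0 < Im (g1 t) * Im (g2 t)) by now apply Rmult_lt_0_compat.
      pose proof (pow2_ge_0 (X1 - X2)). nra. }
  unfold L in *.
  set (La := ln (Im (g1 a)) + ln (Im (g2 a))) in *.
  set (Lb := ln (Im (g1 b)) + ln (Im (g2 b))) in *.
  apply Rmult_le_reg_r with (exp (- coneb * La)); [apply exp_pos|].
  eapply Rle_trans; [exact Hmain|]. right.
  rewrite Rmult_assoc, <- exp_plus. do 2 f_equal. ring.
Qed.

Definition holderK : R := 36 * (1 + coneA) * (5 / conec).

Lemma holderK_pos : 0 < holderK.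
Proof.
  pose proof coneA_pos. pose proof conec_range. unfold holderK.
  apply Rmult_lt_0_compat; [lra|]. apply Rdiv_lt_0_compat; lra.
Qed.

(** Within time [tau] of their ends both solutions are within order [sqrt tau]
    of the driving point; at earlier times [pair_monotone] controls their
    distance. *)
Lemma chord_compare g1 g2 T1 T2 e1 e2 t tau :
  chord lam g1 T1 e1 -> chord lam g2 T2 e2 ->
  0 <= t -> t < T1 -> t < T2 -> 0 < tau ->
  Rabs (T1 - T2) <= tau -> e1 ^ 2 <= tau -> e2 ^ 2 <= tau ->
  sqmod (g1 t - g2 t)%C <=
    holderK * tau * exp (coneb * ln ((Rmin T1 T2 - t + tau) / tau)).
Proof.
  intros G1 G2 Ht0 Ht1 Ht2 Htau HT He1 He2.
  pose proof coneA_pos as HA. pose proof coneb_range as Hb. pose proof conec_range as Hc.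
  set (m := Rmin T1 T2).
  assert (Hm : m <= T1 /\ m <= T2 /\ T1 <= m + tau /\ T2 <= m + tau /\ t < m).
  { apply Rabs_le_between in HT. unfold m, Rmin. destruct Rle_dec; lra. }
  clearbody m.
  assert (Hnear : forall u, 0 <= u -> m - tau <= u < m ->
    sqmod (g1 u - g2 u)%C <= 36 * (1 + coneA) * tau).
  { intros u Hu0 Hu.
    replace (g1 u - g2 u)%C with ((g1 u - RtoC (lam u)) - (g2 u - RtoC (lam u)))%C by ring.
    eapply Rle_trans; [apply sqmod_minus_le|].
    pose proof (chord_size g1 T1 e1 u G1 ltac:(lra)).
    pose proof (chord_size g2 T2 e2 u G2 ltac:(lra)). nra. }
  assert (Hexp1 : 1 <= exp (coneb * ln ((m - t + tau) / tau))).
  { rewrite <- exp_0. apply exp_monotone. apply Rmult_le_pos; [lra|].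
    rewrite <- ln_1. apply ln_le; [lra|]. apply Rmult_le_reg_r with tau; [lra|].
    replace ((m - t + tau) / tau * tau) with (m - t + tau) by (field; lra). lra. }
  assert (H5 : 1 <= 5 / conec).
  { apply Rmult_le_reg_r with conec; [lra|]. replace (5 / conec * conec) with 5 by (field; lra). lra. }
  destruct (Rle_dec (m - tau) t) as [h|h].
  - eapply Rle_trans; [apply Hnear; lra|]. unfold holderK.
    assert (0 <= 36 * (1 + coneA) * tau) by nra.
    apply Rle_trans with (36 * (1 + coneA) * tau * (1 * 1)); [lra|].
    replace (36 * (1 + coneA) * (5 / conec) * tau * exp (coneb * ln ((m - t + tau) / tau)))
      with (36 * (1 + coneA) * tau * (5 / conec * exp (coneb * ln ((m - t + tau) / tau)))) by ring.
    apply Rmult_le_compat_l; [lra|]. apply Rmult_le_compat; lra.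
  - set (t' := m - tau) in *.
    assert (Ht' : t < t' < m) by (unfold t' in *; lra).
    eapply Rle_trans.
    { apply (pair_monotone g1 g2 t t'); [lra| |].
      - intros u Hu. split; [apply G1; lra|]. apply (chord_cone g1 T1 e1); [exact G1|lra].
      - intros u Hu. split; [apply G2; lra|]. apply (chord_cone g2 T2 e2); [exact G2|lra]. }
    assert (Y1 : 0 < Im (g1 t)) by (apply G1; lra).
    assert (Y2 : 0 < Im (g2 t)) by (apply G2; lra).
    assert (Y1' : 0 < Im (g1 t')) by (apply G1; lra).
    assert (Y2' : 0 < Im (g2 t')) by (apply G2; lra).
    pose proof (chord_height g1 T1 e1 t G1 ltac:(lra)) as A1.
    pose proof (chord_height g2 T2 e2 t G2 ltac:(lra)) as A2.
    pose proof (chord_height g1 T1 e1 t' G1 ltac:(lra)) as B1.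
    pose proof (chord_height g2 T2 e2 t' G2 ltac:(lra)) as B2.
    assert (Hln : forall y a, 0 < y -> 0 < a -> y ^ 2 <= a -> 2 * ln y <= ln a).
    { intros y a Hy Ha H. replace (2 * ln y) with (ln (y ^ 2)).
      - apply ln_le; [nra|exact H].
      - replace (y ^ 2) with (y * y) by ring. rewrite ln_mult by lra. ring. }
    assert (Hln' : forall y a, 0 < y -> 0 < a -> a <= y ^ 2 -> ln a <= 2 * ln y).
    { intros y a Hy Ha H. replace (2 * ln y) with (ln (y ^ 2)).
      - apply ln_le; assumption.
      - replace (y ^ 2) with (y * y) by ring. rewrite ln_mult by lra. ring. }
    set (s := m - t + tau) in *.
    assert (Hs : 0 < s) by (unfold s; lra).
    pose proof (Hln _ (5 * s) Y1 ltac:(lra) ltac:(unfold s; lra)) as L1.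
    pose proof (Hln _ (5 * s) Y2 ltac:(lra) ltac:(unfold s; lra)) as L2.
    assert (Hct : 0 < conec * tau) by nra.
    assert (M1 : conec * tau <= conec * (T1 - t'))
      by (apply Rmult_le_compat_l; unfold t'; lra).
    assert (M2 : conec * tau <= conec * (T2 - t'))
      by (apply Rmult_le_compat_l; unfold t'; lra).
    pose proof (pow2_ge_0 e1) as P1. pose proof (pow2_ge_0 e2) as P2.
    pose proof (Hln' _ (conec * tau) Y1' Hct ltac:(lra)) as L3.
    pose proof (Hln' _ (conec * tau) Y2' Hct ltac:(lra)) as L4.
    assert (E1 : ln (5 * s) - ln (conec * tau) = ln (5 / conec) + ln (s / tau)).
    { rewrite <- ln_mult; [|apply Rdiv_lt_0_compat; lra|apply Rdiv_lt_0_compat; lra].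
      rewrite <- ln_div by lra. f_equal. field. lra. }
    assert (E2 : ln (Im (g1 t)) + ln (Im (g2 t)) - (ln (Im (g1 t')) + ln (Im (g2 t')))
                 <= ln (5 / conec) + ln (s / tau)) by lra.
    assert (E3 : 0 <= ln (5 / conec)) by (rewrite <- ln_1; apply ln_le; lra).
    assert (E4 : exp (coneb * (ln (Im (g1 t)) + ln (Im (g2 t)) - (ln (Im (g1 t')) + ln (Im (g2 t')))))
      <= 5 / conec * exp (coneb * ln (s / tau))).
    { replace (5 / conec) with (exp (ln (5 / conec))) by (apply exp_ln; lra).
      rewrite <- exp_plus. apply exp_monotone. nra. }
    unfold holderK.
    replace (36 * (1 + coneA) * (5 / conec) * tau * exp (coneb * ln (s / tau)))
      with (36 * (1 + coneA) * tau * (5 / conec * exp (coneb * ln (s / tau)))) by ring.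
    apply Rmult_le_compat; [apply sqmod_nonneg|left; apply exp_pos| |exact E4].
    apply Hnear; lra.
Qed.

Definition modulus (tau : R) : R := 2 * holderK * exp ((1 - coneb) * ln tau).

Lemma chord_compare_unif g1 g2 T1 T2 e1 e2 t tau :
  chord lam g1 T1 e1 -> chord lam g2 T2 e2 ->
  0 <= t -> t < T1 -> t < T2 -> T1 <= 1 -> 0 < tau <= 1 ->
  Rabs (T1 - T2) <= tau -> e1 ^ 2 <= tau -> e2 ^ 2 <= tau ->
  sqmod (g1 t - g2 t)%C <= modulus tau.
Proof.
  intros G1 G2 Ht0 Ht1 Ht2 HT1 Htau HT He1 He2.
  pose proof coneb_range as Hb. pose proof holderK_pos as HK.
  eapply Rle_trans;
    [exact (chord_compare g1 g2 T1 T2 e1 e2 t tau G1 G2 Ht0 Ht1 Ht2 (proj1 Htau) HT He1 He2)|].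
  unfold modulus.
  assert (Hs : 0 < Rmin T1 T2 - t + tau <= 2).
  { pose proof (Rmin_l T1 T2). assert (t < Rmin T1 T2) by now apply Rmin_glb_lt. lra. }
  set (s := Rmin T1 T2 - t + tau) in *.
  rewrite ln_div by lra.
  replace (coneb * (ln s - ln tau)) with (coneb * ln s + - coneb * ln tau) by ring.
  rewrite exp_plus.
  replace ((1 - coneb) * ln tau) with (ln tau + - coneb * ln tau) by ring.
  rewrite exp_plus, exp_ln by lra.
  assert (H2 : exp (coneb * ln s) <= 2).
  { rewrite <- (exp_ln 2) by lra. apply exp_monotone.
    assert (ln s <= ln 2) by (apply ln_le; lra).
    pose proof ln_lt_2. nra. }
  pose proof (exp_pos (- coneb * ln tau)).
  replace (holderK * tau * (exp (coneb * ln s) * exp (- coneb * ln tau)))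
    with ((holderK * tau * exp (- coneb * ln tau)) * exp (coneb * ln s)) by ring.
  replace (2 * holderK * (tau * exp (- coneb * ln tau)))
    with ((holderK * tau * exp (- coneb * ln tau)) * 2) by ring.
  apply Rmult_le_compat_l; [|exact H2].
  apply Rmult_le_pos; [apply Rmult_le_pos; lra|lra].
Qed.

Lemma modulus_small e : 0 < e -> exists tau0, 0 < tau0 <= 1 /\
  forall tau, 0 < tau <= tau0 -> modulus tau < e.
Proof.
  intros He. pose proof coneb_range as Hb. pose proof holderK_pos as HK.
  assert (H2K : 0 < 2 * holderK) by lra.
  set (a := (ln (e / (2 * holderK)) - 1) / (1 - coneb)).
  exists (Rmin 1 (exp a)). split.
  - split; [apply Rmin_glb_lt; [lra|apply exp_pos]|apply Rmin_l].
  - intros tau Htau. pose proof (Rmin_r 1 (exp a)).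
    unfold modulus. apply Rmult_lt_reg_l with (/ (2 * holderK)); [now apply Rinv_0_lt_compat|].
    rewrite <- Rmult_assoc, Rinv_l, Rmult_1_l by lra.
    replace (/ (2 * holderK) * e) with (e / (2 * holderK)) by (field; lra).
    rewrite <- (exp_ln (e / (2 * holderK))) by (now apply Rdiv_lt_0_compat).
    apply exp_increasing.
    assert (ln tau <= a).
    { rewrite <- (ln_exp a). apply ln_le; lra. }
    apply Rle_lt_trans with ((1 - coneb) * a).
    + apply Rmult_le_compat_l; lra.
    + unfold a. replace ((1 - coneb) * ((ln (e / (2 * holderK)) - 1) / (1 - coneb)))
        with (ln (e / (2 * holderK)) - 1) by (field; lra). lra.
Qed.

(** * Existence and uniqueness of the absorbed solution *)

Lemma backward_chord (T : R) (e : R) :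
  0 < e -> exists g, g T = (lam T, e) /\ (forall t, t <= T -> solves lam g t) /\ chord lam g T e.
Proof.
  intros He. destruct (backward_flow lam (rd_cont _ _ _ _ driver) T (lam T, e) He) as [g [H0 Hg]].
  exists g. split; [exact H0|]. split; [intros; now apply Hg|].
  split; [intros; apply Hg; lra|]. split; [lra|].
  destruct (Hg T (Rle_refl T)) as [[[D1 D2] _] _].
  apply continuous_of_derive in D1. apply continuous_of_derive in D2. split.
  - replace 0 with (Re (g T) - lam T) by (rewrite H0; simpl; ring).
    apply (left_limit_continuous (fun t => Re (g t) - lam t)).
    apply (continuous_minus (fun t => Re (g t)) lam); [exact D1|apply driver].
  - pose proof (left_limit_continuous (fun t => Im (g t)) T D2) as L.
    cbv beta in L. rewrite H0 in L. exact L.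
Qed.

Lemma chord_unique g1 g2 T t :
  0 < T <= 1 -> chord lam g1 T 0 -> chord lam g2 T 0 -> 0 <= t < T -> g1 t = g2 t.
Proof.
  intros HT G1 G2 Ht. apply C_eq_of_sqmod. intros e He.
  destruct (modulus_small e He) as [tau [Htau Hs]].
  left. eapply Rle_lt_trans; [|apply (Hs tau); lra].
  apply (chord_compare_unif g1 g2 T T 0 0); auto; try lra.
  rewrite Rminus_diag, Rabs_R0; lra.
Qed.

(** The chords that end at height [1 / (n + 1)] form a Cauchy sequence by
    [chord_compare_unif]; on every earlier interval the limit agrees with the
    backward flow from one of its points, hence is a solution. *)
Lemma chord_exists (T : R) : 0 < T <= 1 -> exists g, chord lam g T 0.
Proof.
  intros HT.
  set (ep n := / (INR n + 1)).
  assert (Hep : forall n, 0 < ep n).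
  { intros n. apply Rinv_0_lt_compat. pose proof (pos_INR n). lra. }
  assert (Hep0 : forall tau, 0 < tau -> exists N, forall n, (N <= n)%nat -> ep n ^ 2 <= tau).
  { intros tau Htau. destruct (archimed_cor1 (Rmin tau 1)) as [N [HN HN0]].
    { apply Rmin_glb_lt; lra. }
    exists N. intros n Hn. pose proof (Rmin_l tau 1). pose proof (Rmin_r tau 1).
    assert (ep n <= / INR N).
    { unfold ep. apply Rinv_le_contravar; [now apply lt_0_INR|]. apply le_INR in Hn. lra. }
    specialize (Hep n). nra. }
  set (gs n := proj1_sig (constructive_indefinite_description _ (backward_chord T (ep n) (Hep n)))).
  assert (Hgs : forall n, (forall t, t <= T -> solves lam (gs n) t) /\ chord lam (gs n) T (ep n)).
  { intros n. unfold gs. now destruct constructive_indefinite_description as [g [? ?]]. }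
  clearbody gs.
  assert (Hlim : forall t, exists l : C, 0 <= t < T ->
    forall e, 0 < e -> exists N, forall n, (N <= n)%nat -> sqmod (gs n t - l)%C < e).
  { intros t. destruct (classic (0 <= t < T)) as [Ht|Ht]; [|exists (RtoC 0); tauto].
    destruct (C_complete (fun n => gs n t)) as [l Hl]; [|now exists l].
    intros e He. destruct (modulus_small e He) as [tau [Htau Hs]].
    destruct (Hep0 tau ltac:(lra)) as [N HN]. exists N. intros n m Hn Hm.
    eapply Rle_lt_trans; [|apply (Hs tau); lra].
    apply (chord_compare_unif (gs n) (gs m) T T (ep n) (ep m));
      try apply Hgs; auto; try lra.
    rewrite Rminus_diag, Rabs_R0; lra. }
  set (p t := proj1_sig (constructive_indefinite_description _ (Hlim t))).
  assert (Hp : forall t, 0 <= t < T -> forall e, 0 < e -> exists N, forall n, (N <= n)%nat ->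
    sqmod (gs n t - p t)%C < e).
  { intros t. unfold p. now destruct constructive_indefinite_description. }
  clearbody p.
  pose proof (conec_range) as Hc.
  pose proof (coneA_pos) as HA.
  assert (Hpim : forall t, 0 <= t < T -> sqrt (conec * (T - t)) <= Im (p t)).
  { intros t Ht. apply Rnot_lt_le. intros Hlt.
    set (s := sqrt (conec * (T - t))) in *.
    destruct (Hp t Ht ((s - Im (p t)) ^ 2)) as [N HN]; [apply pow2_gt_0; lra|].
    specialize (HN N (Nat.le_refl N)).
    pose proof (chord_height _ _ _ t (proj2 (Hgs N)) Ht) as [Hh _].
    assert (HY : 0 < Im (gs N t)) by (apply Hgs; lra).
    assert (Hs : s <= Im (gs N t)).
    { unfold s. rewrite <- (sqrt_pow2 (Im (gs N t))) by lra. apply sqrt_le_1_alt.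
      pose proof (pow2_ge_0 (ep N)). lra. }
    unfold sqmod in HN. replace (Im (gs N t - p t)%C) with (Im (gs N t) - Im (p t)) in HN
      by (unfold Im; simpl; ring).
    pose proof (pow2_ge_0 (Re (gs N t - p t)%C)). nra. }
  assert (Hpim0 : forall t, 0 <= t < T -> 0 < Im (p t)).
  { intros t Ht. eapply Rlt_le_trans; [|now apply Hpim]. apply sqrt_lt_R0. nra. }
  assert (Hv : forall t1, 0 <= t1 < T -> exists v, v t1 = p t1 /\
    (forall t, t <= t1 -> solves lam v t) /\ forall t, 0 <= t <= t1 -> v t = p t).
  { intros t1 Ht1.
    destruct (backward_flow lam (rd_cont _ _ _ _ driver) t1 (p t1) (Hpim0 t1 Ht1)) as [v [Hv0 Hv]].
    exists v. split; [exact Hv0|]. split; [intros; now apply Hv|].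
    intros t Ht.
    set (m := sqrt (conec * (T - t1))).
    assert (Hm : 0 < m) by (apply sqrt_lt_R0; nra).
    set (K := exp (4 / m ^ 2 * (t1 - t))).
    assert (HK : 0 < K) by apply exp_pos.
    apply C_eq_of_sqmod. intros e He.
    destruct (Hp t1 Ht1 (e / (4 * K))) as [N1 HN1]; [apply Rdiv_lt_0_compat; lra|].
    destruct (Hp t ltac:(lra) (e / 4)) as [N2 HN2]; [lra|].
    set (n := (N1 + N2)%nat).
    specialize (HN1 n ltac:(unfold n; lia)). specialize (HN2 n ltac:(unfold n; lia)).
    destruct (flow_gronwall lam (gs n) v t t1 m) as [_ G]; try lra.
    + intros u Hu. apply Hgs. lra.
    + intros u Hu. apply Hv. lra.
    + assert (HY : 0 < Im (gs n t1)) by (apply Hgs; lra).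
      unfold m. rewrite <- (sqrt_pow2 (Im (gs n t1))) by lra. apply sqrt_le_1_alt.
      pose proof (chord_height _ _ _ t1 (proj2 (Hgs n)) Ht1) as [Hh _].
      pose proof (pow2_ge_0 (ep n)). lra.
    + rewrite Hv0. now apply Hpim.
    + fold K in G. rewrite Hv0 in G.
      eapply Rle_trans; [apply (sqmod_triangle _ (gs n t))|].
      rewrite (sqmod_sym (v t)).
      assert (sqmod (gs n t1 - p t1)%C * K <= e / 4).
      { apply Rle_trans with (e / (4 * K) * K); [apply Rmult_le_compat_r; lra|].
        right; field; lra. }
      lra. }
  destruct (Hv 0 ltac:(lra)) as [v0 [Hv00 [Hv0s _]]].
  set (g t := if Rlt_dec t 0 then v0 t else p t).
  assert (Hg : forall t, 0 <= t < T -> g t = p t).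
  { intros t Ht. unfold g. destruct Rlt_dec; [lra|reflexivity]. }
  assert (Hsolves : forall t, 0 <= t < T -> solves lam g t).
  { intros t Ht. destruct (Hv ((t + T) / 2) ltac:(lra)) as [v [Hv1 [Hvs Hvp]]].
    assert (Hgv : forall s, t - 1 < s < (t + T) / 2 -> v s = g s).
    { intros s Hs. unfold g. destruct Rlt_dec as [h|h].
      - apply (solution_unique lam v v0 (t - 1) 0 0); try lra.
        + intros u Hu. apply Hvs. lra.
        + intros u Hu. apply Hv0s. lra.
        + rewrite Hvp, Hv00 by lra. reflexivity.
      - apply Hvp. lra. }
    destruct (Hvs t ltac:(lra)) as [D HY]. rewrite (Hgv t) in D, HY by lra.
    split; [|exact HY].
    apply (cderiv_ext_loc v g t _ (t - 1) ((t + T) / 2)); auto. lra. }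
  exists g. split; [exact Hsolves|]. split; [lra|].
  assert (Hsz : forall t, 0 <= t < T ->
    sqmod (p t - RtoC (lam t))%C <= 2 * (1 + coneA) * (4 * (T - t)) ).
  { intros t Ht. apply le_epsilon. intros e He.
    set (K := 2 * (1 + coneA)).
    assert (HK : 0 < K) by (unfold K; lra).
    destruct (Hp t Ht (e / 4)) as [N1 HN1]; [lra|].
    destruct (Hep0 (e / (2 * K))) as [N2 HN2]; [apply Rdiv_lt_0_compat; lra|].
    set (n := (N1 + N2)%nat).
    specialize (HN1 n ltac:(unfold n; lia)). specialize (HN2 n ltac:(unfold n; lia)).
    pose proof (chord_size _ _ _ t (proj2 (Hgs n)) Ht) as Hz.
    eapply Rle_trans; [apply (sqmod_triangle _ (gs n t))|]. rewrite (sqmod_sym (p t)).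
    assert (K * ep n ^ 2 <= e / 2).
    { apply Rle_trans with (K * (e / (2 * K))); [apply Rmult_le_compat_l; lra|].
      right; field; lra. }
    unfold K in *. nra. }
  assert (Hnear : forall e, 0 < e -> exists d, 0 < d /\
    forall u, T - d < u < T -> Cmod (g u - RtoC (lam u))%C < e).
  { intros e He. set (K := 2 * (1 + coneA) * 4).
    assert (HK : 0 < K) by (unfold K; lra).
    exists (Rmin T (e ^ 2 / K)). split; [apply Rmin_glb_lt; [lra|apply Rdiv_lt_0_compat; nra]|].
    intros u Hu. pose proof (Rmin_l T (e ^ 2 / K)). pose proof (Rmin_r T (e ^ 2 / K)).
    rewrite Hg by lra. specialize (Hsz u ltac:(lra)). rewrite <- Cmod_sqmod in Hsz.
    assert (K * (T - u) < e ^ 2).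
    { apply Rlt_le_trans with (K * (e ^ 2 / K)); [apply Rmult_lt_compat_l; lra|].
      right; field; lra. }
    unfold K in *. pose proof (Cmod_ge_0 (p u - RtoC (lam u))%C). nra. }
  split; apply left_limit_eps; intros e He; destruct (Hnear e He) as [d [Hd Hu]];
    exists d; (split; [exact Hd|]); intros u Hu'; rewrite Rminus_0_r;
    (eapply Rle_lt_trans; [|exact (Hu u Hu')]).
  - replace (Re (g u) - lam u) with (Re (g u - RtoC (lam u))%C) by (unfold Re; simpl; ring).
    apply Re_le_Cmod.
  - replace (Im (g u)) with (Im (g u - RtoC (lam u))%C) by (unfold Im; simpl; ring).
    apply Im_le_Cmod.
Qed.

(** * The trace *)

Section Trace.
Variable gam : R -> C.
Hypothesis gam_0 : gam 0 = RtoC (lam 0).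
Hypothesis gam_tip : forall T, 0 < T <= 1 -> exists g, chord lam g T 0 /\ g 0 = gam T.

Let lam_cont : forall t, continuous lam t := rd_cont _ _ _ _ driver.

Lemma tip_height T : 0 < T <= 1 -> 0 < Im (gam T) <= 2.
Proof.
  intros HT. destruct (gam_tip T HT) as [g [Hg <-]].
  assert (HY : 0 < Im (g 0)) by (apply Hg; lra).
  pose proof (chord_height g T 0 0 Hg ltac:(lra)) as [_ H]. nra.
Qed.

Lemma tip_start T : 0 < T <= 1 ->
  sqmod (gam T - gam 0)%C <= (1 + coneA) * (4 * T).
Proof.
  intros HT. destruct (gam_tip T HT) as [g [Hg <-]]. rewrite gam_0.
  pose proof (chord_size g T 0 0 Hg ltac:(lra)) as H. lra.
Qed.

Lemma tip_modulus S T tau : 0 < S <= 1 -> 0 < T <= 1 -> Rabs (S - T) <= tau -> 0 < tau <= 1 ->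
  sqmod (gam S - gam T)%C <= modulus tau.
Proof.
  intros HS HT Hst Htau.
  destruct (gam_tip S HS) as [g [Hg <-]]. destruct (gam_tip T HT) as [h [Hh <-]].
  apply (chord_compare_unif g h S T 0 0); auto; lra.
Qed.

Lemma trace_continuous : continuous_on (fun t => 0 <= t <= 1) gam.
Proof.
  apply continuous_on_eps. intros s Hs e He.
  pose proof (coneA_pos) as HA.
  assert (Hsq : forall z, sqmod z < e ^ 2 -> Cmod z < e).
  { intros z Hz. rewrite <- Cmod_sqmod in Hz. pose proof (Cmod_ge_0 z). nra. }
  destruct (modulus_small (e ^ 2) ltac:(nra)) as [tau [Htau Hmod]].
  set (K := 4 * (1 + coneA)). assert (HK : 0 < K) by (unfold K; lra).
  assert (Hnear0 : forall t, 0 <= t <= 1 -> t < e ^ 2 / K -> sqmod (gam t - gam 0)%C < e ^ 2).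
  { intros t Ht Hlt. destruct (Req_dec t 0) as [->|h].
    - replace (gam 0 - gam 0)%C with (RtoC 0) by ring.
      unfold sqmod, Re, Im; simpl. nra.
    - eapply Rle_lt_trans; [apply tip_start; lra|].
      replace ((1 + coneA) * (4 * t)) with (K * t) by (unfold K; ring).
      apply Rlt_le_trans with (K * (e ^ 2 / K)); [apply Rmult_lt_compat_l; lra|].
      right; field; lra. }
  destruct (Req_dec s 0) as [->|h].
  - exists (e ^ 2 / K). split; [apply Rdiv_lt_0_compat; nra|].
    intros t Ht Hts. apply Hsq. apply Hnear0; [exact Ht|].
    rewrite Rminus_0_r, Rabs_pos_eq in Hts; lra.
  - exists (Rmin s tau). split; [apply Rmin_glb_lt; lra|].
    intros t Ht Hts. pose proof (Rmin_l s tau). pose proof (Rmin_r s tau).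
    assert (0 < t) by (apply Rabs_lt_between in Hts; lra).
    apply Hsq. eapply Rle_lt_trans; [apply (tip_modulus t s tau); lra|]. apply Hmod. lra.
Qed.

Lemma trace_hull t z : t <= 1 -> loewner_hull lam t z <-> exists T, 0 < T <= t /\ gam T = z.
Proof.
  intros Ht. split.
  - intros H. destruct (chord_of_hull lam t z lam_cont H) as [g [T [HT [Hg H0]]]].
    exists T. split; [exact HT|].
    destruct (gam_tip T ltac:(lra)) as [h [Hh <-]]. rewrite <- H0.
    apply (chord_unique h g T 0); auto; lra.
  - intros [T [HT <-]]. destruct (gam_tip T ltac:(lra)) as [g [Hg <-]].
    now apply (hull_of_chord lam g T).
Qed.

(** At time [T] the height of the chord has dropped to zero, that of a
    solution has not. *)
Lemma chord_not_solution g h T : 0 < T -> chord lam g T 0 ->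
  (forall s, 0 <= s <= T -> solves lam h s) -> g 0 <> h 0.
Proof.
  intros HT Hg Hh E.
  assert (HY : 0 < Im (h T)) by (apply Hh; lra).
  destruct Hg as [Hs [_ [_ HI]]]. rewrite left_limit_eps in HI.
  destruct (HI (Im (h T)) HY) as [d [Hd Hu]].
  set (u := Rmax 0 (T - d / 2)).
  assert (Hu' : 0 <= u < T /\ T - d / 2 <= u).
  { unfold u. split; [split|]; [apply Rmax_l|apply Rmax_lub_lt; lra|apply Rmax_r]. }
  specialize (Hu u ltac:(lra)).
  rewrite (solution_unique lam g h 0 u 0) in Hu; try lra.
  - pose proof (Im_decreasing lam h u T ltac:(lra) ltac:(intros; apply Hh; lra)).
    rewrite Rminus_0_r, Rabs_pos_eq in Hu; lra.
  - intros; apply Hs; lra.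
  - intros; apply Hh; lra.
  - exact E.
Qed.

Lemma trace_injective s t : 0 <= s <= 1 -> 0 <= t <= 1 -> gam s = gam t -> s = t.
Proof.
  assert (Hlt : forall s t, 0 <= s <= 1 -> 0 <= t <= 1 -> s < t -> gam s <> gam t).
  { intros a b Ha Hb Hab E. destruct (Req_dec a 0) as [->|h].
    - pose proof (tip_height b ltac:(lra)). rewrite <- E, gam_0 in H. simpl in H. lra.
    - destruct (gam_tip a ltac:(lra)) as [g [Hg E1]].
      destruct (gam_tip b ltac:(lra)) as [k [Hk E2]].
      apply (chord_not_solution g k a ltac:(lra) Hg).
      + intros u Hu. apply Hk. lra.
      + congruence. }
  intros Hs Ht E. destruct (Rtotal_order s t) as [h|[h|h]]; [|exact h|].
  - exfalso. now apply (Hlt s t).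
  - exfalso. now apply (Hlt t s).
Qed.

Definition survivors (t : R) (z : C) : Prop := upper_half_plane z /\ ~ loewner_hull lam t z.

(** The surviving set is the image of the half-plane under the backward flow,
    which is locally Lipschitz. *)
Lemma survivors_connected t : 0 <= t <= 1 -> connected_set (survivors t).
Proof.
  intros Ht. apply connected_of_paths. intros z w [Hz Nz] [Hw Nw].
  destruct (survives_or_absorbed lam lam_cont z t (proj1 Ht) Hz) as [[g [Hg0 Hg]]|]; [|tauto].
  destruct (survives_or_absorbed lam lam_cont w t (proj1 Ht) Hw) as [[h [Hh0 Hh]]|]; [|tauto].
  assert (Yg : 0 < Im (g t)) by (apply Hg; lra).
  assert (Yh : 0 < Im (h t)) by (apply Hh; lra).
  set (m := Rmin (Im (g t)) (Im (h t))).
  assert (Hm : 0 < m) by now apply Rmin_glb_lt.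
  assert (Hseg : forall s, 0 <= s <= 1 -> m <= Im (segment (g t) (h t) s)).
  { intros s Hs. unfold segment.
    replace (Im (g t + RtoC s * (h t - g t))%C) with ((1 - s) * Im (g t) + s * Im (h t))
      by (unfold Im; simpl; ring).
    assert (m <= Im (g t)) by apply Rmin_l. assert (m <= Im (h t)) by apply Rmin_r. nra. }
  assert (Hch : forall s, exists k, 0 <= s <= 1 -> k t = segment (g t) (h t) s /\
     forall u, u <= t -> solves lam k u).
  { intros s. destruct (classic (0 <= s <= 1)) as [Hs|Hs]; [|exists g; tauto].
    destruct (backward_flow lam lam_cont t (segment (g t) (h t) s)) as [k [Hk0 Hk]].
    - pose proof (Hseg s Hs). lra.
    - exists k. intros _. split; [exact Hk0|]. intros u Hu. now apply Hk. }
  set (k s := proj1_sig (constructive_indefinite_description _ (Hch s))).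
  assert (Hk : forall s, 0 <= s <= 1 -> k s t = segment (g t) (h t) s /\
     forall u, u <= t -> solves lam (k s) u).
  { intros s. unfold k. now destruct constructive_indefinite_description. }
  clearbody k.
  set (K := exp (4 / m ^ 2 * (t - 0))).
  exists (fun s => k s 0), (Cmod (h t - g t)%C * K).
  assert (Hend : forall s f, 0 <= s <= 1 -> (forall u, 0 <= u <= t -> solves lam f u) ->
    f t = segment (g t) (h t) s -> k s 0 = f 0).
  { intros s f Hs Hf E. destruct (Hk s Hs) as [Ek Hks].
    apply (solution_unique lam (k s) f 0 t t); try lra.
    - intros u Hu. apply Hks. lra.
    - exact Hf.
    - congruence. }
  split; [|split; [|split]].
  - rewrite (Hend 0 g); [exact Hg0|lra|exact Hg|unfold segment; ring].
  - rewrite (Hend 1 h); [exact Hh0|lra|exact Hh|unfold segment; ring].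
  - intros s Hs. destruct (Hk s Hs) as [Ek Hks]. split.
    + apply Hks. lra.
    + intros Hhull. destruct (chord_of_hull lam t _ lam_cont Hhull) as [f [T [HT [Hf Ef]]]].
      apply (chord_not_solution f (k s) T (proj1 HT) Hf); [|exact Ef].
      intros u Hu. apply Hks. lra.
  - intros s s' Hs Hs'. destruct (Hk s Hs) as [Ek Hks]. destruct (Hk s' Hs') as [Ek' Hks'].
    destruct (flow_gronwall lam (k s) (k s') 0 t m) as [_ G]; try lra.
    + intros u Hu. apply Hks. lra.
    + intros u Hu. apply Hks'. lra.
    + rewrite Ek. now apply Hseg.
    + rewrite Ek'. now apply Hseg.
    + rewrite Ek, Ek', <- !Cmod_sqmod, segment_lipschitz in G. fold K in G.
      assert (HK : 1 <= K).
      { unfold K. rewrite <- exp_0. apply exp_monotone. apply Rmult_le_pos; [|lra].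
        left. apply Rdiv_lt_0_compat; nra. }
      set (a := Cmod (h t - g t)%C * Rabs (s - s')) in *.
      assert (Ha : 0 <= a) by (apply Rmult_le_pos; [apply Cmod_ge_0|apply Rabs_pos]).
      replace (Cmod (h t - g t)%C * K * Rabs (s - s')) with (a * K) by (unfold a; ring).
      apply Rsqr_incr_0_var; [|nra]. unfold Rsqr.
      assert (a ^ 2 * K <= a ^ 2 * K ^ 2) by (apply Rmult_le_compat_l; nra).
      nra.
Qed.

Lemma survivors_unbounded t : 0 <= t <= 1 -> ~ bounded_set (survivors t).
Proof.
  intros Ht [B HB].
  set (z := (0, Rabs B + 3) : C).
  pose proof (Rabs_pos B).
  assert (Hz : survivors t z).
  { split; [unfold upper_half_plane, z; simpl; lra|]. rewrite trace_hull by lra.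
    intros [T [HT E]]. pose proof (tip_height T ltac:(lra)) as Hh.
    rewrite E in Hh. unfold z in Hh; simpl in Hh. lra. }
  specialize (HB z Hz). pose proof (Im_le_Cmod z) as HI. unfold z in HI at 1; simpl in HI.
  rewrite Rabs_pos_eq in HI by lra. pose proof (Rle_abs B). lra.
Qed.

Lemma trace_is_trace : is_trace lam gam.
Proof.
  split; [exact trace_continuous|]. split.
  - intros t Ht. destruct (Req_dec t 0) as [->|h].
    + rewrite gam_0. simpl. lra.
    + pose proof (tip_height t ltac:(lra)). lra.
  - intros t Ht. split; [|now apply survivors_unbounded].
    split; [|split; [|split]].
    + apply NNPP. intros Hn. apply (survivors_unbounded t Ht). exists 0.
      intros z Hz. exfalso. apply Hn. now exists z.
    + intros z [Hz Nz]. split; [exact Hz|]. intros [s [Hs E]]. apply Nz.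
      rewrite trace_hull by lra. exists s. split; [|exact E].
      destruct (Req_dec s 0) as [->|h]; [|lra].
      unfold upper_half_plane in Hz. rewrite <- E, gam_0 in Hz. simpl in Hz. lra.
    + now apply survivors_connected.
    + intros B _ HB _ z Hz. destruct (HB z Hz) as [Hz1 Nz]. split; [exact Hz1|].
      rewrite trace_hull by lra. intros [T [HT E]]. apply Nz. exists T. split; [lra|exact E].
Qed.

(** The hulls are slits without interior, so they determine the curve. *)
Lemma trace_unique (gam' : R -> C) :
  is_trace lam gam' -> forall t, 0 <= t <= 1 -> gam' t = gam t.
Proof.
  intros [Hc' [Hi' Hcomp]].
  pose proof trace_continuous as Hc.
  assert (Hsub : forall t s, 0 <= t <= 1 -> 0 <= s <= t -> upper_half_plane (gam' s) ->
    exists T, 0 < T <= t /\ gam T = gam' s).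
  { intros t s Ht Hs Hup. apply trace_hull; [lra|]. apply NNPP. intros Hn.
    destruct (Hcomp t Ht) as [[_ [Hin _]] _].
    destruct (Hin (gam' s) (conj Hup Hn)) as [_ Hno]. apply Hno. now exists s. }
  assert (Hsup : forall t s, 0 <= t <= 1 -> 0 < s <= t -> exists s', 0 <= s' <= t /\ gam' s' = gam s).
  { intros t s Ht Hs. apply NNPP. intros Hn.
    destruct (Hcomp t Ht) as [[_ [Hin [Hconn Hmax]]] _].
    assert (Hoff : forall u, 0 <= u <= t -> gam' u <> gam s).
    { intros u Hu E. apply Hn. now exists u. }
    destruct (off_curve_distance gam' 0 t (gam s) (proj1 Ht)) as [r [Hr Hd]]; [|exact Hoff|].
    { apply (continuous_on_subset (fun t => 0 <= t <= 1)); [intros; lra|exact Hc']. }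
    pose proof (tip_height s ltac:(lra)) as Hh.
    set (r' := Rmin r (Im (gam s))).
    assert (Hr' : 0 < r') by (apply Rmin_glb_lt; lra).
    assert (Hball : forall z, Cmod (z - gam s)%C < r' ->
      upper_half_plane z /\ ~ curve_image gam' 0 t z).
    { intros z Hz. split.
      - assert (r' <= Im (gam s)) by apply Rmin_r.
        pose proof (Im_le_Cmod (z - gam s)%C) as HI.
        change (Im (z - gam s)%C) with (Im z - Im (gam s)) in HI.
        unfold upper_half_plane. apply Rabs_le_between in HI. lra.
      - intros [u [Hu E]]. specialize (Hd u Hu). rewrite E in Hd.
        assert (r' <= r) by apply Rmin_l. lra. }
    destruct (arc_empty_interior gam t (gam s) r' Hr') as [p [Hp Np]].
    { apply (continuous_on_subset (fun t => 0 <= t <= 1)); [intros; lra|exact Hc]. }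
    { intros a b Ha Hb. apply trace_injective; lra. }
    assert (Sp : survivors t p).
    { split; [now apply Hball|]. rewrite trace_hull by lra. intros [T [HT E]].
      apply (Np T); [lra|exact E]. }
    pose proof (connected_union _ _ p Hconn (connected_ball (gam s) r') Sp Hp) as Hun.
    assert (Hs' : survivors t (gam s)).
    { apply (Hmax _ Hun).
      - intros z [Hz|Hz]; [now apply Hin|now apply Hball].
      - intros z Hz. now left.
      - right. replace (gam s - gam s)%C with (RtoC 0) by ring. now rewrite Cmod_0. }
    apply (proj2 Hs'). rewrite trace_hull by lra. now exists s. }
  assert (Hpos : forall t, 0 < t <= 1 -> gam' t = gam t).
  { intros t Ht. destruct (Hsup t t ltac:(lra) ltac:(lra)) as [s [Hs E]].
    destruct (Req_dec s t) as [->|h]; [exact E|]. exfalso.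
    destruct (Hsub s s ltac:(lra) ltac:(lra)) as [T [HT E']].
    - unfold upper_half_plane. rewrite E. pose proof (tip_height t Ht). lra.
    - rewrite E in E'. apply trace_injective in E'; lra. }
  intros t Ht. destruct (Req_dec t 0) as [->|h]; [|apply Hpos; lra].
  apply C_eq_of_sqmod. intros e He.
  rewrite continuous_on_eps in Hc, Hc'.
  assert (Hse : 0 < sqrt e) by now apply sqrt_lt_R0.
  destruct (Hc 0 Ht (sqrt e / 2) ltac:(lra)) as [d [Hd K]].
  destruct (Hc' 0 Ht (sqrt e / 2) ltac:(lra)) as [d' [Hd' K']].
  set (u := Rmin 1 (Rmin d d' / 2)).
  assert (Hu : 0 < u <= 1 /\ u < d /\ u < d').
  { unfold u. pose proof (Rmin_l d d'). pose proof (Rmin_r d d').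
    assert (0 < Rmin d d') by now apply Rmin_glb_lt.
    pose proof (Rmin_l 1 (Rmin d d' / 2)). pose proof (Rmin_r 1 (Rmin d d' / 2)).
    split; [split; [apply Rmin_glb_lt|]|]; lra. }
  specialize (K u ltac:(lra) ltac:(rewrite Rminus_0_r, Rabs_pos_eq; lra)).
  specialize (K' u ltac:(lra) ltac:(rewrite Rminus_0_r, Rabs_pos_eq; lra)).
  rewrite (Hpos u) in K' by lra. rewrite Cmod_sym in K'.
  pose proof (Cmod_dist_triangle (gam' 0) (gam u) (gam 0)) as HT.
  rewrite <- Cmod_sqmod. pose proof (Cmod_ge_0 (gam' 0 - gam 0)%C).
  assert (sqrt e ^ 2 = e) by (apply pow2_sqrt; lra). nra.
Qed.

(** * Asymptotics at the tip *)

(** With [Z = X + i Y], [U = u + i v] and [E = Z - U + w], the right-hand side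
    is [2 |E|^2 |1/Z - 1/conj U|^2] up to a term linear in [w]: relative to
    the heights, solutions separate at a definite rate. *)
Lemma separation_inequality (X Y u v w : R) :
  0 < Y -> 0 < v ->
  let q := X ^ 2 + Y ^ 2 in let m := u ^ 2 + v ^ 2 in
  let e1 := X - u + w in let e2 := Y - v in
  (e1 ^ 2 + e2 ^ 2) * v ^ 2 / (q * m) - 4 * w ^ 2 / v ^ 2 <=
  2 * (e1 * (2 * X / q - 2 * u / m) + e2 * (- 2 * Y / q + 2 * v / m)) +
  (e1 ^ 2 + e2 ^ 2) * (2 / q + 2 / m).
Proof.
  intros HY Hv q m e1 e2.
  assert (Hq : 0 < q) by (apply sumsq_pos; exact HY).
  assert (Hm : 0 < m) by (apply sumsq_pos; exact Hv).
  set (n1 := X * u - Y * v). set (n2 := X * v + Y * u).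
  set (s := (e1 * n1 - e2 * n2) / (q * m)).
  assert (Hqm : 0 < q * m) by now apply Rmult_lt_0_compat.
  assert (Hid : 2 * (e1 * (2 * X / q - 2 * u / m) + e2 * (- 2 * Y / q + 2 * v / m)) +
    (e1 ^ 2 + e2 ^ 2) * (2 / q + 2 / m) =
    2 * (e1 ^ 2 + e2 ^ 2) * ((X - u) ^ 2 + (Y + v) ^ 2) / (q * m) + 4 * w * s).
  { unfold s, n1, n2, e1, e2, q, m. unfold q in Hq. unfold m in Hm. field. lra. }
  rewrite Hid.
  assert (Hs : s ^ 2 <= (e1 ^ 2 + e2 ^ 2) / (q * m)).
  { unfold s. apply Rmult_le_reg_r with ((q * m) ^ 2); [now apply pow_lt|].
    replace (((e1 * n1 - e2 * n2) / (q * m)) ^ 2 * (q * m) ^ 2)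
      with ((e1 * n1 - e2 * n2) ^ 2) by (field; lra).
    replace ((e1 ^ 2 + e2 ^ 2) / (q * m) * (q * m) ^ 2) with ((e1 ^ 2 + e2 ^ 2) * (q * m))
      by (field; lra).
    replace (q * m) with (n1 ^ 2 + n2 ^ 2) by (unfold n1, n2, q, m; ring).
    pose proof (pow2_ge_0 (e1 * n2 + e2 * n1)). nra. }
  assert (Hv2 : 0 < v ^ 2) by now apply pow_lt.
  assert (Hw : - (v ^ 2 * s ^ 2) - 4 * w ^ 2 / v ^ 2 <= 4 * w * s).
  { assert (0 <= (v * s + 2 * w / v) ^ 2) by apply pow2_ge_0.
    replace ((v * s + 2 * w / v) ^ 2) with (v ^ 2 * s ^ 2 + 4 * w * s + 4 * w ^ 2 / v ^ 2) in H
      by (field; lra). lra. }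
  assert (Hbig : 2 * ((e1 ^ 2 + e2 ^ 2) * v ^ 2 / (q * m)) <=
    2 * (e1 ^ 2 + e2 ^ 2) * ((X - u) ^ 2 + (Y + v) ^ 2) / (q * m)).
  { apply Rmult_le_reg_r with (q * m); [exact Hqm|].
    replace (2 * ((e1 ^ 2 + e2 ^ 2) * v ^ 2 / (q * m)) * (q * m))
      with (2 * (e1 ^ 2 + e2 ^ 2) * v ^ 2) by (field; lra).
    replace (2 * (e1 ^ 2 + e2 ^ 2) * ((X - u) ^ 2 + (Y + v) ^ 2) / (q * m) * (q * m))
      with (2 * (e1 ^ 2 + e2 ^ 2) * ((X - u) ^ 2 + (Y + v) ^ 2)) by (field; lra).
    apply Rmult_le_compat_l.
    - pose proof (pow2_ge_0 e1). pose proof (pow2_ge_0 e2). lra.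
    - pose proof (pow2_ge_0 (X - u)). nra. }
  assert (Hvs : v ^ 2 * s ^ 2 <= (e1 ^ 2 + e2 ^ 2) * v ^ 2 / (q * m)).
  { apply Rle_trans with (v ^ 2 * ((e1 ^ 2 + e2 ^ 2) / (q * m))).
    - apply Rmult_le_compat_l; lra.
    - right. field. lra. }
  lra.
Qed.

Section Spiral.
Variables (kappa : R) (G : R -> C).
Hypothesis kappa_lt : Rabs kappa < 4.
Hypothesis lam_near : forall e, 0 < e -> exists t0, 0 <= t0 < 1 /\
  forall t, t0 <= t < 1 -> Rabs (lam t - kappa * sqrt (1 - t)) <= e * sqrt (1 - t).
Hypothesis G_chord : chord lam G 1 0.
Hypothesis G_start : G 0 = gam 1.

Definition spiral_angle : R := - asin (kappa / 4).
Let co := cos spiral_angle.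
Let si := sin spiral_angle.
Let A := coneA.
Let c := conec.
Let beta := coneb.
Let K := 4 * (1 + A).
Let r (t : R) := sqrt (1 - t).

(** [hs] is the fixed point of the flow in the coordinate [z / sqrt (1 - t)] for
    the driving function [kappa sqrt (1 - t)], [hb] its conjugate, and [zs] its
    position relative to the driving point; [ew] is [exp (2 i theta)], the exponent
    in the linearizing coordinate. *)
Let hs : C := (- 2 * si, 2 * co).
Let hb : C := (- 2 * si, - 2 * co).
Let zs : C := (2 * si, 2 * co).
Let ew : C := (co ^ 2 - si ^ 2, 2 * si * co).

Lemma kappa_range : -1 < kappa / 4 < 1.
Proof. apply Rabs_lt_between in kappa_lt. lra. Qed.

Lemma spiral_angle_range : - PI / 2 < spiral_angle < PI / 2.
Proof.
  pose proof (asin_bound_lt (kappa / 4) kappa_range) as H. unfold spiral_angle. lra.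
Qed.

Lemma sin_spiral_angle : kappa = - 4 * si.
Proof.
  unfold si, spiral_angle. rewrite sin_neg, sin_asin; [field|].
  pose proof kappa_range. lra.
Qed.

Lemma co_pos : 0 < co <= 1.
Proof.
  split; [|apply COS_bound]. pose proof spiral_angle_range. apply cos_gt_0; lra.
Qed.

Lemma co_si : co ^ 2 + si ^ 2 = 1.
Proof.
  pose proof (sin2_cos2 spiral_angle) as H. unfold Rsqr in H. unfold co, si. lra.
Qed.

Lemma A_pos : 0 < A. Proof. apply (coneA_pos). Qed.
Lemma c_range : 0 < c <= 4. Proof. apply (conec_range). Qed.
Lemma beta_range : 0 < beta < 1. Proof. apply (coneb_range). Qed.
Lemma K_pos : 4 < K. Proof. pose proof A_pos. unfold K. lra. Qed.

Lemma zs_neq0 : zs <> RtoC 0.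
Proof. apply neq0_im. unfold zs; simpl. pose proof co_pos. lra. Qed.

Lemma hs_minus : (hs - RtoC kappa)%C = zs.
Proof.
  pose proof sin_spiral_angle. apply C_ext; unfold hs, zs, Re, Im; simpl; lra.
Qed.

Lemma hs_hb : (hs * hb)%C = RtoC 4.
Proof. pose proof co_si. apply C_ext; unfold hs, hb, Re, Im; simpl; nra. Qed.

Lemma hs_plus_hb : (hs + hb)%C = RtoC kappa.
Proof.
  pose proof sin_spiral_angle. apply C_ext; unfold hs, hb, Re, Im; simpl; lra.
Qed.

Lemma ew_hb : (ew * hb * zs)%C = RtoC 4.
Proof.
  pose proof co_si as H.
  assert (E1 : (hb * zs)%C = (4 * (co ^ 2 - si ^ 2), - 8 * si * co))
    by (apply C_ext; unfold hb, zs, Re, Im; simpl; ring).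
  replace (ew * hb * zs)%C with (ew * (hb * zs))%C by ring. rewrite E1.
  apply C_ext; unfold ew, Re, Im; simpl; [|ring].
  replace ((co * (co * 1) - si * (si * 1)) * (4 * (co * (co * 1) - si * (si * 1))) -
    2 * si * co * (-8 * si * co)) with (4 * (co ^ 2 + si ^ 2) ^ 2) by ring.
  rewrite H. ring.
Qed.

Lemma Cmod_zs : Cmod zs = 2.
Proof.
  assert (H : Cmod zs ^ 2 = 2 ^ 2).
  { rewrite Cmod_sqmod. unfold sqmod, zs; simpl. pose proof co_si. nra. }
  pose proof (Cmod_ge_0 zs). nra.
Qed.

Lemma Cmod_hb : Cmod hb = 2.
Proof.
  assert (H : Cmod hb ^ 2 = 2 ^ 2).
  { rewrite Cmod_sqmod. unfold sqmod, hb; simpl. pose proof co_si. nra. }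
  pose proof (Cmod_ge_0 hb). nra.
Qed.

Lemma Cmod_ew : Cmod ew = 1.
Proof.
  assert (H : Cmod ew ^ 2 = 1 ^ 2).
  { rewrite Cmod_sqmod. unfold sqmod, ew, Re, Im; simpl.
    replace ((co * (co * 1) - si * (si * 1)) * ((co * (co * 1) - si * (si * 1)) * 1) +
      2 * si * co * (2 * si * co * 1)) with ((co ^ 2 + si ^ 2) ^ 2) by ring.
    rewrite co_si. ring. }
  pose proof (Cmod_ge_0 ew). nra.
Qed.

Lemma r_pos t : t < 1 -> 0 < r t.
Proof. intros H. apply sqrt_lt_R0. lra. Qed.

Lemma r_sq t : t <= 1 -> r t ^ 2 = 1 - t.
Proof. intros H. apply pow2_sqrt. lra. Qed.

Lemma derive_r t : t < 1 -> is_derive r t (- / (2 * r t)).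
Proof.
  intros H. evar_last. apply (derive_sqrt _ _ _ (derive_rev 1 t)). lra.
  fold (r t). pose proof (r_pos t H). field. lra.
Qed.

Lemma chord_height_lower g T t : chord lam g T 0 -> 0 <= t < T ->
  sqrt (c * (T - t)) <= Im (g t).
Proof.
  intros Hg Ht. destruct (chord_height g T 0 t Hg Ht) as [H _]. fold c in H.
  assert (HY : 0 < Im (g t)) by (apply Hg; lra).
  rewrite <- (sqrt_pow2 (Im (g t))) by lra. apply sqrt_le_1_alt. lra.
Qed.

Lemma chord_gap_lower g T t : chord lam g T 0 -> 0 <= t < T ->
  sqrt (c * (T - t)) <= Cmod (g t - RtoC (lam t))%C.
Proof.
  intros Hg Ht. eapply Rle_trans; [exact (chord_height_lower g T t Hg Ht)|].
  eapply Rle_trans; [|apply Im_le_Cmod].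
  replace (Im (g t - RtoC (lam t))%C) with (Im (g t)) by (unfold Im; simpl; ring).
  apply Rle_abs.
Qed.

Definition steady_error (t : R) : C := (G t - hs * RtoC (r t))%C.

(** The trajectory of the tip approaches the fixed point: in the scaled
    coordinate all other trajectories are repelled from it at a definite rate,
    while this one stays bounded up to the end. *)
Lemma tip_is_steady e : 0 < e -> exists t0, 0 <= t0 < 1 /\ forall t, t0 <= t < 1 ->
  Cmod (steady_error t) <= e * r t.
Proof.
  intros He.
  pose proof co_pos as Hco. pose proof c_range as Hc. pose proof K_pos as HK.
  assert (Hsc : 0 < sqrt c) by (apply sqrt_lt_R0; lra).
  assert (Hco2 : 0 < co ^ 2) by (apply pow_lt; lra).
  set (a := co ^ 2 / K).
  assert (Ha : 0 < a) by (apply Rdiv_lt_0_compat; lra).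
  set (b := e ^ 2 / 2).
  assert (Hb : 0 < b) by (unfold b; nra).
  assert (Hnu0 : 0 < b * a * co ^ 2 * sqrt c).
  { apply Rmult_lt_0_compat; [|exact Hsc]. apply Rmult_lt_0_compat; [|exact Hco2].
    now apply Rmult_lt_0_compat. }
  set (nu := sqrt (b * a * co ^ 2 * sqrt c)).
  assert (Hnu2 : nu ^ 2 = b * a * co ^ 2 * sqrt c).
  { apply pow2_sqrt. lra. }
  assert (Hnu : 0 < nu) by now apply sqrt_lt_R0.
  destruct (lam_near (Rmin nu 1)) as [t0 [Ht0 Hlam]]; [apply Rmin_glb_lt; lra|].
  exists t0. split; [exact Ht0|].
  set (om t := lam t - kappa * r t).
  assert (Hom : forall t, t0 <= t < 1 -> Rabs (om t) <= nu * r t /\ Rabs (om t) <= r t).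
  { intros t Ht. specialize (Hlam t Ht). fold (r t) in Hlam. fold (om t) in Hlam.
    pose proof (Rmin_l nu 1). pose proof (Rmin_r nu 1). pose proof (r_pos t ltac:(lra)).
    split; nra. }
  set (P t := sqmod (steady_error t) * (/ Im (G t) * / r t)).
  set (X t := Re (G t) - lam t). set (Y t := Im (G t)).
  assert (HGs : forall t, 0 <= t < 1 -> solves lam G t) by apply G_chord.
  assert (HY : forall t, 0 <= t < 1 -> sqrt c * r t <= Y t /\ Y t <= 2 * r t).
  { intros t Ht. split.
    - unfold r. rewrite <- sqrt_mult by lra. now apply (chord_height_lower G 1 t G_chord).
    - destruct (chord_height G 1 0 t G_chord Ht) as [_ H].
      pose proof (r_sq t ltac:(lra)). pose proof (r_pos t ltac:(lra)). unfold Y. nra. }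
  assert (Hq : forall t, 0 <= t < 1 -> X t ^ 2 + Y t ^ 2 <= K * r t ^ 2).
  { intros t Ht. pose proof (chord_size G 1 0 t G_chord Ht) as H.
    rewrite sqmod_gap in H. rewrite r_sq by lra. unfold X, Y, K. fold A in H. lra. }
  assert (HE : forall t, Re (steady_error t) = X t - 2 * si * r t + om t /\
                         Im (steady_error t) = Y t - 2 * co * r t).
  { intros t. pose proof sin_spiral_angle. unfold steady_error, X, Y, om, hs, Re, Im; simpl.
    split; [|ring]. rewrite H. ring. }
  set (S t := 2 * (Re (steady_error t) * (2 * X t / (X t ^ 2 + Y t ^ 2) - 2 * (2 * si * r t) / (2 * r t) ^ 2)
    + Im (steady_error t) * (-2 * Y t / (X t ^ 2 + Y t ^ 2) + 2 * (2 * co * r t) / (2 * r t) ^ 2))).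
  set (dP t := S t * (/ Y t * / r t) + sqmod (steady_error t) *
     ((2 / (Y t * (X t ^ 2 + Y t ^ 2))) * / r t + / Y t * (/ (2 * r t) / r t ^ 2))).
  assert (DP : forall t, 0 <= t < 1 -> is_derive P t (dP t)).
  { intros t Ht. pose proof (r_pos t ltac:(lra)) as Hr.
    assert (HYp : 0 < Y t) by (apply HGs; lra).
    pose proof (sumsq_pos (X t) (Y t) HYp) as Hqp.
    destruct (solves_components lam G t (HGs t Ht)) as [D1 [D2 _]]. fold (X t) (Y t) in D1, D2.
    pose proof (derive_r t ltac:(lra)) as Dr.
    apply (derive_mult (fun t => sqmod (steady_error t)) (fun t => / Im (G t) * / r t)).
    - evar_last.
      + apply (derive_sqmod steady_error t
          (2 * X t / (X t ^ 2 + Y t ^ 2) - 2 * (2 * si * r t) / (2 * r t) ^ 2,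
           -2 * Y t / (X t ^ 2 + Y t ^ 2) + 2 * (2 * co * r t) / (2 * r t) ^ 2)).
        split.
        * apply derive_ext with (fun t => Re (G t) - - 2 * si * r t).
          { intros s. unfold steady_error, hs, Re, Im; simpl. ring. }
          evar_last.
          exact (derive_minus _ _ _ _ _ D1 (derive_mult _ _ _ _ _ (is_derive_const (- 2 * si) t) Dr)).
          unfold zero; simpl. field. split; [lra|]. unfold Re in *; simpl in *. lra.
        * apply derive_ext with (fun t => Im (G t) - 2 * co * r t).
          { intros s. unfold steady_error, hs, Re, Im; simpl. ring. }
          evar_last.
          exact (derive_minus _ _ _ _ _ D2 (derive_mult _ _ _ _ _ (is_derive_const (2 * co) t) Dr)).
          unfold zero; simpl. field. split; [lra|]. unfold Re in *; simpl in *. lra.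
      + reflexivity.
    - evar_last.
      + exact (derive_mult _ _ _ _ _ (derive_inv _ _ _ D2 ltac:(unfold Y in HYp; lra))
                 (derive_inv _ _ _ Dr ltac:(lra))).
      + cbv beta. fold (Y t). generalize (Y t) (X t) HYp Hqp. intros y x Hy Hxy. field. lra. }
  assert (Hineq : forall t, t0 <= t < 1 -> a * (P t - b) / (1 - t) <= dP t).
  { intros t Ht. pose proof (r_pos t ltac:(lra)) as Hr.
    destruct (HY t ltac:(lra)) as [HY1 HY2].
    assert (HYp : 0 < Y t) by (apply HGs; lra).
    pose proof (sumsq_pos (X t) (Y t) HYp) as Hqp. specialize (Hq t ltac:(lra)).
    destruct (Hom t Ht) as [Ho1 _].
    pose proof (separation_inequality (X t) (Y t) (2 * si * r t) (2 * co * r t) (om t) HYp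
      ltac:(nra)) as Hsep. cbv zeta in Hsep.
    destruct (HE t) as [E1 E2]. rewrite <- E1, <- E2 in Hsep.
    replace ((2 * si * r t) ^ 2 + (2 * co * r t) ^ 2) with ((2 * r t) ^ 2) in Hsep
      by (replace ((2 * si * r t) ^ 2 + (2 * co * r t) ^ 2) with ((2 * r t) ^ 2 * (co ^ 2 + si ^ 2)) by ring;
          rewrite co_si; ring).
    set (q := X t ^ 2 + Y t ^ 2) in *.
    change (Re (steady_error t) ^ 2 + Im (steady_error t) ^ 2) with (sqmod (steady_error t)) in Hsep.
    assert (EdP : dP t = (S t + sqmod (steady_error t) * (2 / q + 2 / (2 * r t) ^ 2)) * (/ Y t * / r t)).
    { unfold dP. fold q. field. lra. }
    assert (Hpos : 0 < / Y t * / r t).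
    { apply Rmult_lt_0_compat; now apply Rinv_0_lt_compat. }
    pose proof (sqmod_nonneg (steady_error t)) as HE0.
    set (e2 := sqmod (steady_error t)) in *.
    assert (H1 : e2 * co ^ 2 / (K * r t ^ 2) <= e2 * (2 * co * r t) ^ 2 / (q * (2 * r t) ^ 2)).
    { replace (e2 * (2 * co * r t) ^ 2 / (q * (2 * r t) ^ 2)) with (e2 * co ^ 2 * / q)
        by (field; lra).
      unfold Rdiv. apply Rmult_le_compat_l; [apply Rmult_le_pos; lra|].
      apply Rinv_le_contravar; lra. }
    assert (H2 : 4 * om t ^ 2 / (2 * co * r t) ^ 2 <= nu ^ 2 / co ^ 2).
    { replace (4 * om t ^ 2 / (2 * co * r t) ^ 2) with (om t ^ 2 * / r t ^ 2 * / co ^ 2)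
        by (field; lra).
      unfold Rdiv. apply Rmult_le_compat_r; [left; now apply Rinv_0_lt_compat|].
      apply Rmult_le_reg_r with (r t ^ 2); [nra|].
      rewrite Rmult_assoc, Rinv_l, Rmult_1_r by nra.
      rewrite <- pow2_abs. pose proof (Rabs_pos (om t)). nra. }
    assert (H3 : nu ^ 2 / co ^ 2 * (/ Y t * / r t) <= a * b / (1 - t)).
    { rewrite Hnu2. rewrite <- r_sq by lra.
      apply Rmult_le_reg_r with (Y t * r t); [nra|].
      replace (b * a * co ^ 2 * sqrt c / co ^ 2 * (/ Y t * / r t) * (Y t * r t))
        with (a * b * sqrt c) by (field; lra).
      replace (a * b / r t ^ 2 * (Y t * r t)) with (a * b * (Y t / r t)) by (field; lra).
      apply Rmult_le_compat_l; [nra|].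
      apply Rmult_le_reg_r with (r t); [lra|]. replace (Y t / r t * r t) with (Y t) by (field; lra).
      lra. }
    assert (H4 : e2 * co ^ 2 / (K * r t ^ 2) * (/ Y t * / r t) = a * P t / (1 - t)).
    { unfold P, a. fold e2 (Y t). rewrite <- r_sq by lra. field. lra. }
    rewrite EdP.
    apply Rle_trans with ((e2 * co ^ 2 / (K * r t ^ 2) - nu ^ 2 / co ^ 2) * (/ Y t * / r t)).
    - replace (a * (P t - b) / (1 - t)) with (a * P t / (1 - t) - a * b / (1 - t)) by (field; lra).
      rewrite <- H4. lra.
    - apply Rmult_le_compat_r; [lra|]. unfold S. fold q. lra. }
  set (Pmax := (3 * (K + 29)) / sqrt c).
  assert (HPmax : forall t, t0 <= t < 1 -> P t <= Pmax).
  { intros t Ht. pose proof (r_pos t ltac:(lra)) as Hr.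
    destruct (HY t ltac:(lra)) as [HY1 _]. specialize (Hq t ltac:(lra)).
    destruct (Hom t Ht) as [_ Ho]. destruct (HE t) as [E1 E2].
    assert (HYp : 0 < Y t) by (apply HGs; lra).
    assert (He2 : sqmod (steady_error t) <= 3 * (K + 29) * r t ^ 2).
    { unfold sqmod. rewrite E1, E2. apply Rabs_le_between in Ho.
      pose proof co_si as Hcs.
      assert ((X t - 2 * si * r t + om t) ^ 2 <= 3 * (X t ^ 2 + (2 * si * r t) ^ 2 + om t ^ 2)).
      { pose proof (pow2_ge_0 (X t + 2 * si * r t)). pose proof (pow2_ge_0 (X t - om t)).
        pose proof (pow2_ge_0 (2 * si * r t + om t)). nra. }
      assert ((Y t - 2 * co * r t) ^ 2 <= 2 * (Y t ^ 2 + (2 * co * r t) ^ 2)).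
      { pose proof (pow2_ge_0 (Y t + 2 * co * r t)). nra. }
      assert ((2 * si * r t) ^ 2 + (2 * co * r t) ^ 2 = 4 * r t ^ 2).
      { replace ((2 * si * r t) ^ 2 + (2 * co * r t) ^ 2) with (4 * r t ^ 2 * (co ^ 2 + si ^ 2)) by ring.
        rewrite Hcs. ring. }
      assert (om t ^ 2 <= r t ^ 2) by nra.
      pose proof (pow2_ge_0 (2 * co * r t)). pose proof (pow2_ge_0 (Y t)).
      pose proof (pow2_ge_0 (r t)). nra. }
    unfold P, Pmax. fold (Y t). apply Rmult_le_reg_r with (Y t * r t); [nra|].
    replace (sqmod (steady_error t) * (/ Y t * / r t) * (Y t * r t))
      with (sqmod (steady_error t)) by (field; lra).
    eapply Rle_trans; [exact He2|].
    replace (3 * (K + 29) * r t ^ 2) with (3 * (K + 29) / sqrt c * (sqrt c * r t * r t))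
      by (field; lra).
    apply Rmult_le_compat_l; [left; apply Rdiv_lt_0_compat; lra|].
    apply Rmult_le_compat_r; lra. }
  assert (HPb : forall t, t0 <= t < 1 -> P t <= b).
  { intros t Ht. apply Rnot_lt_le. intros Hlt.
    assert (Hm : 0 < (P t - b) / Pmax).
    { apply Rdiv_lt_0_compat; [lra|]. pose proof (HPmax t Ht). lra. }
    assert (HPm : 0 < Pmax) by (pose proof (HPmax t Ht); lra).
    (* The lower bound for [P] grows like [(1 - u)^(-a)]; [u] is where it passes [Pmax]. *)
    set (L := ln (1 - t) + Rmin 0 (ln ((P t - b) / Pmax) / a) - 1).
    set (u := 1 - exp L).
    assert (HL : L < ln (1 - t)) by (pose proof (Rmin_l 0 (ln ((P t - b) / Pmax) / a)); unfold L; lra).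
    assert (Hu : t < u < 1).
    { unfold u. pose proof (exp_pos L). apply exp_increasing in HL. rewrite exp_ln in HL; lra. }
    assert (Hmono : (P t - b) * exp (a * ln (1 - t)) <= (P u - b) * exp (a * ln (1 - u))).
    { apply (nondecreasing_of_derive (fun s => (P s - b) * exp (a * ln (1 - s)))
       (fun s => (dP s - 0) * exp (a * ln (1 - s)) +
          (P s - b) * (exp (a * ln (1 - s)) * (a * ((-1) / (1 - s))))) t u); [lra| |].
      - intros s Hs.
        assert (D := derive_ln _ _ _ (derive_rev 1 s) ltac:(lra)).
        apply (derive_mult (fun s => P s - b) (fun s => exp (a * ln (1 - s)))).
        + exact (derive_minus _ _ _ _ _ (DP s ltac:(lra)) (is_derive_const b s)).
        + apply (derive_comp exp (fun s => a * ln (1 - s))); [apply is_derive_exp|].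
          evar_last. exact (derive_mult _ _ _ _ _ (is_derive_const a s) D).
          unfold zero; simpl. ring.
      - intros s Hs. specialize (Hineq s ltac:(lra)). pose proof (exp_pos (a * ln (1 - s))).
        replace ((dP s - 0) * exp (a * ln (1 - s)) +
          (P s - b) * (exp (a * ln (1 - s)) * (a * (-1 / (1 - s)))))
        with (exp (a * ln (1 - s)) * (dP s - a * (P s - b) / (1 - s))) by (field; lra).
        apply Rmult_le_pos; lra. }
    replace (ln (1 - u)) with L in Hmono by (unfold u; replace (1 - (1 - exp L)) with (exp L) by ring;
      now rewrite ln_exp).
    pose proof (HPmax u ltac:(lra)) as HPu.
    assert (Hcontra : Pmax * exp (a * L) < (P t - b) * exp (a * ln (1 - t))).
    { apply Rmult_lt_reg_l with (/ Pmax); [now apply Rinv_0_lt_compat|].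
      rewrite <- !Rmult_assoc, Rinv_l, Rmult_1_l by lra.
      replace (/ Pmax * (P t - b)) with (exp (ln ((P t - b) / Pmax)))
        by (rewrite exp_ln by exact Hm; field; lra).
      rewrite <- exp_plus. apply exp_increasing.
      pose proof (Rmin_r 0 (ln ((P t - b) / Pmax) / a)) as Hr.
      assert (a * L <= a * ln (1 - t) + ln ((P t - b) / Pmax) - a).
      { unfold L. replace (ln ((P t - b) / Pmax)) with (a * (ln ((P t - b) / Pmax) / a)) at 2
          by (field; lra). nra. }
      lra. }
    pose proof (exp_pos (a * L)). nra. }
  intros t Ht. specialize (HPb t Ht). pose proof (r_pos t ltac:(lra)) as Hr.
  destruct (HY t ltac:(lra)) as [HY1 HY2]. assert (HYp : 0 < Y t) by (apply HGs; lra).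
  assert (Hsq : Cmod (steady_error t) ^ 2 <= (e * r t) ^ 2).
  { rewrite Cmod_sqmod. unfold P in HPb. fold (Y t) in HPb.
    apply Rmult_le_compat_r with (r := Y t * r t) in HPb; [|nra].
    replace (sqmod (steady_error t) * (/ Y t * / r t) * (Y t * r t))
      with (sqmod (steady_error t)) in HPb by (field; lra).
    assert (b * (Y t * r t) <= b * (2 * r t * r t)) by (apply Rmult_le_compat_l; nra).
    unfold b in *. nra. }
  pose proof (Cmod_ge_0 (steady_error t)). assert (0 < e * r t) by nra. nra.
Qed.

Let Kh := holderK.
Let p := (1 - beta) / 2.

Lemma p_pos : 0 < p.
Proof. pose proof beta_range. unfold p. lra. Qed.

Lemma sqrt_Kh_pos : 0 < sqrt Kh.
Proof. apply sqrt_lt_R0. apply (holderK_pos). Qed.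

(** Measured in units of [r t], the difference decays like a power of the
    ratio of scales [(1 - t) / (1 - T)]. *)
Lemma gap_to_tip_le g T t : T < 1 -> chord lam g T 0 -> 0 <= t < T ->
  Cmod (g t - G t)%C <= sqrt Kh * (r t * exp (- p * (ln (1 - t) - ln (1 - T)))).
Proof.
  intros HT Hg Ht.
  pose proof (chord_compare g G T 1 0 0 t (1 - T) Hg G_chord
    ltac:(lra) ltac:(lra) ltac:(lra) ltac:(lra) ltac:(rewrite Rabs_left1; lra)
    ltac:(rewrite pow_ne_zero by lia; lra) ltac:(rewrite pow_ne_zero by lia; lra)) as H.
  fold Kh beta in H. rewrite Rmin_left in H by lra.
  replace (T - t + (1 - T)) with (1 - t) in H by ring. rewrite ln_div in H by lra.
  pose proof (sqrt_Kh_pos) as HK. pose proof (r_pos t ltac:(lra)) as Hr.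
  assert (HKs : sqrt Kh ^ 2 = Kh).
  { apply pow2_sqrt. left. apply (holderK_pos). }
  apply Rsqr_incr_0_var; [|repeat apply Rmult_le_pos; try lra; left; apply exp_pos].
  unfold Rsqr.
  replace (Cmod (g t - G t)%C * Cmod (g t - G t)%C) with (Cmod (g t - G t)%C ^ 2) by ring.
  rewrite Cmod_sqmod. eapply Rle_trans; [exact H|]. right.
  set (l := ln (1 - t)) in *. set (m := ln (1 - T)).
  replace (sqrt Kh * (r t * exp (- p * (l - m))) * (sqrt Kh * (r t * exp (- p * (l - m)))))
    with (sqrt Kh ^ 2 * (r t ^ 2 * (exp (- p * (l - m)) * exp (- p * (l - m))))) by ring.
  rewrite HKs, r_sq, <- exp_plus by lra.
  replace (1 - t) with (exp l) by (apply exp_ln; lra).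
  replace (1 - T) with (exp m) by (apply exp_ln; lra).
  rewrite Rmult_assoc, <- !exp_plus. do 2 f_equal. unfold p. field.
Qed.

Lemma gap_to_tip_neq0 g T t : 0 < T < 1 -> chord lam g T 0 -> g 0 = gam T -> 0 <= t < T ->
  (g t - G t)%C <> RtoC 0.
Proof.
  intros HT Hg Hg0 Ht E.
  assert (E' : g t = G t) by (replace (g t) with (g t - G t + G t)%C by ring; rewrite E; ring).
  assert (H : g 0 = G 0).
  { apply (solution_unique lam g G 0 t t); try lra; auto.
    - intros u Hu. apply Hg. lra.
    - intros u Hu. apply G_chord. lra. }
  rewrite Hg0, G_start in H.
  apply (trace_injective) in H; lra.
Qed.

Let K2 := 4 * sqrt Kh / sqrt (c / 2) ^ 3.

(** With [D1] and [D2] the differences to the tip trajectory, the logarithmic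
    derivative of [D2 / D1] is [2 (D2 - D1) / (Z Z1 Z2)]. By [gap_to_tip_le]
    its integral over [[0, t]] is small if the ratio of scales [W] is large. *)
Lemma far_ratio g1 g2 T1 T2 t W :
  0 < T1 <= T2 -> T2 < 1 -> chord lam g1 T1 0 -> chord lam g2 T2 0 ->
  g1 0 = gam T1 -> g2 0 = gam T2 -> 0 <= t < T1 -> 2 <= W -> 1 - t = W * (1 - T1) ->
  near (K2 / p * exp (- p * ln W))
    ((g2 0%R - G 0%R) / (g1 0%R - G 0%R) / ((g2 t - G t) / (g1 t - G t)))%C.
Proof.
  intros HT1 HT2 C1 C2 S1 S2 Ht HW HtW.
  pose proof c_range as Hc. pose proof p_pos as Hp. pose proof sqrt_Kh_pos as HKh.
  assert (Hsc : 0 < sqrt (c / 2)) by (apply sqrt_lt_R0; lra).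
  assert (Hsc3 : 0 < sqrt (c / 2) ^ 3) by now apply pow_lt.
  assert (HK2 : 0 < K2) by (unfold K2; apply Rdiv_lt_0_compat; lra).
  assert (N1 : forall u, 0 <= u <= t -> (g1 u - G u)%C <> RtoC 0).
  { intros u Hu. apply (gap_to_tip_neq0 g1 T1); auto; lra. }
  assert (N2 : forall u, 0 <= u <= t -> (g2 u - G u)%C <> RtoC 0).
  { intros u Hu. apply (gap_to_tip_neq0 g2 T2); auto; lra. }
  set (f u := ((g2 u - G u) * / (g1 u - G u))%C).
  set (ZG u := (G u - RtoC (lam u))%C).
  set (Z1 u := (g1 u - RtoC (lam u))%C). set (Z2 u := (g2 u - RtoC (lam u))%C).
  set (e u := (RtoC 2 * ((g2 u - G u) - (g1 u - G u)) / (ZG u * (Z1 u * Z2 u)))%C).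
  set (E u := K2 / p * exp (- p * (ln (1 - u) - ln (1 - T1)))).
  set (dE u := K2 * exp (- p * (ln (1 - u) - ln (1 - T1))) / (1 - u)).
  assert (Hf : forall u, 0 <= u <= t -> cderiv f u (e u * f u)%C).
  { intros u Hu.
    assert (SG : solves lam G u) by (apply G_chord; lra).
    assert (S1' : solves lam g1 u) by (apply C1; lra).
    assert (S2' : solves lam g2 u) by (apply C2; lra).
    specialize (N1 u Hu). specialize (N2 u Hu).
    pose proof (gap_neq0 lam G u (proj2 SG)) as NG.
    pose proof (gap_neq0 lam g1 u (proj2 S1')) as NZ1.
    pose proof (gap_neq0 lam g2 u (proj2 S2')) as NZ2.
    eapply cderiv_ext_val.
    - apply (cderiv_mult (fun u => g2 u - G u)%C (fun u => / (g1 u - G u))%C).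
      + exact (cderiv_difference lam g2 G u S2' SG).
      + exact (cderiv_inv _ _ _ (cderiv_difference lam g1 G u S1' SG) N1).
    - unfold e, f, ZG, Z1, Z2. field. auto. }
  assert (HE : forall u, 0 <= u <= t -> is_derive E u (dE u)).
  { intros u Hu.
    assert (D1 : is_derive (fun u => - p * (ln (1 - u) - ln (1 - T1))) u (- p * ((-1) / (1 - u)))).
    { evar_last.
      exact (derive_mult _ _ _ _ _ (is_derive_const (- p) u) (derive_minus _ _ _ _ _
        (derive_ln _ _ _ (derive_rev 1 u) ltac:(lra)) (is_derive_const (ln (1 - T1)) u))).
      unfold zero; simpl. ring. }
    evar_last.
    exact (derive_mult _ _ _ _ _ (is_derive_const (K2 / p) u)
      (derive_comp exp _ u _ _ (is_derive_exp _) D1)).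
    unfold dE, zero; simpl. field. lra. }
  assert (He : forall u, 0 <= u <= t -> Cmod (e u) <= dE u).
  { intros u Hu. pose proof (r_pos u ltac:(lra)) as Hr.
    set (m := sqrt (c / 2) * r u).
    assert (Hm : 0 < m) by (unfold m; nra).
    assert (Hlow : forall T, 1 - u <= 2 * (T - u) -> m <= sqrt (c * (T - u))).
    { intros T HT. unfold m, r. rewrite <- sqrt_mult by lra. apply sqrt_le_1_alt. nra. }
    assert (LG : m <= Cmod (ZG u)).
    { eapply Rle_trans; [|apply (chord_gap_lower G 1 u G_chord); lra]. apply Hlow. lra. }
    assert (L1 : m <= Cmod (Z1 u)).
    { eapply Rle_trans; [|apply (chord_gap_lower g1 T1 u C1); lra]. apply Hlow. nra. }
    assert (L2 : m <= Cmod (Z2 u)).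
    { eapply Rle_trans; [|apply (chord_gap_lower g2 T2 u C2); lra]. apply Hlow. nra. }
    set (x := exp (- p * (ln (1 - u) - ln (1 - T1)))).
    assert (Hx : 0 < x) by apply exp_pos.
    assert (B1 : Cmod (g1 u - G u)%C <= sqrt Kh * (r u * x)) by (apply gap_to_tip_le; auto; lra).
    assert (B2 : Cmod (g2 u - G u)%C <= sqrt Kh * (r u * x)).
    { eapply Rle_trans; [apply (gap_to_tip_le g2 T2); auto; lra|].
      apply Rmult_le_compat_l; [lra|]. apply Rmult_le_compat_l; [lra|]. apply exp_monotone.
      assert (ln (1 - T2) <= ln (1 - T1)) by (apply ln_le; lra). nra. }
    unfold e.
    assert (NZ : (ZG u * (Z1 u * Z2 u))%C <> RtoC 0).
    { apply Cmult_neq_0; [|apply Cmult_neq_0]; intros E0; rewrite E0, Cmod_0 in *; lra. }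
    rewrite Cmod_div by exact NZ. rewrite !Cmod_mult, Cmod_R, (Rabs_pos_eq 2) by lra.
    assert (B3 : Cmod ((g2 u - G u) - (g1 u - G u))%C <= 2 * (sqrt Kh * (r u * x))).
    { unfold Cminus at 1. eapply Rle_trans; [apply Cmod_triangle|]. rewrite Cmod_opp. lra. }
    assert (Hm3 : m ^ 3 <= Cmod (ZG u) * (Cmod (Z1 u) * Cmod (Z2 u))).
    { replace (m ^ 3) with (m * (m * m)) by ring.
      apply Rmult_le_compat; [lra|nra|exact LG|]. apply Rmult_le_compat; lra. }
    assert (Hm30 : 0 < m ^ 3) by now apply pow_lt.
    unfold Rdiv.
    apply Rle_trans with (2 * (2 * (sqrt Kh * (r u * x))) * / m ^ 3).
    - apply Rmult_le_compat.
      + pose proof (Cmod_ge_0 ((g2 u - G u) - (g1 u - G u))%C). lra.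
      + left. apply Rinv_0_lt_compat. lra.
      + lra.
      + now apply Rinv_le_contravar.
    - right. unfold dE. fold x. rewrite <- r_sq by lra. unfold K2, m. field. lra. }
  assert (Hft : f t <> RtoC 0).
  { intros E0. specialize (N1 t ltac:(lra)). apply (N2 t ltac:(lra)).
    replace (g2 t - G t)%C with (f t * (g1 t - G t))%C by (unfold f; field; exact N1).
    rewrite E0. ring. }
  change (near (K2 / p * exp (- p * ln W)) (f 0 / f t)%C).
  apply near_of_quotient; [exact Hft|].
  eapply Rle_trans; [apply (log_derivative_bound_rev f e E dE 0 t); auto; lra|].
  apply Rmult_le_compat_l; [apply Cmod_ge_0|].
  assert (E t - E 0 <= K2 / p * exp (- p * ln W)).
  { assert (0 < E 0) by (apply Rmult_lt_0_compat; [apply Rdiv_lt_0_compat; lra|apply exp_pos]).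
    assert (E t = K2 / p * exp (- p * ln W)); [|lra].
    unfold E. rewrite HtW, ln_mult by lra. do 3 f_equal. ring. }
  apply exp_monotone in H. lra.
Qed.

Definition base_point (g : R -> C) (t : R) : C := (g t - hb * RtoC (r t))%C.

Lemma base_point_Im g t : t < 1 -> 0 <= Im (g t) -> 2 * co * r t <= Im (base_point g t).
Proof.
  intros Ht Hg. unfold base_point, hb, Im in *; simpl. lra.
Qed.

(** For the driving function [kappa sqrt (1 - t)] this quantity is constant: it is
    the linearizing coordinate of the flow at its fixed point. *)
Definition spiral_coordinate (g : R -> C) (t : R) : C :=
  ((g t - G t) * Cexp (ew * clog (base_point g t)))%C.

(** The value of the spiral coordinate when the chord has reached the driving
    point. *)
Definition spiral_end (T : R) : C :=
  ((RtoC (lam T) - G T) * Cexp (ew * clog (RtoC (lam T) - hb * RtoC (r T))))%C.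

Let eta0 := 2 / sqrt c + 1 / (2 * co).

Lemma spiral_coordinate_derivative g T t nu :
  T < 1 -> chord lam g T 0 -> 0 <= t < T ->
  Rabs (lam t - kappa * r t) <= nu * r t -> Cmod (steady_error t) <= nu * r t ->
  exists e, cderiv (spiral_coordinate g) t (e * spiral_coordinate g t)%C /\
    Cmod e <= nu * eta0 / (r t * sqrt (c * (T - t))).
Proof.
  intros HT Hg Ht Hom HE.
  pose proof c_range as Hc. pose proof co_pos as Hco. pose proof (r_pos t ltac:(lra)) as Hr.
  assert (Hsc : 0 < sqrt c) by (apply sqrt_lt_R0; lra).
  assert (SG : solves lam G t) by (apply G_chord; lra).
  assert (Sg : solves lam g t) by (apply Hg; lra).
  pose proof (gap_neq0 lam G t (proj2 SG)) as NG.
  pose proof (gap_neq0 lam g t (proj2 Sg)) as Ng.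
  assert (HB : 2 * co * r t <= Im (base_point g t)).
  { apply base_point_Im; [lra|]. left. apply Sg. }
  assert (NB : base_point g t <> RtoC 0) by (apply neq0_im; nra).
  assert (Nr : RtoC (r t) <> RtoC 0).
  { intros E. apply (f_equal Re) in E. simpl in E. lra. }
  assert (N2 : RtoC 2 <> RtoC 0).
  { intros E. apply (f_equal Re) in E. simpl in E. lra. }
  set (om := lam t - kappa * r t) in *.
  set (e := (RtoC 2 * (steady_error t - RtoC om) / ((G t - RtoC (lam t)) * zs * RtoC (r t)) -
    ew * hb * RtoC om / (RtoC 2 * RtoC (r t) * base_point g t))%C).
  exists (/ (g t - RtoC (lam t)) * e)%C. split.
  - assert (DB : cderiv (base_point g) t
      (vel (g t) (lam t) - hb * RtoC (- / (2 * r t)))%C).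
    { unfold base_point. apply cderiv_minus; [apply Sg|].
      eapply cderiv_ext_val; [apply (cderiv_mult (fun _ => hb) (fun t => RtoC (r t)));
        [apply cderiv_const|apply cderiv_RtoC; apply derive_r; lra]|]. ring. }
    assert (DL := cderiv_clog _ _ _ DB ltac:(nra)).
    assert (DE : cderiv (fun s => ew * clog (base_point g s))%C t
      (ew * ((vel (g t) (lam t) - hb * RtoC (- / (2 * r t))) / base_point g t))%C).
    { eapply cderiv_ext_val; [apply (cderiv_mult (fun _ => ew) (fun s => clog (base_point g s)));
        [apply cderiv_const|exact DL]|]. ring. }
    assert (DX := cderiv_Cexp _ _ _ DE).
    eapply cderiv_ext_val.
    + exact (cderiv_mult _ _ _ _ _ (cderiv_difference lam g G t Sg SG) DX).
    + unfold spiral_coordinate. set (X := Cexp (ew * clog (base_point g t))%C).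
      assert (Er : RtoC (- / (2 * r t)) = (- (/ (RtoC 2 * RtoC (r t))))%C).
      { rewrite RtoC_opp, RtoC_inv, RtoC_mult by lra. reflexivity. }
      rewrite Er. unfold vel, e.
      (* Once all constants are expressed through [hb], the singular terms cancel
         because [ew hb zs = 4]. *)
      assert (Eew : ew = (RtoC 4 / (hb * zs))%C).
      { assert (Nhb : hb <> RtoC 0) by (apply neq0_im; unfold hb; simpl; lra).
        pose proof zs_neq0. rewrite <- ew_hb. field. auto. }
      assert (Nhb : hb <> RtoC 0) by (apply neq0_im; unfold hb; simpl; lra).
      pose proof zs_neq0 as Nzs.
      assert (Ehs : hs = (RtoC 4 / hb)%C) by (rewrite <- hs_hb; field; exact Nhb).
      assert (Ekap : RtoC kappa = (RtoC 4 / hb + hb)%C) by (rewrite <- Ehs; symmetry; apply hs_plus_hb).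
      assert (Ezs : zs = (- hb)%C).
      { rewrite <- hs_minus, <- hs_plus_hb. ring. }
      rewrite Eew. unfold steady_error, om. rewrite RtoC_minus, RtoC_mult, Ehs, Ekap, Ezs.
      unfold base_point in *. unfold X. clear DX DE DL DB HB Er Hom HE e om X Eew.
      field. auto.
  - rewrite Cmod_mult, Cmod_inv by exact Ng.
    assert (Lg : sqrt (c * (T - t)) <= Cmod (g t - RtoC (lam t))%C)
      by (apply chord_gap_lower; [exact Hg|lra]).
    assert (LG : sqrt c * r t <= Cmod (G t - RtoC (lam t))%C).
    { unfold r. rewrite <- sqrt_mult by lra. apply (chord_gap_lower G 1 t G_chord). lra. }
    assert (Hs : 0 < sqrt (c * (T - t))) by (apply sqrt_lt_R0; nra).
    assert (Hnu : 0 <= nu).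
    { pose proof (Cmod_ge_0 (steady_error t)). nra. }
    assert (B1 : Cmod (RtoC 2 * (steady_error t - RtoC om) /
       ((G t - RtoC (lam t)) * zs * RtoC (r t)))%C <= nu * (2 / sqrt c) / r t).
    { rewrite Cmod_div by (repeat apply Cmult_neq_0; auto using zs_neq0).
      rewrite !Cmod_mult, !Cmod_R, Cmod_zs, (Rabs_pos_eq 2), (Rabs_pos_eq (r t)) by lra.
      assert (Cmod (steady_error t - RtoC om)%C <= 2 * nu * r t).
      { unfold Cminus. eapply Rle_trans; [apply Cmod_triangle|]. rewrite Cmod_opp, Cmod_R. lra. }
      apply Rle_trans with (2 * (2 * nu * r t) * / (sqrt c * r t * 2 * r t)).
      - unfold Rdiv. apply Rmult_le_compat.
        + pose proof (Cmod_ge_0 (steady_error t - RtoC om)%C). lra.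
        + left. apply Rinv_0_lt_compat. apply Rmult_lt_0_compat; [|lra].
          apply Rmult_lt_0_compat; [nra|lra].
        + lra.
        + apply Rinv_le_contravar; [|].
          * apply Rmult_lt_0_compat; [|lra]. apply Rmult_lt_0_compat; [nra|lra].
          * apply Rmult_le_compat_r; [lra|]. apply Rmult_le_compat_r; lra.
      - right. field. lra. }
    assert (B2 : Cmod (ew * hb * RtoC om / (RtoC 2 * RtoC (r t) * base_point g t))%C
      <= nu * (1 / (2 * co)) / r t).
    { rewrite Cmod_div by (repeat apply Cmult_neq_0; auto).
      rewrite !Cmod_mult, !Cmod_R, Cmod_ew, Cmod_hb, (Rabs_pos_eq 2), (Rabs_pos_eq (r t)) by lra.
      assert (LB : 2 * co * r t <= Cmod (base_point g t)).
      { eapply Rle_trans; [exact HB|]. eapply Rle_trans; [|apply Im_le_Cmod]. apply Rle_abs. }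
      assert (Hcr : 0 < 2 * co * r t) by nra.
      apply Rle_trans with (1 * 2 * (nu * r t) * / (2 * r t * (2 * co * r t))).
      - unfold Rdiv. apply Rmult_le_compat.
        + pose proof (Rabs_pos om). lra.
        + left. apply Rinv_0_lt_compat. apply Rmult_lt_0_compat; lra.
        + lra.
        + apply Rinv_le_contravar; [apply Rmult_lt_0_compat; lra|].
          apply Rmult_le_compat_l; lra.
      - right. field. lra. }
    assert (B3 : Cmod e <= nu * eta0 / r t).
    { unfold e, Cminus at 1. eapply Rle_trans; [apply Cmod_triangle|]. rewrite Cmod_opp.
      replace (nu * eta0 / r t) with (nu * (2 / sqrt c) / r t + nu * (1 / (2 * co)) / r t)
        by (unfold eta0; field; lra). lra. }
    apply Rle_trans with (/ sqrt (c * (T - t)) * (nu * eta0 / r t)).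
    + apply Rmult_le_compat; [left; apply Rinv_0_lt_compat; lra|apply Cmod_ge_0| |exact B3].
      now apply Rinv_le_contravar.
    + right. field. lra.
Qed.

Lemma spiral_coordinate_end g T : 0 < T < 1 -> chord lam g T 0 ->
  climit (spiral_coordinate g) T (spiral_end T).
Proof.
  intros HT Hg. pose proof co_pos as Hco.
  assert (Hr : continuous r T) by (eapply continuous_of_derive; apply derive_r; lra).
  destruct Hg as [Hs [_ [HX HY]]]. rewrite left_limit_eps in HX, HY.
  assert (HG : forall e, 0 < e -> exists d, 0 < d /\ forall u, Rabs (u - T) < d ->
    Cmod (G u - G T)%C < e).
  { intros e He. destruct G_chord as [GS _]. destruct (GS T ltac:(lra)) as [[D1 D2] _].
    apply continuous_of_derive in D1. apply continuous_of_derive in D2.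
    destruct (continuous_eps _ _ D1 (e / 2) ltac:(lra)) as [d1 [Hd1 K1]].
    destruct (continuous_eps _ _ D2 (e / 2) ltac:(lra)) as [d2 [Hd2 K2']].
    exists (Rmin d1 d2). split; [now apply Rmin_glb_lt|]. intros u Hu.
    pose proof (Rmin_l d1 d2). pose proof (Rmin_r d1 d2).
    specialize (K1 u ltac:(lra)). specialize (K2' u ltac:(lra)).
    eapply Rle_lt_trans; [apply Cmod_le_abs|].
    change (Rabs (Re (G u) - Re (G T)) + Rabs (Im (G u) - Im (G T)) < e). lra. }
  assert (Hg : forall e, 0 < e -> exists d, 0 < d /\ forall u, T - d < u < T ->
    Cmod (g u - RtoC (lam T))%C < e).
  { intros e He. destruct (HX (e / 3) ltac:(lra)) as [d1 [Hd1 K1]].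
    destruct (HY (e / 3) ltac:(lra)) as [d2 [Hd2 K2']].
    destruct (continuous_eps _ _ (rd_cont _ _ _ _ driver T) (e / 3) ltac:(lra)) as [d3 [Hd3 K3]].
    exists (Rmin d1 (Rmin d2 d3)). split; [repeat apply Rmin_glb_lt; auto|]. intros u Hu.
    pose proof (Rmin_l d1 (Rmin d2 d3)). pose proof (Rmin_r d1 (Rmin d2 d3)).
    pose proof (Rmin_l d2 d3). pose proof (Rmin_r d2 d3).
    specialize (K1 u ltac:(lra)). specialize (K2' u ltac:(lra)).
    specialize (K3 u ltac:(rewrite Rabs_left; lra)). rewrite Rminus_0_r in *.
    eapply Rle_lt_trans; [apply Cmod_le_abs|].
    replace (Re (g u - RtoC (lam T))%C) with ((Re (g u) - lam u) + (lam u - lam T))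
      by (unfold Re; simpl; ring).
    replace (Im (g u - RtoC (lam T))%C) with (Im (g u)) by (unfold Im; simpl; ring).
    pose proof (Rabs_triang (Re (g u) - lam u) (lam u - lam T)). lra. }
  apply climit_mult.
  - intros e He. destruct (HG (e / 2) ltac:(lra)) as [d1 [Hd1 K1]].
    destruct (Hg (e / 2) ltac:(lra)) as [d2 [Hd2 K2']].
    exists (Rmin d1 d2). split; [now apply Rmin_glb_lt|]. intros u Hu.
    pose proof (Rmin_l d1 d2). pose proof (Rmin_r d1 d2).
    specialize (K1 u ltac:(rewrite Rabs_left; lra)). specialize (K2' u ltac:(lra)).
    replace (g u - G u - (RtoC (lam T) - G T))%C with ((g u - RtoC (lam T)) - (G u - G T))%C by ring.
    unfold Cminus at 1. eapply Rle_lt_trans; [apply Cmod_triangle|]. rewrite Cmod_opp. lra.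
  - apply climit_Cexp. apply climit_scal.
    pose proof (r_pos T ltac:(lra)) as HrT.
    apply climit_clog with (m := 2 * co * r T).
    + nra.
    + unfold hb, Im; simpl. lra.
    + exists T. split; [lra|]. intros u Hu.
      eapply Rle_trans; [|apply base_point_Im].
      * apply Rmult_le_compat_l; [lra|]. apply sqrt_le_1_alt. lra.
      * lra.
      * left. apply Hs. lra.
    + intros e He. destruct (Hg (e / 2) ltac:(lra)) as [d1 [Hd1 K1]].
      destruct (continuous_eps _ _ Hr (e / 4) ltac:(lra)) as [d2 [Hd2 K2']].
      exists (Rmin d1 d2). split; [now apply Rmin_glb_lt|]. intros u Hu.
      pose proof (Rmin_l d1 d2). pose proof (Rmin_r d1 d2).
      specialize (K1 u ltac:(lra)). specialize (K2' u ltac:(rewrite Rabs_left; lra)).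
      unfold base_point.
      replace (g u - hb * RtoC (r u) - (RtoC (lam T) - hb * RtoC (r T)))%C
        with ((g u - RtoC (lam T)) - hb * RtoC (r u - r T))%C by (rewrite RtoC_minus; ring).
      unfold Cminus at 1. eapply Rle_lt_trans; [apply Cmod_triangle|].
      rewrite Cmod_opp, Cmod_mult, Cmod_R, Cmod_hb. lra.
Qed.

Lemma spiral_coordinate_neq0 g T t : 0 < T < 1 -> chord lam g T 0 -> g 0 = gam T -> 0 <= t < T ->
  spiral_coordinate g t <> RtoC 0.
Proof.
  intros HT Hg H0 Ht. apply Cmult_neq_0; [|apply Cexp_neq0].
  now apply (gap_to_tip_neq0 g T).
Qed.

Lemma spiral_end_neq0 T : 0 <= T < 1 -> spiral_end T <> RtoC 0.
Proof.
  intros HT. apply Cmult_neq_0; [|apply Cexp_neq0]. apply neq0_im.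
  assert (0 < Im (G T)) by (apply G_chord; lra). unfold Im in *; simpl. lra.
Qed.

(** The logarithmic derivative is at most of order [nu / (r t sqrt (T - t))],
    which is integrable up to the end. *)
Lemma near_ratio g T t nu :
  0 < T < 1 -> chord lam g T 0 -> g 0 = gam T -> 0 <= t < T -> 0 <= nu ->
  (forall u, t <= u < T -> Rabs (lam u - kappa * r u) <= nu * r u /\
     Cmod (steady_error u) <= nu * r u) ->
  let x := nu * (2 * eta0 / sqrt c * sqrt ((1 - t) / (1 - T))) in
  near x (spiral_coordinate g t / spiral_end T)%C /\
  near x (spiral_end T / spiral_coordinate g t)%C.
Proof.
  intros HT Hg Hg0 Ht Hnu Hb x.
  pose proof c_range as Hc. pose proof co_pos as Hco. pose proof (r_pos T ltac:(lra)) as HrT.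
  assert (Hsc : 0 < sqrt c) by (apply sqrt_lt_R0; lra).
  assert (Heta0 : 0 < eta0).
  { unfold eta0. apply Rplus_lt_0_compat; apply Rdiv_lt_0_compat; lra. }
  set (k := 2 * nu * eta0 / (sqrt c * r T)).
  assert (Hk : 0 <= k).
  { unfold k. apply Rdiv_le_0_compat; [apply Rmult_le_pos; lra|nra]. }
  set (E u := - (k * sqrt (T - u))). set (dE u := k * / (2 * sqrt (T - u))).
  assert (HE : forall u, t <= u < T -> is_derive E u (dE u)).
  { intros u Hu. assert (0 < sqrt (T - u)) by (apply sqrt_lt_R0; lra).
    evar_last.
    exact (derive_opp _ _ _ (derive_mult _ _ _ _ _ (is_derive_const k u)
      (derive_sqrt _ _ _ (derive_rev T u) ltac:(lra)))).
    unfold dE, zero; simpl. field. lra. }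
  set (e u := match (excluded_middle_informative (t <= u < T)) with
    | left H => proj1_sig (constructive_indefinite_description _
        (spiral_coordinate_derivative g T u nu ltac:(lra) Hg ltac:(lra)
           (proj1 (Hb u H)) (proj2 (Hb u H))))
    | right _ => RtoC 0 end).
  assert (He : forall u, t <= u < T ->
    cderiv (spiral_coordinate g) u (e u * spiral_coordinate g u)%C /\
    Cmod (e u) <= nu * eta0 / (r u * sqrt (c * (T - u)))).
  { intros u Hu. unfold e. destruct excluded_middle_informative as [h|h]; [|tauto].
    now destruct constructive_indefinite_description. }
  clearbody e.
  assert (HeE : forall u, t <= u < T -> Cmod (e u) <= dE u).
  { intros u Hu. destruct (He u Hu) as [_ H]. eapply Rle_trans; [exact H|].
    assert (Hs : 0 < sqrt (T - u)) by (apply sqrt_lt_R0; lra).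
    assert (Hru : r T <= r u) by (apply sqrt_le_1_alt; lra).
    rewrite sqrt_mult by lra. unfold dE, k.
    replace (2 * nu * eta0 / (sqrt c * r T) * / (2 * sqrt (T - u)))
      with (nu * eta0 * / (r T * (sqrt c * sqrt (T - u)))) by (field; lra).
    unfold Rdiv. apply Rmult_le_compat_l; [apply Rmult_le_pos; lra|].
    assert (0 < sqrt c * sqrt (T - u)) by nra.
    apply Rinv_le_contravar; [nra|]. apply Rmult_le_compat_r; lra. }
  assert (Hx : forall b, t <= b < T -> E b - E t <= x).
  { intros b Hb'. unfold E. pose proof (sqrt_pos (T - b)).
    assert (k * sqrt (T - t) <= x); [|nra].
    unfold x, k. rewrite sqrt_div by lra. fold (r T).
    replace (nu * (2 * eta0 / sqrt c * (sqrt (1 - t) / r T)))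
      with (2 * nu * eta0 / (sqrt c * r T) * sqrt (1 - t)) by (field; lra).
    apply Rmult_le_compat_l; [exact Hk|]. apply sqrt_le_1_alt. lra. }
  assert (Hfor : forall b, t <= b < T ->
    Cmod (spiral_coordinate g b - spiral_coordinate g t)%C <=
    Cmod (spiral_coordinate g t) * (exp x - 1) /\
    Cmod (spiral_coordinate g b - spiral_coordinate g t)%C <=
    Cmod (spiral_coordinate g b) * (exp x - 1)).
  { intros b Hb'. pose proof (exp_monotone _ _ (Hx b Hb')) as Hex. split.
    - eapply Rle_trans; [apply (log_derivative_bound _ e E dE t b)|].
      + lra.
      + intros u Hu. apply He. lra.
      + intros u Hu. apply HE. lra.
      + intros u Hu. apply HeE. lra.
      + apply Rmult_le_compat_l; [apply Cmod_ge_0|lra].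
    - rewrite Cmod_sym. eapply Rle_trans; [apply (log_derivative_bound_rev _ e E dE t b)|].
      + lra.
      + intros u Hu. apply He. lra.
      + intros u Hu. apply HE. lra.
      + intros u Hu. apply HeE. lra.
      + apply Rmult_le_compat_l; [apply Cmod_ge_0|lra]. }
  assert (Hx0 : 0 <= exp x - 1).
  { pose proof (Hx t ltac:(lra)) as H0. rewrite Rminus_diag in H0.
    apply exp_monotone in H0. rewrite exp_0 in H0. lra. }
  pose proof (spiral_coordinate_end g T HT Hg) as Hlim.
  split.
  - apply near_of_quotient; [apply spiral_end_neq0; lra|]. rewrite Cmod_sym.
    rewrite <- (Rplus_0_r (Cmod (spiral_end T) * (exp x - 1))).
    apply (climit_le (spiral_coordinate g) T); [exact Hx0| |exact Hlim].
    exists (T - t). split; [lra|]. intros u Hu. rewrite Rplus_0_r. apply Hfor. lra.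
  - apply near_of_quotient; [now apply (spiral_coordinate_neq0 g T)|].
    replace (Cmod (spiral_coordinate g t) * (exp x - 1))
      with (Cmod (spiral_end T) * 0 + Cmod (spiral_coordinate g t) * (exp x - 1)) by ring.
    apply (climit_le (spiral_coordinate g) T); [lra| |exact Hlim].
    exists (T - t). split; [lra|]. intros u Hu. rewrite Rmult_0_r, Rplus_0_l. apply Hfor. lra.
Qed.

(** At its end time a chord differs from the tip trajectory by [r T] times a
    quantity close to [- zs], so up to a factor close to 1 only the powers of
    [r T] contribute to the quotient. *)
Lemma spiral_end_ratio T1 T2 v nu :
  0 < T1 -> T1 < 1 -> 0 <= v -> 1 - T2 = exp (- v) * (1 - T1) ->
  (forall T, T = T1 \/ T = T2 -> Rabs (lam T - kappa * r T) <= nu * r T /\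
     Cmod (steady_error T) <= nu * r T) ->
  exists N, (spiral_end T2 / spiral_end T1 = Cexp (RtoC (- v / 2) * (RtoC 1 + ew)) * N)%C /\
    near (nu * (4 / sqrt c + 2 / co)) N.
Proof.
  intros HT1 HT1' Hv HT2 Hb.
  pose proof c_range as Hc. pose proof co_pos as Hco.
  assert (Hsc : 0 < sqrt c) by (apply sqrt_lt_R0; lra).
  assert (Hev : 0 < exp (- v) <= 1).
  { split; [apply exp_pos|]. rewrite <- exp_0. apply exp_monotone. lra. }
  assert (HT2r : 0 < T2 < 1) by nra.
  pose proof (r_pos T1 HT1') as Hr1. pose proof (r_pos T2 ltac:(lra)) as Hr2.
  set (h T := ((RtoC (lam T) - G T) / RtoC (r T))%C).
  set (m T := (RtoC (lam T / r T) - hb)%C).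
  assert (Nr : forall T, T < 1 -> RtoC (r T) <> RtoC 0).
  { intros T HT E. apply (f_equal Re) in E. simpl in E. pose proof (r_pos T HT). lra. }
  assert (Hend : forall T, 0 < T < 1 ->
    spiral_end T = (Cexp (RtoC (ln (r T)) * (RtoC 1 + ew)) * h T * Cexp (ew * clog (m T)))%C).
  { intros T HT. pose proof (r_pos T ltac:(lra)) as HrT. unfold spiral_end.
    replace (RtoC (lam T) - hb * RtoC (r T))%C with (RtoC (r T) * m T)%C.
    - rewrite clog_scale by (auto; unfold m, hb, Im; simpl; lra).
      replace (ew * (RtoC (ln (r T)) + clog (m T)))%C
        with (ew * RtoC (ln (r T)) + ew * clog (m T))%C by ring.
      replace (RtoC (ln (r T)) * (RtoC 1 + ew))%C
        with (RtoC (ln (r T)) + ew * RtoC (ln (r T)))%C by ring.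
      rewrite !Cexp_plus, Cexp_RtoC, exp_ln by exact HrT.
      unfold h. field. apply Nr. lra.
    - unfold m. rewrite RtoC_div by lra. field. apply Nr. lra. }
  assert (Hln : ln (r T2) = ln (r T1) + - v / 2).
  { assert (Hr : r T2 = r T1 * exp (- v / 2)).
    { unfold r. rewrite HT2.
      replace (exp (- v)) with (exp (- v / 2) * exp (- v / 2))
        by (rewrite <- exp_plus; f_equal; field).
      pose proof (exp_pos (- v / 2)).
      rewrite sqrt_mult by nra. rewrite sqrt_square by lra. ring. }
    rewrite Hr, ln_mult, ln_exp by (auto; apply exp_pos). reflexivity. }
  assert (Hh : forall T, T = T1 \/ T = T2 -> h T <> RtoC 0 /\ sqrt c <= Cmod (h T) /\
     h T = (- zs - (steady_error T - RtoC (lam T - kappa * r T)) / RtoC (r T))%C).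
  { intros T HT. assert (HT' : 0 < T < 1) by (destruct HT; subst; lra).
    pose proof (r_pos T ltac:(lra)) as HrT. pose proof (Nr T ltac:(lra)) as NrT.
    assert (Hlow : sqrt c <= Cmod (h T)).
    { unfold h. rewrite Cmod_div, Cmod_R, Rabs_pos_eq by (lra || exact NrT).
      rewrite Cmod_sym. apply Rmult_le_reg_r with (r T); [exact HrT|].
      unfold Rdiv. rewrite Rmult_assoc, Rinv_l, Rmult_1_r by lra.
      unfold r. rewrite <- sqrt_mult by lra. apply (chord_gap_lower G 1 T G_chord). lra. }
    split; [|split; [exact Hlow|]].
    - intros E. rewrite E, Cmod_0 in Hlow. lra.
    - unfold h, steady_error. rewrite <- hs_minus, RtoC_minus, RtoC_mult. field. exact NrT. }
  destruct (Hh T1 (or_introl eq_refl)) as [Nh1 [Lh1 Eh1]].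
  destruct (Hh T2 (or_intror eq_refl)) as [Nh2 [Lh2 Eh2]].
  exists (h T2 / h T1 * Cexp (ew * (clog (m T2) - clog (m T1))))%C. split.
  - rewrite (Hend T1), (Hend T2) by lra. rewrite Hln.
    replace (RtoC (ln (r T1) + - v / 2) * (RtoC 1 + ew))%C
      with (RtoC (ln (r T1)) * (RtoC 1 + ew) + RtoC (- v / 2) * (RtoC 1 + ew))%C
      by (rewrite RtoC_plus; ring).
    rewrite Cexp_plus.
    replace (Cexp (ew * clog (m T2)))%C
      with (Cexp (ew * (clog (m T2) - clog (m T1))) * Cexp (ew * clog (m T1)))%C
      by (rewrite <- Cexp_plus; f_equal; ring).
    field. split; [exact Nh1|]. split; apply Cexp_neq0.
  - replace (nu * (4 / sqrt c + 2 / co)) with (nu * 4 / sqrt c + nu * 2 / co) by (field; lra).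
    assert (Hdev : forall T, T = T1 \/ T = T2 ->
      Cmod ((steady_error T - RtoC (lam T - kappa * r T)) / RtoC (r T))%C <= 2 * nu).
    { intros T HT. assert (HT' : 0 < T < 1) by (destruct HT; subst; lra).
      pose proof (r_pos T ltac:(lra)) as HrT. destruct (Hb T HT) as [B1 B2].
      rewrite Cmod_div, Cmod_R, (Rabs_pos_eq (r T)) by (lra || (apply Nr; lra)).
      apply Rmult_le_reg_r with (r T); [exact HrT|].
      unfold Rdiv. rewrite Rmult_assoc, Rinv_l, Rmult_1_r by lra.
      unfold Cminus. eapply Rle_trans; [apply Cmod_triangle|]. rewrite Cmod_opp, Cmod_R. lra. }
    apply near_mult.
    + apply near_of_dist.
      replace (h T2 / h T1 - RtoC 1)%C with ((h T2 - h T1) / h T1)%C by (field; exact Nh1).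
      rewrite Cmod_div by exact Nh1.
      assert (Hd : Cmod (h T2 - h T1)%C <= nu * 4).
      { rewrite Eh1, Eh2.
        pose proof (Hdev T1 (or_introl eq_refl)) as V1. pose proof (Hdev T2 (or_intror eq_refl)) as V2.
        set (d1 := ((steady_error T1 - RtoC (lam T1 - kappa * r T1)) / RtoC (r T1))%C) in *.
        set (d2 := ((steady_error T2 - RtoC (lam T2 - kappa * r T2)) / RtoC (r T2))%C) in *.
        replace (- zs - d2 - (- zs - d1))%C with (d1 + - d2)%C by ring.
        eapply Rle_trans; [apply Cmod_triangle|]. rewrite Cmod_opp. lra. }
      unfold Rdiv. apply Rmult_le_compat; [apply Cmod_ge_0|left; apply Rinv_0_lt_compat; lra|exact Hd|].
      apply Rinv_le_contravar; lra.
    + eapply near_monotone; [|apply near_Cexp].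
      rewrite Cmod_mult, Cmod_ew, Rmult_1_l.
      eapply Rle_trans; [apply (clog_lipschitz _ _ (2 * co)); unfold m, hb, Im; simpl; lra|].
      assert (Hm : Cmod (m T2 - m T1)%C <= 2 * nu).
      { unfold m. replace (RtoC (lam T2 / r T2) - hb - (RtoC (lam T1 / r T1) - hb))%C
          with (RtoC (lam T2 / r T2 - lam T1 / r T1)) by (rewrite RtoC_minus; ring).
        rewrite Cmod_R.
        assert (Hq : forall T, T = T1 \/ T = T2 -> Rabs (lam T / r T - kappa) <= nu).
        { intros T HT. assert (HT' : 0 < T < 1) by (destruct HT; subst; lra).
          pose proof (r_pos T ltac:(lra)) as HrT. destruct (Hb T HT) as [B1 _].
          replace (lam T / r T - kappa) with ((lam T - kappa * r T) / r T) by (field; lra).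
          unfold Rdiv. rewrite Rabs_mult, (Rabs_pos_eq (/ r T)) by (left; now apply Rinv_0_lt_compat).
          apply Rmult_le_reg_r with (r T); [exact HrT|].
          rewrite Rmult_assoc, Rinv_l, Rmult_1_r by lra. exact B1. }
        pose proof (Hq T1 (or_introl eq_refl)) as Q1. pose proof (Hq T2 (or_intror eq_refl)) as Q2.
        apply Rabs_le_between in Q1. apply Rabs_le_between in Q2. apply Rabs_le_between. lra. }
      apply Rle_trans with (2 / (2 * co) * (2 * nu)).
      * apply Rmult_le_compat_l; [left; apply Rdiv_lt_0_compat; lra|exact Hm].
      * right. field. lra.
Qed.

Lemma log_spiral_exponent v :
  Cexp (RtoC (- v / 2) * (RtoC 1 + ew))%C = log_spiral spiral_angle (- (v * co)).
Proof.
  unfold log_spiral. f_equal. pose proof co_si as Hcs.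
  assert (E : Cexp (Ci * RtoC spiral_angle)%C = (co, si)).
  { unfold Cexp. replace (Re (Ci * RtoC spiral_angle)%C) with 0 by (unfold Re; simpl; ring).
    replace (Im (Ci * RtoC spiral_angle)%C) with spiral_angle by (unfold Im; simpl; ring).
    rewrite exp_0, !Rmult_1_l. reflexivity. }
  rewrite E. apply C_ext; unfold ew, Re, Im; simpl.
  - assert (1 + (co * (co * 1) - si * (si * 1)) = 2 * (co * co)) by lra.
    rewrite H. field.
  - field.
Qed.

Definition rescaled (s v : R) : C :=
  ((gam (1 - exp (- (s + v)))%R - gam 1%R) / (gam (1 - exp (- s))%R - gam 1%R))%C.

(** The far estimate is used up to the time [t] with [1 - t = W (1 - T1)], the
    near one from there to the ends. [W] is fixed before [nu], because the
    near error grows with [W]. *)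
Lemma rescaled_limit u e : 0 < u -> 0 < e -> exists s0, forall s v, s0 <= s -> 0 <= v <= u ->
  Cmod (rescaled s v - log_spiral spiral_angle (- (v * co)))%C <= e.
Proof.
  intros Hu He.
  pose proof c_range as Hc. pose proof co_pos as Hco. pose proof p_pos as Hp.
  pose proof sqrt_Kh_pos as HKh.
  assert (Hsc : 0 < sqrt c) by (apply sqrt_lt_R0; lra).
  assert (Hsc2 : 0 < sqrt (c / 2) ^ 3) by (apply pow_lt, sqrt_lt_R0; lra).
  assert (HK2 : 0 < K2) by (unfold K2; apply Rdiv_lt_0_compat; lra).
  assert (Heta0 : 0 < eta0).
  { unfold eta0. apply Rplus_lt_0_compat; apply Rdiv_lt_0_compat; lra. }
  set (d := ln (1 + e)).
  assert (Hd : 0 < d) by (unfold d; rewrite <- ln_1; apply ln_increasing; lra).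
  set (A1 := K2 / p + 2 * sqrt Kh / co).
  assert (HA1 : 0 < A1) by (unfold A1; apply Rplus_lt_0_compat; apply Rdiv_lt_0_compat; lra).
  set (n := Rmax (ln 2) (- ln (d / (2 * A1)) / p)).
  set (W := exp n).
  assert (HW : 2 <= W).
  { unfold W. rewrite <- (exp_ln 2) by lra. apply exp_monotone. apply Rmax_l. }
  assert (HWp : A1 * exp (- p * ln W) <= d / 2).
  { unfold W. rewrite ln_exp.
    assert (Hq : 0 < d / (2 * A1)) by (apply Rdiv_lt_0_compat; lra).
    assert (Hn : - p * n <= ln (d / (2 * A1))).
    { assert (- ln (d / (2 * A1)) / p <= n) by apply Rmax_r.
      assert (p * (- ln (d / (2 * A1)) / p) <= p * n) by (apply Rmult_le_compat_l; lra).
      replace (p * (- ln (d / (2 * A1)) / p)) with (- ln (d / (2 * A1))) in H0 by (field; lra).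
      lra. }
    apply exp_monotone in Hn. rewrite exp_ln in Hn by exact Hq.
    apply Rle_trans with (A1 * (d / (2 * A1))); [apply Rmult_le_compat_l; lra|].
    right. field. lra. }
  set (A2 := 2 * (2 * eta0 / sqrt c * sqrt (W * exp u)) + (4 / sqrt c + 2 / co)).
  assert (HA2 : 0 < A2).
  { unfold A2. pose proof (sqrt_pos (W * exp u)).
    assert (0 < 2 * eta0 / sqrt c) by (apply Rdiv_lt_0_compat; lra).
    assert (0 < 4 / sqrt c) by (apply Rdiv_lt_0_compat; lra).
    assert (0 < 2 / co) by (apply Rdiv_lt_0_compat; lra). nra. }
  set (nu := d / (2 * A2)).
  assert (Hnu : 0 < nu) by (unfold nu; apply Rdiv_lt_0_compat; lra).
  destruct (lam_near nu Hnu) as [ta [Hta Ha]].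
  destruct (tip_is_steady nu Hnu) as [tb [Htb Hb]].
  set (t0 := Rmax ta tb).
  assert (Ht0 : 0 <= t0 < 1).
  { unfold t0. split; [eapply Rle_trans; [|apply Rmax_l]; lra|apply Rmax_lub_lt; lra]. }
  assert (Hnear0 : forall t, t0 <= t < 1 -> Rabs (lam t - kappa * r t) <= nu * r t /\
     Cmod (steady_error t) <= nu * r t).
  { intros t Ht. pose proof (Rmax_l ta tb). pose proof (Rmax_r ta tb). fold t0 in H, H0.
    split; [apply Ha; lra|apply Hb; lra]. }
  exists (n - ln (1 - t0)). intros s v Hs Hv.
  set (T1 := 1 - exp (- s)). set (T2 := 1 - exp (- (s + v))).
  set (t := 1 - W * exp (- s)).
  assert (HWs : W * exp (- s) <= 1 - t0).
  { unfold W. rewrite <- exp_plus. rewrite <- (exp_ln (1 - t0)) by lra.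
    apply exp_monotone. lra. }
  pose proof (exp_pos (- s)) as Hes.
  assert (Hev : 0 < exp (- v) <= 1).
  { split; [apply exp_pos|]. rewrite <- exp_0. apply exp_monotone. lra. }
  assert (HT12 : 1 - T2 = exp (- v) * (1 - T1)).
  { unfold T1, T2. replace (- (s + v)) with (- v + - s) by ring. rewrite exp_plus. ring. }
  assert (HT1 : t0 <= t < T1 /\ T1 <= T2 < 1).
  { assert (1 - T1 = exp (- s)) by (unfold T1; ring).
    assert (1 - t = W * exp (- s)) by (unfold t; ring). nra. }
  destruct (gam_tip T1 ltac:(lra)) as [g1 [C1 S1]].
  destruct (gam_tip T2 ltac:(lra)) as [g2 [C2 S2]].
  assert (HtW : 1 - t = W * (1 - T1)) by (unfold t, T1; ring).
  pose proof (far_ratio g1 g2 T1 T2 t W ltac:(lra) ltac:(lra) C1 C2 S1 S2 ltac:(lra) HW HtW) as Nfar.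
  destruct (near_ratio g1 T1 t nu) as [_ N1]; auto; try lra.
  { intros w Hw. apply Hnear0. lra. }
  destruct (near_ratio g2 T2 t nu) as [N2 _]; auto; try lra.
  { intros w Hw. apply Hnear0. lra. }
  destruct (spiral_end_ratio T1 T2 v nu) as [N [EN N3]]; auto; try lra.
  { intros T [HT|HT]; subst T; apply Hnear0; lra. }
  set (B1 := base_point g1 t). set (B2 := base_point g2 t).
  pose proof (r_pos t ltac:(lra)) as Hr.
  assert (N4 : near (2 * sqrt Kh / co * exp (- p * ln W)) (Cexp (ew * (clog B1 - clog B2)))%C).
  { eapply near_monotone; [|apply near_Cexp]. rewrite Cmod_mult, Cmod_ew, Rmult_1_l.
    eapply Rle_trans; [apply (clog_lipschitz _ _ (2 * co * r t))|].
    - nra.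
    - apply base_point_Im; [lra|]. left. apply C1. lra.
    - apply base_point_Im; [lra|]. left. apply C2. lra.
    - assert (Hdiff : Cmod (B1 - B2)%C <= 2 * (sqrt Kh * (r t * exp (- p * ln W)))).
      { unfold B1, B2, base_point.
        replace (g1 t - hb * RtoC (r t) - (g2 t - hb * RtoC (r t)))%C
          with ((g1 t - G t) + - (g2 t - G t))%C by ring.
        eapply Rle_trans; [apply Cmod_triangle|]. rewrite Cmod_opp.
        assert (L1 : ln (1 - t) - ln (1 - T1) = ln W) by (rewrite HtW, ln_mult by lra; ring).
        pose proof (gap_to_tip_le g1 T1 t ltac:(lra) C1 ltac:(lra)) as D1. rewrite L1 in D1.
        pose proof (gap_to_tip_le g2 T2 t ltac:(lra) C2 ltac:(lra)) as D2.
        assert (D3 : sqrt Kh * (r t * exp (- p * (ln (1 - t) - ln (1 - T2)))) <=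
                     sqrt Kh * (r t * exp (- p * ln W))).
        { apply Rmult_le_compat_l; [lra|]. apply Rmult_le_compat_l; [lra|].
          apply exp_monotone. rewrite <- L1.
          assert (ln (1 - T2) <= ln (1 - T1)) by (apply ln_le; lra). nra. }
        lra. }
      apply Rle_trans with (2 / (2 * co * r t) * (2 * (sqrt Kh * (r t * exp (- p * ln W))))).
      + apply Rmult_le_compat_l; [left; apply Rdiv_lt_0_compat; nra|exact Hdiff].
      + right. field. lra. }
  assert (Hsq : sqrt ((1 - t) / (1 - T1)) <= sqrt (W * exp u) /\
                sqrt ((1 - t) / (1 - T2)) <= sqrt (W * exp u)).
  { assert (E1 : 1 <= exp u) by (rewrite <- exp_0; apply exp_monotone; lra).
    rewrite HT12, HtW.
    replace (W * (1 - T1) / (1 - T1)) with W by (field; lra).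
    replace (W * (1 - T1) / (exp (- v) * (1 - T1))) with (W * / exp (- v)) by (field; lra).
    rewrite <- exp_Ropp, Ropp_involutive.
    assert (exp v <= exp u) by (apply exp_monotone; lra).
    split; apply sqrt_le_1_alt; nra. }
  set (far := ((g2 0%R - G 0%R) / (g1 0%R - G 0%R) / ((g2 t - G t) / (g1 t - G t)))%C) in *.
  set (P := (far * (spiral_coordinate g2 t / spiral_end T2 *
     (spiral_end T1 / spiral_coordinate g1 t * (N * Cexp (ew * (clog B1 - clog B2))))))%C).
  assert (HP : near d P).
  { eapply near_monotone; [|exact (near_mult _ _ _ _ Nfar (near_mult _ _ _ _ N2
      (near_mult _ _ _ _ N1 (near_mult _ _ _ _ N3 N4))))].
    assert (E1 : K2 / p * exp (- p * ln W) + 2 * sqrt Kh / co * exp (- p * ln W) <= d / 2)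
      by (unfold A1 in HWp; lra).
    assert (E2 : nu * A2 = d / 2) by (unfold nu; field; lra).
    assert (Hk : 0 <= nu * (2 * eta0 / sqrt c)).
    { apply Rmult_le_pos; [lra|]. apply Rdiv_le_0_compat; lra. }
    destruct Hsq as [Q1 Q2].
    apply (Rmult_le_compat_l _ _ _ Hk) in Q1. apply (Rmult_le_compat_l _ _ _ Hk) in Q2.
    unfold A2 in E2. lra. }
  assert (NV1 : spiral_coordinate g1 t <> RtoC 0) by (apply (spiral_coordinate_neq0 g1 T1); auto; lra).
  assert (NV2 : spiral_coordinate g2 t <> RtoC 0) by (apply (spiral_coordinate_neq0 g2 T2); auto; lra).
  assert (NE1 : spiral_end T1 <> RtoC 0) by (apply spiral_end_neq0; lra).
  assert (NE2 : spiral_end T2 <> RtoC 0) by (apply spiral_end_neq0; lra).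
  assert (ND1 : (g1 t - G t)%C <> RtoC 0) by (apply (gap_to_tip_neq0 g1 T1); auto; lra).
  assert (ND2 : (g2 t - G t)%C <> RtoC 0) by (apply (gap_to_tip_neq0 g2 T2); auto; lra).
  assert (ND10 : (g1 0%R - G 0%R)%C <> RtoC 0) by (apply (gap_to_tip_neq0 g1 T1); auto; lra).
  assert (Hratio : rescaled s v = (log_spiral spiral_angle (- (v * co)) * P)%C).
  { rewrite <- log_spiral_exponent. unfold rescaled. fold T1 T2. rewrite <- S1, <- S2, <- G_start.
    set (Xs := Cexp (RtoC (- v / 2) * (RtoC 1 + ew))%C) in *.
    assert (EV : ((g2 t - G t) / (g1 t - G t) = spiral_coordinate g2 t / spiral_coordinate g1 t *
       Cexp (ew * (clog B1 - clog B2)))%C).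
    { replace (Cexp (ew * (clog B1 - clog B2)))%C
        with (Cexp (ew * clog B1) / Cexp (ew * clog B2))%C.
      - unfold spiral_coordinate. fold B1 B2. field.
        repeat split; auto using Cexp_neq0.
      - replace (Cexp (ew * clog B1))%C with (Cexp (ew * (clog B1 - clog B2)) * Cexp (ew * clog B2))%C
          by (rewrite <- Cexp_plus; f_equal; ring).
        field. apply Cexp_neq0. }
    assert (EN' : (Xs * N)%C = (spiral_end T2 / spiral_end T1)%C) by (symmetry; exact EN).
    replace (Xs * P)%C with (far * (spiral_coordinate g2 t / spiral_end T2 *
     (spiral_end T1 / spiral_coordinate g1 t * ((Xs * N) * Cexp (ew * (clog B1 - clog B2))))))%C
      by (unfold P; ring).
    rewrite EN'.
    replace (spiral_coordinate g2 t / spiral_end T2 * (spiral_end T1 / spiral_coordinate g1 t *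
       (spiral_end T2 / spiral_end T1 * Cexp (ew * (clog B1 - clog B2)))))%C
      with (spiral_coordinate g2 t / spiral_coordinate g1 t * Cexp (ew * (clog B1 - clog B2)))%C
      by (field; auto).
    rewrite <- EV. unfold far. field. auto. }
  rewrite Hratio.
  replace (log_spiral spiral_angle (- (v * co)) * P - log_spiral spiral_angle (- (v * co)))%C
    with (log_spiral spiral_angle (- (v * co)) * (P - RtoC 1))%C by ring.
  rewrite Cmod_mult.
  assert (Hsp : Cmod (log_spiral spiral_angle (- (v * co))) <= 1).
  { rewrite <- log_spiral_exponent, Cmod_Cexp.
    apply Rle_trans with (exp 0); [apply exp_monotone|rewrite exp_0; lra].
    unfold ew, Re; simpl. pose proof co_si as Hcs.
    replace (co * (co * 1) - si * (si * 1)) with (2 * co ^ 2 - 1) by lra.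
    pose proof (pow2_ge_0 co). nra. }
  unfold near in HP. unfold d in HP. rewrite exp_ln in HP by lra.
  pose proof (Cmod_ge_0 (P - RtoC 1)%C). pose proof (Cmod_ge_0 (log_spiral spiral_angle (- (v * co)))).
  nra.
Qed.

Lemma tip_similar_to_spiral : asymptotically_similar_to_spiral gam spiral_angle.
Proof.
  unfold asymptotically_similar_to_spiral. cbv zeta. intros u Hu e He.
  pose proof co_pos as Hco.
  destruct (rescaled_limit u (e / 2) Hu ltac:(lra)) as [s0 Hs0].
  exists s0. intros s Hs. specialize (fun v => Hs0 s v ltac:(lra)).
  apply Rbar_le_lt_trans with (Finite (e / 2)); [|simpl; lra].
  unfold hausdorff_dist.
  match goal with |- Rbar_le (Glb_Rbar ?S) _ =>
    destruct (Glb_Rbar_correct S) as [Hlb _]; apply Hlb end.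
  split; [lra|]. split.
  - intros x [v [Hv ->]]. exists (log_spiral spiral_angle (- (v * co))). split.
    + exists (v * co). split; [|reflexivity]. fold co. nra.
    + now apply Hs0.
  - intros y [tau [Htau ->]]. fold co in Htau.
    assert (Hv : 0 <= tau / co <= u).
    { split; [apply Rdiv_le_0_compat; lra|]. apply Rmult_le_reg_r with co; [lra|].
      unfold Rdiv. rewrite Rmult_assoc, Rinv_l, Rmult_1_r by lra. lra. }
    exists (rescaled s (tau / co)). split.
    + exists (tau / co). split; [exact Hv|reflexivity].
    + replace tau with (tau / co * co) at 2 by (field; lra). now apply Hs0.
Qed.

End Spiral.
End Trace.
End Driver.

(** * The driving function up to the terminal time *)

Lemma sqrt_minus_le a b : 0 <= b <= a -> sqrt a - sqrt b <= sqrt (a - b).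
Proof.
  intros H. pose proof (sqrt_pos a). pose proof (sqrt_pos b). pose proof (sqrt_pos (a - b)).
  assert (Ea : sqrt a ^ 2 = a) by (apply pow2_sqrt; lra).
  assert (Eb : sqrt b ^ 2 = b) by (apply pow2_sqrt; lra).
  assert (Ec : sqrt (a - b) ^ 2 = a - b) by (apply pow2_sqrt; lra).
  apply Rnot_lt_le. intros Hlt. nra.
Qed.

Lemma loewner_hull_ext l1 l2 t z :
  t <= 1 -> (forall s, 0 <= s < 1 -> l1 s = l2 s) ->
  loewner_hull l1 t z -> loewner_hull l2 t z.
Proof.
  intros Ht E [Hz [T [g [HT [[H0 Hg] Hlim]]]]].
  split; [exact Hz|]. exists T, g. split; [exact HT|]. split.
  - split; [exact H0|]. intros s Hs. rewrite <- E by lra. now apply Hg.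
  - rewrite left_limit_eps in *. intros e He. destruct (Hlim e He) as [d [Hd Hu]].
    exists (Rmin d T). split; [apply Rmin_glb_lt; lra|]. intros u Hu'.
    pose proof (Rmin_l d T). pose proof (Rmin_r d T).
    rewrite <- E by lra. apply Hu. lra.
Qed.

Lemma is_trace_ext l1 l2 gam :
  (forall s, 0 <= s < 1 -> l1 s = l2 s) -> is_trace l1 gam -> is_trace l2 gam.
Proof.
  intros E [Hc [Hi Hcomp]]. split; [exact Hc|]. split; [exact Hi|].
  intros t Ht. destruct (Hcomp t Ht) as [[[z Hz] [Hin [Hconn Hmax]]] Hub].
  assert (Eq : forall z, loewner_hull l1 t z <-> loewner_hull l2 t z).
  { intros w. split; apply loewner_hull_ext; try lra; auto. intros; symmetry; auto. }
  cbv zeta. split; [split; [|split; [|split]]|].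
  - exists z. now rewrite <- Eq.
  - intros w Hw. apply Hin. now rewrite Eq.
  - intros U V HU HV Hcov [a [Ha HUa]] [b [Hb HVb]].
    destruct (Hconn U V HU HV) as [x [Hx HUV]].
    + intros w Hw. apply Hcov. now rewrite <- Eq.
    + exists a. now rewrite Eq.
    + exists b. now rewrite Eq.
    + exists x. now rewrite <- Eq.
  - intros B HB HBS HUB w Hw. rewrite <- Eq. apply (Hmax B HB HBS); [|exact Hw].
    intros v Hv. apply HUB. now rewrite <- Eq.
  - intros [B HB]. apply Hub. exists B. intros w Hw. apply HB. now rewrite <- Eq.
Qed.

Section Reduction.
Variables (lambda : R -> R) (kappa C0 : R).
Hypothesis hcont : continuous_on (fun t => 0 <= t <= 1) lambda.
Hypothesis hlim : filterlim (fun t => lambda t / sqrt (1 - t)) (at_left 1) (locally kappa).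
Hypothesis hkappa : Rabs kappa < 4.
Hypothesis hC0 : C0 < 4.
Hypothesis hlip : local_lip_half_lt lambda C0.

Definition clamped (t : R) : R := lambda (Rmax 0 (Rmin t 1)).

Lemma clamped_eq t : 0 <= t <= 1 -> clamped t = lambda t.
Proof. intros H. unfold clamped. now rewrite clamp_id. Qed.

Lemma near_end e : 0 < e -> exists t0, 0 <= t0 < 1 /\ forall t, t0 <= t < 1 ->
  Rabs (lambda t - kappa * sqrt (1 - t)) <= e * sqrt (1 - t).
Proof.
  intros He. rewrite left_limit_eps in hlim. destruct (hlim e He) as [d [Hd Hu]].
  exists (Rmax 0 (1 - d / 2)). split; [split; [apply Rmax_l|apply Rmax_lub_lt; lra]|].
  intros t Ht. pose proof (Rmax_l 0 (1 - d / 2)). pose proof (Rmax_r 0 (1 - d / 2)).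
  specialize (Hu t ltac:(lra)).
  assert (Hs : 0 < sqrt (1 - t)) by (apply sqrt_lt_R0; lra).
  replace (lambda t - kappa * sqrt (1 - t)) with ((lambda t / sqrt (1 - t) - kappa) * sqrt (1 - t))
    by (field; lra).
  rewrite Rabs_mult, (Rabs_pos_eq (sqrt (1 - t))) by lra.
  apply Rmult_le_compat_r; lra.
Qed.

Lemma lambda_end : lambda 1 = 0.
Proof.
  apply NNPP. intros Hn. apply Rabs_pos_lt in Hn.
  destruct (near_end 1 ltac:(lra)) as [t0 [Ht0 H]].
  assert (Hh : 0 < Rabs (lambda 1) / 2) by lra.
  destruct (proj1 (filterlim_locally _ _) (hcont 1 (conj Rle_0_1 (Rle_refl 1))) (mkposreal _ Hh)) as [d Hd].
  set (k := Rabs (lambda 1) / 2 / 5).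
  assert (Hk : 0 < k) by (unfold k; lra).
  set (t := Rmax t0 (Rmax (1 - d / 2) (1 - k ^ 2))).
  pose proof (cond_pos d) as Hd0.
  assert (Ht : t0 <= t < 1 /\ 1 - d / 2 <= t /\ 1 - k ^ 2 <= t).
  { unfold t. pose proof (Rmax_l t0 (Rmax (1 - d / 2) (1 - k ^ 2))).
    pose proof (Rmax_r t0 (Rmax (1 - d / 2) (1 - k ^ 2))).
    pose proof (Rmax_l (1 - d / 2) (1 - k ^ 2)). pose proof (Rmax_r (1 - d / 2) (1 - k ^ 2)).
    split; [split; [lra|]|lra]. repeat apply Rmax_lub_lt; try lra. nra. }
  specialize (H t ltac:(lra)).
  assert (Hb : Rabs (lambda t - lambda 1) < Rabs (lambda 1) / 2).
  { apply (Hd t); [|lra]. change (Rabs (t - 1) < d). rewrite Rabs_left; lra. }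
  assert (Hs : sqrt (1 - t) <= k).
  { rewrite <- (sqrt_pow2 k) by lra. apply sqrt_le_1_alt. lra. }
  pose proof (sqrt_pos (1 - t)).
  assert (Ht5 : Rabs (lambda t) <= 5 * sqrt (1 - t)).
  { replace (lambda t) with ((lambda t - kappa * sqrt (1 - t)) + kappa * sqrt (1 - t)) by ring.
    eapply Rle_trans; [apply Rabs_triang|]. rewrite Rabs_mult, (Rabs_pos_eq (sqrt (1 - t))) by lra.
    nra. }
  assert (Rabs (lambda 1) <= Rabs (lambda t) + Rabs (lambda t - lambda 1)).
  { replace (lambda 1) with (lambda t + - (lambda t - lambda 1)) at 1 by ring.
    eapply Rle_trans; [apply Rabs_triang|]. rewrite Rabs_Ropp. lra. }
  unfold k in Hs. lra.
Qed.

(** Away from the end the local condition is uniform.  Near the end, pairs too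
    far apart for the local condition are handled by the comparison with
    [kappa sqrt (1 - t)], whose Lip-1/2 norm is [|kappa|]. *)
Lemma clamped_driver : exists c eta M, regular_driver clamped c eta M.
Proof.
  destruct hlip as [c' [Hc' [delta0 [Hdelta0 Hloc]]]].
  set (delta := Rmin delta0 1).
  assert (Hdelta : 0 < delta <= 1 /\ delta <= delta0).
  { unfold delta. split; [split; [apply Rmin_glb_lt; lra|apply Rmin_r]|apply Rmin_l]. }
  set (c := (Rmax c' (Rabs kappa) + 4) / 2).
  assert (Hc : Rabs kappa < c < 4 /\ c' < c).
  { unfold c. pose proof (Rmax_l c' (Rabs kappa)). pose proof (Rmax_r c' (Rabs kappa)).
    assert (Rmax c' (Rabs kappa) < 4) by (apply Rmax_lub_lt; lra). lra. }
  pose proof (Rabs_pos kappa) as Hk0.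
  assert (Hsd : 0 < sqrt delta) by (apply sqrt_lt_R0; lra).
  set (nu := (c - Rabs kappa) * sqrt delta / 2).
  assert (Hnu : 0 < nu) by (unfold nu; apply Rdiv_lt_0_compat; [apply Rmult_lt_0_compat|]; lra).
  destruct (near_end nu Hnu) as [t0 [Ht0 Hend]].
  set (eta := delta * (1 - t0)).
  assert (Heta : 0 < eta <= 1 - t0) by (unfold eta; nra).
  assert (Hlt : forall t t', 0 <= t -> t < t' -> t' <= 1 -> t' - t < eta ->
    Rabs (lambda t - lambda t') <= c * sqrt (t' - t)).
  { intros t t' Ht Htt Ht' Hd.
    pose proof (sqrt_pos (t' - t)) as Hs.
    destruct (Rlt_or_le (t' - t) (delta * (1 - t))) as [h|h].
    - assert (t' < 1) by nra.
      specialize (Hloc t t' Ht Htt H). rewrite (Rabs_left (t - t')) in Hloc by lra.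
      replace (- (t - t')) with (t' - t) in Hloc by ring.
      eapply Rle_trans; [apply Hloc; nra|]. nra.
    - assert (t0 < t) by (unfold eta in *; nra).
      assert (Hend' : Rabs (lambda t' - kappa * sqrt (1 - t')) <= nu * sqrt (1 - t')).
      { destruct (Req_dec t' 1) as [->|h'].
        - rewrite lambda_end, Rminus_diag, sqrt_0, !Rmult_0_r, Rminus_0_r, Rabs_R0. lra.
        - apply Hend. lra. }
      specialize (Hend t ltac:(lra)).
      assert (Hm : sqrt (1 - t') <= sqrt (1 - t)) by (apply sqrt_le_1_alt; lra).
      pose proof (sqrt_minus_le (1 - t) (1 - t') ltac:(lra)) as Hsub.
      replace (1 - t - (1 - t')) with (t' - t) in Hsub by ring.
      assert (Hq : sqrt delta * sqrt (1 - t) <= sqrt (t' - t)).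
      { rewrite <- sqrt_mult by lra. now apply sqrt_le_1_alt. }
      replace (lambda t - lambda t') with ((lambda t - kappa * sqrt (1 - t)) -
        (lambda t' - kappa * sqrt (1 - t')) + kappa * (sqrt (1 - t) - sqrt (1 - t'))) by ring.
      eapply Rle_trans; [apply Rabs_triang|].
      eapply Rle_trans; [apply Rplus_le_compat_r, Rabs_triang|].
      rewrite Rabs_Ropp, Rabs_mult, (Rabs_pos_eq (sqrt (1 - t) - sqrt (1 - t'))) by lra.
      assert (2 * nu * sqrt (1 - t) <= (c - Rabs kappa) * sqrt (t' - t)).
      { replace (2 * nu * sqrt (1 - t)) with ((c - Rabs kappa) * (sqrt delta * sqrt (1 - t)))
          by (unfold nu; field). apply Rmult_le_compat_l; lra. }
      assert (Rabs kappa * (sqrt (1 - t) - sqrt (1 - t')) <= Rabs kappa * sqrt (t' - t))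
        by (apply Rmult_le_compat_l; lra).
      assert (nu * sqrt (1 - t') <= nu * sqrt (1 - t)) by (apply Rmult_le_compat_l; lra).
      lra. }
  assert (Hall : forall u v, Rabs (u - v) < eta ->
    Rabs (clamped u - clamped v) <= c * sqrt (Rabs (u - v))).
  { intros u v Huv. unfold clamped.
    pose proof (clamp_lipschitz 0 1 u v ltac:(lra)) as Hcl.
    pose proof (clamp_range 0 1 u ltac:(lra)). pose proof (clamp_range 0 1 v ltac:(lra)).
    set (u' := Rmax 0 (Rmin u 1)) in *. set (v' := Rmax 0 (Rmin v 1)) in *.
    assert (Hs : sqrt (Rabs (u' - v')) <= sqrt (Rabs (u - v))) by now apply sqrt_le_1_alt.
    apply Rle_trans with (c * sqrt (Rabs (u' - v'))); [|apply Rmult_le_compat_l; lra].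
    destruct (Rtotal_order u' v') as [h|[h|h]].
    - rewrite (Rabs_left (u' - v')) in * by lra.
      replace (- (u' - v')) with (v' - u') in * by ring. apply Hlt; lra.
    - rewrite h, !Rminus_diag, Rabs_R0. apply Rmult_le_pos; [lra|apply sqrt_pos].
    - rewrite (Rabs_pos_eq (u' - v')) in * by lra.
      rewrite Rabs_minus_sym. apply Hlt; lra. }
  assert (Hcont : forall t, continuous clamped t).
  { intros t. apply filterlim_locally. intros e. pose proof (cond_pos e) as He.
    set (d := Rmin eta ((e / c) ^ 2)).
    assert (Hec : 0 < e / c) by (apply Rdiv_lt_0_compat; lra).
    assert (Hd : 0 < d) by (apply Rmin_glb_lt; [lra|nra]).
    exists (mkposreal _ Hd). intros s Hs. change (Rabs (s - t) < d) in Hs.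
    change (Rabs (clamped s - clamped t) < e).
    assert (d <= eta) by apply Rmin_l. assert (d <= (e / c) ^ 2) by apply Rmin_r.
    eapply Rle_lt_trans; [apply Hall; lra|].
    assert (Hq : sqrt (Rabs (s - t)) < e / c).
    { rewrite <- (sqrt_pow2 (e / c)) by lra. apply sqrt_lt_1_alt. split; [apply Rabs_pos|lra]. }
    apply Rlt_le_trans with (c * (e / c)); [apply Rmult_lt_compat_l; lra|].
    right; field; lra. }
  assert (Cpt : forall t, 0 <= t <= 1 -> continuity_pt clamped t).
  { intros t _. apply continuity_pt_filterlim. apply Hcont. }
  destruct (continuity_ab_maj clamped 0 1 ltac:(lra) Cpt) as [a [Ha _]].
  destruct (continuity_ab_min clamped 0 1 ltac:(lra) Cpt) as [b [Hb _]].
  exists c, eta, (Rabs (clamped a) + Rabs (clamped b)).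
  split; auto; try lra.
  intros t. set (s := Rmax 0 (Rmin t 1)).
  assert (Hs : 0 <= s <= 1) by (apply clamp_range; lra).
  replace (clamped t) with (clamped s) by (rewrite clamped_eq by exact Hs; reflexivity).
  specialize (Ha s Hs). specialize (Hb s Hs).
  pose proof (Rle_abs (clamped a)). pose proof (Rle_abs (- clamped b)). rewrite Rabs_Ropp in *.
  pose proof (Rabs_pos (clamped a)). pose proof (Rabs_pos (clamped b)).
  apply Rabs_le_between. lra.
Qed.

End Reduction.

(** * Jordan arc and spiral *)

Lemma tip_curve_exists (lam : R -> R) (c0 eta M : R) :
  regular_driver lam c0 eta M ->
  exists gam : R -> C, gam 0 = RtoC (lam 0) /\
    forall T, 0 < T <= 1 -> exists g, chord lam g T 0 /\ g 0 = gam T.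
Proof.
  intros driver.
  assert (H : forall T, exists z : C, (T = 0 -> z = RtoC (lam 0)) /\
    (0 < T <= 1 -> exists g, chord lam g T 0 /\ g 0 = z)).
  { intros T. destruct (classic (0 < T <= 1)) as [HT|HT].
    - destruct (chord_exists lam c0 eta M driver T HT) as [g Hg].
      exists (g 0). split; [lra|]. intros _. now exists g.
    - exists (RtoC (lam 0)). tauto. }
  exists (fun T => proj1_sig (constructive_indefinite_description _ (H T))). split.
  - destruct (constructive_indefinite_description _ (H 0)) as [z Hz]. simpl. now apply Hz.
  - intros T. destruct (constructive_indefinite_description _ (H T)) as [z Hz]. simpl. apply Hz.
Qed.

Theorem theorem6p2 (lambda : R -> R) (kappa C0 : R)
    (hcont : continuous_on (fun t => 0 <= t <= 1) lambda)
    (hlim : filterlim (fun t => lambda t / sqrt (1 - t)) (at_left 1)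
              (locally kappa))
    (hkappa : Rabs kappa < 4)
    (hC0 : C0 < 4)
    (hlip : local_lip_half_lt lambda C0) :
  (exists gamma : R -> C, is_trace lambda gamma) /\
  forall gamma : R -> C, is_trace lambda gamma ->
    jordan_arc gamma 0 1 /\
    upper_half_plane (gamma 1) /\
    exists theta : R, - PI / 2 < theta < PI / 2 /\
      kappa = - 4 * sin theta /\
      asymptotically_similar_to_spiral gamma theta.
Proof.
  destruct (clamped_driver lambda kappa C0 hcont hlim hkappa hC0 hlip)
    as [c [eta [M driver]]].
  set (lam := clamped lambda) in *.
  assert (Elam : forall s, 0 <= s < 1 -> lam s = lambda s).
  { intros s Hs. apply clamped_eq. lra. }
  destruct (tip_curve_exists lam c eta M driver) as [gam [gam_0 gam_tip]].
  split.
  - exists gam. apply (is_trace_ext lam lambda gam Elam).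
    now apply (trace_is_trace lam c eta M).
  - intros gamma Hgamma.
    assert (Htr : is_trace lam gamma).
    { apply (is_trace_ext lambda lam gamma); [|exact Hgamma].
      intros s Hs. symmetry. now apply Elam. }
    pose proof (trace_unique lam c eta M driver gam gam_0 gam_tip gamma Htr) as Heq.
    destruct (gam_tip 1 ltac:(lra)) as [G [HG HG0]].
    assert (Hnear : forall e, 0 < e -> exists t0, 0 <= t0 < 1 /\ forall t, t0 <= t < 1 ->
      Rabs (lam t - kappa * sqrt (1 - t)) <= e * sqrt (1 - t)).
    { intros e He. destruct (near_end lambda kappa hlim e He) as [t0 [Ht0 H]].
      exists t0. split; [exact Ht0|]. intros t Ht. rewrite Elam by lra. now apply H. }
    split; [|split].
    + split; [apply Htr|]. intros s t Hs Ht E. rewrite !Heq in E by lra.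
      now apply (trace_injective lam c eta M driver gam gam_0 gam_tip).
    + unfold upper_half_plane. rewrite Heq by lra.
      now apply (tip_height lam c eta M driver gam gam_tip 1); lra.
    + exists (spiral_angle kappa). split; [now apply spiral_angle_range|].
      split; [now apply sin_spiral_angle|].
      pose proof (tip_similar_to_spiral lam c eta M driver gam gam_0 gam_tip kappa G
        hkappa Hnear HG HG0) as Hsp.
      intros u Hu e He. destruct (Hsp u Hu e He) as [s0 Hs0].
      exists (Rmax 0 s0). intros s Hs. pose proof (Rmax_l 0 s0). pose proof (Rmax_r 0 s0).
      specialize (Hs0 s ltac:(lra)).
      (* On [0, 1] the two curves agree, so the rescaled arcs are the same sets. *)
      assert (Hg : forall w, 0 <= w -> gamma (1 - exp (- w)) = gam (1 - exp (- w))).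
      { intros w Hw. apply Heq. pose proof (exp_pos (- w)).
        assert (exp (- w) <= 1); [|lra]. rewrite <- exp_0. apply exp_monotone. lra. }
      eapply Rbar_le_lt_trans; [|exact Hs0].
      unfold hausdorff_dist. apply Glb_Rbar_correct. intros x [Hx [HA HB]].
      apply Glb_Rbar_correct. split; [exact Hx|]. split.
      * intros z [v [Hv ->]]. apply HA. exists v. split; [exact Hv|].
        rewrite !Hg, Heq by lra. reflexivity.
      * intros y Hy. destruct (HB y Hy) as [z [[v [Hv ->]] Hz]].
        eexists. split; [exists v; split; [exact Hv|reflexivity]|].
        rewrite !Hg, Heq by lra. exact Hz.
Qed.
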